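(* Over $\mathrm{WKL}_0$, weak Martin's pointed tree theorem $\mathrm{wMPT}$ does not imply $\mathrm{ACA}_0$; that is, $\mathrm{WKL}_0+\mathrm{wMPT}\not\vdash \mathrm{ACA}_0$.
   Context: All theories are in the language of second order arithmetic, with models $(N,M,0,1,+,\times,<)$, where $N$ is the number sort and $M$ is the sort of sets of numbers (equivalently, up to coding, functions from numbers to numbers, called reals). $\mathrm{WKL}_0$ is the usual base system $\mathrm{RCA}_0$ plus the statement that every infinite binary tree has an infinite path. $\mathrm{ACA}_0$ is the usual system including all arithmetical comprehension axioms. $\leq_{\rm T}$ denotes Turing reducibility. A tree $T\subseteq\omega^{<\omega}$ is a set of finite strings closed under initial segments; $[T]$ is the collection of its infinite paths. A perfect tree is a nonempty tree in which every node has two incompatible extensions in the tree. A set $A$ of reals is cofinal if for every real $x$ there is some $y\in A$ with $y\geq_{\rm T} x$. Weak Martin's pointed tree theorem, $\mathrm{wMPT}$, is the statement (formulated in second order arithmetic): for every tree $T\subseteq\omega^{<\omega}$, if $[T]$ is cofinal, then $T$ has a perfect subtree. *)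

(* Defs.v *)
From Stdlib Require Import List.

(** De Bruijn syntax with two independent families of variables: [Var i] is the
    number variable bound by the [i]-th enclosing number quantifier, and the
    second argument of [In] refers to the enclosing set quantifiers. *)

Inductive term : Type :=
| Var (i : nat)
| Zero
| One
| Plus (s t : term)
| Times (s t : term).

Inductive form : Type :=
| Eq (s t : term)
| Lt (s t : term)
| In (t : term) (X : nat)
| Bot
| Imp (p q : form)
| And (p q : form)
| Or (p q : form)
| AllN (p : form)
| ExN (p : form)
| AllS (p : form)
| ExS (p : form).

Definition Neg (p : form) : form := Imp p Bot.
Definition Iff (p q : form) : form := And (Imp p q) (Imp q p).

Definition scons {A : Type} (a : A) (f : nat -> A) (n : nat) : A :=
  match n with O => a | S k => f k end.

Fixpoint subst_term (s : nat -> term) (t : term) : term :=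
  match t with
  | Var i => s i
  | Zero => Zero
  | One => One
  | Plus t u => Plus (subst_term s t) (subst_term s u)
  | Times t u => Times (subst_term s t) (subst_term s u)
  end.

Definition lift_term : term -> term := subst_term (fun i => Var (S i)).

Definition up_num (s : nat -> term) : nat -> term :=
  scons (Var 0) (fun i => lift_term (s i)).
Definition up_set (r : nat -> nat) : nat -> nat :=
  scons 0 (fun X => S (r X)).

(** There are no set terms, so set variables are only ever renamed. *)
Fixpoint subst (s : nat -> term) (r : nat -> nat) (p : form) : form :=
  match p with
  | Eq t u => Eq (subst_term s t) (subst_term s u)
  | Lt t u => Lt (subst_term s t) (subst_term s u)
  | In t X => In (subst_term s t) (r X)
  | Bot => Bot
  | Imp p q => Imp (subst s r p) (subst s r q)
  | And p q => And (subst s r p) (subst s r q)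
  | Or p q => Or (subst s r p) (subst s r q)
  | AllN p => AllN (subst (up_num s) r p)
  | ExN p => ExN (subst (up_num s) r p)
  | AllS p => AllS (subst s (up_set r) p)
  | ExS p => ExS (subst s (up_set r) p)
  end.

Definition lift_num : form -> form := subst (fun i => Var (S i)) (fun X => X).
Definition lift_set : form -> form := subst Var S.
Definition inst_num (t : term) : form -> form := subst (scons t Var) (fun X => X).
Definition inst_set (Y : nat) : form -> form := subst Var (scons Y (fun X => X)).

(** Rule [nd_ax] makes axioms available in every context, also below the
    eigenvariable rules; hence an axiom with free variables has the strength of
    its universal closure. *)

Definition theory : Type := form -> Prop.

Inductive nd (T : theory) : list form -> form -> Prop :=
| nd_ax G p : T p -> nd T G p
| nd_hyp G p : List.In p G -> nd T G p
| nd_dne G p : nd T G (Neg (Neg p)) -> nd T G p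
| nd_botE G p : nd T G Bot -> nd T G p
| nd_impI G p q : nd T (p :: G) q -> nd T G (Imp p q)
| nd_impE G p q : nd T G (Imp p q) -> nd T G p -> nd T G q
| nd_andI G p q : nd T G p -> nd T G q -> nd T G (And p q)
| nd_andE1 G p q : nd T G (And p q) -> nd T G p
| nd_andE2 G p q : nd T G (And p q) -> nd T G q
| nd_orI1 G p q : nd T G p -> nd T G (Or p q)
| nd_orI2 G p q : nd T G q -> nd T G (Or p q)
| nd_orE G p q r :
    nd T G (Or p q) -> nd T (p :: G) r -> nd T (q :: G) r -> nd T G r
| nd_allNI G p : nd T (map lift_num G) p -> nd T G (AllN p)
| nd_allNE G p t : nd T G (AllN p) -> nd T G (inst_num t p)
| nd_exNI G p t : nd T G (inst_num t p) -> nd T G (ExN p)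
| nd_exNE G p q :
    nd T G (ExN p) -> nd T (p :: map lift_num G) (lift_num q) -> nd T G q
| nd_allSI G p : nd T (map lift_set G) p -> nd T G (AllS p)
| nd_allSE G p Y : nd T G (AllS p) -> nd T G (inst_set Y p)
| nd_exSI G p Y : nd T G (inst_set Y p) -> nd T G (ExS p)
| nd_exSE G p q :
    nd T G (ExS p) -> nd T (p :: map lift_set G) (lift_set q) -> nd T G q
| nd_eq_refl G t : nd T G (Eq t t)
| nd_eq_subst G p t u :
    nd T G (Eq t u) -> nd T G (inst_num t p) -> nd T G (inst_num u p).

Definition provable (T : theory) (p : form) : Prop := nd T nil p.

Definition proves (T U : theory) : Prop := forall p, U p -> provable T p.

Definition extend (T : theory) (p : form) : theory := fun q => T q \/ q = p.

(** An [hform] is a formula relative to the numbers of number and set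
    quantifiers above it. A binder hands its body a variable that remembers its
    own level and turns it into a de Bruijn index at each place of use, so
    abbreviations can be combined without explicit lifting. *)

Definition hterm : Type := nat -> term.
Definition hset : Type := nat -> nat.
Definition hform : Type := nat -> nat -> form.

Definition hZero : hterm := fun _ => Zero.
Definition hOne : hterm := fun _ => One.
Definition hPlus (s t : hterm) : hterm := fun d => Plus (s d) (t d).
Definition hTimes (s t : hterm) : hterm := fun d => Times (s d) (t d).
Definition hEq (s t : hterm) : hform := fun d _ => Eq (s d) (t d).
Definition hLt (s t : hterm) : hform := fun d _ => Lt (s d) (t d).
Definition hIn (t : hterm) (X : hset) : hform := fun d e => In (t d) (X e).
Definition hNeg (p : hform) : hform := fun d e => Neg (p d e).
Definition hImp (p q : hform) : hform := fun d e => Imp (p d e) (q d e).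
Definition hIff (p q : hform) : hform := fun d e => Iff (p d e) (q d e).
Definition hAnd (p q : hform) : hform := fun d e => And (p d e) (q d e).
Definition hOr (p q : hform) : hform := fun d e => Or (p d e) (q d e).
Definition hAllN (p : hterm -> hform) : hform :=
  fun d e => AllN (p (fun d' => Var (d' - S d)) (S d) e).
Definition hExN (p : hterm -> hform) : hform :=
  fun d e => ExN (p (fun d' => Var (d' - S d)) (S d) e).
Definition hAllS (p : hset -> hform) : hform :=
  fun d e => AllS (p (fun e' => e' - S e) d (S e)).
Definition hExS (p : hset -> hform) : hform :=
  fun d e => ExS (p (fun e' => e' - S e) d (S e)).

Definition sentence (p : hform) : form := p 0 0.

Declare Scope l2_scope.
Delimit Scope l2_scope with l2.
Bind Scope l2_scope with hterm hform.
Local Open Scope l2_scope.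

Local Notation "0" := hZero : l2_scope.
Local Notation "1" := hOne : l2_scope.
Local Notation "s + t" := (hPlus s t) : l2_scope.
Local Notation "s * t" := (hTimes s t) : l2_scope.
Local Notation "s = t" := (hEq s t) : l2_scope.
Local Notation "s < t" := (hLt s t) : l2_scope.
Local Notation "t ∈ X" := (hIn t X) (at level 70) : l2_scope.
Local Notation "¬ p" := (hNeg p) (at level 75, right associativity) : l2_scope.
Local Notation "p ∧ q" := (hAnd p q) (at level 80, right associativity) : l2_scope.
Local Notation "p ∨ q" := (hOr p q) (at level 85, right associativity) : l2_scope.
Local Notation "p ⇒ q" := (hImp p q) (at level 99, right associativity, q at level 200) : l2_scope.
Local Notation "p ⇔ q" := (hIff p q) (at level 95, no associativity) : l2_scope.
Local Notation "'∀' x .. y , p" := (hAllN (fun x => .. (hAllN (fun y => p)) ..))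
  (at level 200, x binder, y binder, right associativity) : l2_scope.
Local Notation "'∃' x .. y , p" := (hExN (fun x => .. (hExN (fun y => p)) ..))
  (at level 200, x binder, y binder, right associativity) : l2_scope.
Local Notation "'∀set' X .. Y , p" := (hAllS (fun X => .. (hAllS (fun Y => p)) ..))
  (at level 200, X binder, Y binder, right associativity) : l2_scope.
Local Notation "'∃set' X .. Y , p" := (hExS (fun X => .. (hExS (fun Y => p)) ..))
  (at level 200, X binder, Y binder, right associativity) : l2_scope.

Inductive basic_axiom : theory :=
| ax_succ_nonzero : basic_axiom (sentence (∀ n, ¬ n + 1 = 0))
| ax_succ_inj : basic_axiom (sentence (∀ m n, m + 1 = n + 1 ⇒ m = n))
| ax_add_0 : basic_axiom (sentence (∀ m, m + 0 = m))
| ax_add_succ : basic_axiom (sentence (∀ m n, m + (n + 1) = (m + n) + 1))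
| ax_mul_0 : basic_axiom (sentence (∀ m, m * 0 = 0))
| ax_mul_succ : basic_axiom (sentence (∀ m n, m * (n + 1) = m * n + m))
| ax_lt_0 : basic_axiom (sentence (∀ m, ¬ m < 0))
| ax_lt_succ : basic_axiom (sentence (∀ m n, m < n + 1 ⇔ m < n ∨ m = n)).

Definition set_induction : form :=
  sentence (∀set X, 0 ∈ X ∧ (∀ n, n ∈ X ⇒ n + 1 ∈ X) ⇒ ∀ n, n ∈ X).

(** Bounded quantifier formulas; lifting the bound [t] expresses that it does
    not contain the quantified variable. *)
Inductive delta00 : form -> Prop :=
| delta00_eq s t : delta00 (Eq s t)
| delta00_lt s t : delta00 (Lt s t)
| delta00_in t X : delta00 (In t X)
| delta00_bot : delta00 Bot
| delta00_imp p q : delta00 p -> delta00 q -> delta00 (Imp p q)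
| delta00_and p q : delta00 p -> delta00 q -> delta00 (And p q)
| delta00_or p q : delta00 p -> delta00 q -> delta00 (Or p q)
| delta00_all t p :
    delta00 p -> delta00 (AllN (Imp (Lt (Var 0) (lift_term t)) p))
| delta00_ex t p :
    delta00 p -> delta00 (ExN (And (Lt (Var 0) (lift_term t)) p)).

Inductive sigma01 : form -> Prop :=
| sigma01_ex p : delta00 p -> sigma01 (ExN p).

Inductive pi01 : form -> Prop :=
| pi01_all p : delta00 p -> pi01 (AllN p).

(** Set parameters are allowed, set quantifiers are not. *)
Fixpoint arithmetical (p : form) : Prop :=
  match p with
  | Eq _ _ | Lt _ _ | In _ _ | Bot => True
  | Imp p q | And p q | Or p q => arithmetical p /\ arithmetical q
  | AllN p | ExN p => arithmetical p
  | AllS _ | ExS _ => False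
  end.

(** In both schemes the distinguished number variable of [p] is [Var 0]; all
    other free variables are parameters. In [comprehension] lifting [p]
    prevents the new set from occurring in it. *)
Definition induction (p : form) : form :=
  Imp (And (inst_num Zero p)
           (AllN (Imp p (subst (scons (Plus (Var 0) One) (fun i => Var (S i)))
                               (fun X => X) p))))
      (AllN p).

Definition comprehension (p : form) : form :=
  ExS (AllN (Iff (In (Var 0) 0) (lift_set p))).

Inductive RCA0 : theory :=
| RCA0_basic p : basic_axiom p -> RCA0 p
| RCA0_induction p : sigma01 p -> RCA0 (induction p)
| RCA0_comp p q : sigma01 p -> pi01 q ->
    RCA0 (Imp (AllN (Iff p q)) (comprehension p)).

Inductive ACA0 : theory :=
| ACA0_basic p : basic_axiom p -> ACA0 p
| ACA0_induction : ACA0 set_induction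
| ACA0_comp p : arithmetical p -> ACA0 (comprehension p).

Definition pair (x y : hterm) : hterm := (x + y) * (x + y) + x.

(** The triple (k, (m, n)) represents the finite set of those [i < k] for which
    [m (i + 1) + 1] divides [n]. *)
Definition fin_mem (i c : hterm) : hform :=
  ∃ k m n, c = pair k (pair m n) ∧ i < k ∧ ∃ q, n = (m * (i + 1) + 1) * q.

(** The code of a finite set is the least number representing it. A number that
    is not a triple has no [fin_mem]-members and is excluded because 0 is a
    triple representing the empty set. *)
Definition fin_code (c : hterm) : hform :=
  ∀ d, d < c ⇒ ¬ ∀ i, fin_mem i c ⇔ fin_mem i d.

(** Finite sequences are identified with their graphs. *)
Definition entry (s i j : hterm) : hform := fin_mem (pair i j) s.

Definition seq (s : hterm) : hform :=
  fin_code s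
  ∧ (∀ n, fin_mem n s ⇒ ∃ i j, n = pair i j)
  ∧ (∀ i j k, entry s i j ∧ entry s i k ⇒ j = k)
  ∧ ∃ l, ∀ i, i < l ⇔ ∃ j, entry s i j.

Definition initial (s t : hterm) : hform := ∀ i j, entry s i j ⇒ entry t i j.

Definition incompatible (s t : hterm) : hform := ¬ initial s t ∧ ¬ initial t s.

Definition tree (T : hset) : hform :=
  (∀ s, s ∈ T ⇒ seq s) ∧ ∀ s t, s ∈ T ∧ seq t ∧ initial t s ⇒ t ∈ T.

Definition binary_tree (T : hset) : hform :=
  tree T ∧ ∀ s i j, s ∈ T ∧ entry s i j ⇒ j = 0 ∨ j = 1.

Definition infinite (X : hset) : hform := ∀ m, ∃ n, m < n ∧ n ∈ X.

Definition func (F : hset) : hform :=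
  (∀ n, n ∈ F ⇒ ∃ i j, n = pair i j)
  ∧ (∀ i j k, pair i j ∈ F ∧ pair i k ∈ F ⇒ j = k)
  ∧ ∀ i, ∃ j, pair i j ∈ F.

Definition path (F T : hset) : hform :=
  func F ∧ ∀ s, seq s ∧ (∀ i j, entry s i j ⇒ pair i j ∈ F) ⇒ s ∈ T.

Definition perfect_tree (P : hset) : hform :=
  tree P
  ∧ (∃ s, s ∈ P)
  ∧ ∀ s, s ∈ P ⇒
      ∃ t u, t ∈ P ∧ u ∈ P ∧ initial s t ∧ initial s u ∧ incompatible t u.

Definition subset (X Y : hset) : hform := ∀ n, n ∈ X ⇒ n ∈ Y.

(** Kleene's partial recursive functions relative to [Y], in unary form: tuples
    are coded by [pair], and an index [e] denotes
    - [(0, 0)], ..., [(0, 5)]: zero, successor, identity, the two projections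
      of a pair, the characteristic function of the oracle [Y];
    - [(1, (a, b))]: [x |-> {a}({b}(x))];
    - [(2, (a, b))]: [x |-> ({a}(x), {b}(x))];
    - [(3, (a, b))]: primitive recursion, [(p, 0) |-> {a}(p)] and
      [(p, n + 1) |-> {b}(p, (n, {e}(p, n)))];
    - [(4, a)]: minimization, [x |-> the least y with {a}(x, y) = 0].

    [rule Y J e x y] says that the computation [{e}(x) = y] follows in one step
    from computations [{e'}(x') = y'] with [J e' x' y']. *)

Definition rule (Y : hset) (J : hterm -> hterm -> hterm -> hform)
    (e x y : hterm) : hform :=
  (e = pair 0 0 ∧ y = 0)
  ∨ (e = pair 0 1 ∧ y = x + 1)
  ∨ (e = pair 0 (1 + 1) ∧ y = x)
  ∨ (e = pair 0 (1 + 1 + 1) ∧ ∃ z, x = pair y z)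
  ∨ (e = pair 0 (1 + 1 + 1 + 1) ∧ ∃ z, x = pair z y)
  ∨ (e = pair 0 (1 + 1 + 1 + 1 + 1)
     ∧ ((x ∈ Y ∧ y = 1) ∨ (¬ x ∈ Y ∧ y = 0)))
  ∨ (∃ a b, e = pair 1 (pair a b) ∧ ∃ z, J b x z ∧ J a z y)
  ∨ (∃ a b, e = pair (1 + 1) (pair a b)
       ∧ ∃ u v, J a x u ∧ J b x v ∧ y = pair u v)
  ∨ (∃ a b, e = pair (1 + 1 + 1) (pair a b) ∧ ∃ p n, x = pair p n
       ∧ ((n = 0 ∧ J a p y)
          ∨ ∃ m z, n = m + 1 ∧ J e (pair p m) z
                   ∧ J b (pair p (pair m z)) y))
  ∨ (∃ a, e = pair (1 + 1 + 1 + 1) a ∧ J a (pair x y) 0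
       ∧ ∀ w, w < y ⇒ ∃ v, J a (pair x w) (v + 1)).

(** A computation is a finite sequence of triples (e, (x, y)), each of which
    follows from earlier ones. *)
Definition computation (Y : hset) (d : hterm) : hform :=
  seq d ∧ ∀ i n, entry d i n ⇒ ∃ e x y, n = pair e (pair x y)
    ∧ rule Y (fun e' x' y' =>
                ∃ j, j < i ∧ entry d j (pair e' (pair x' y'))) e x y.

Definition computes (Y : hset) (e x y : hterm) : hform :=
  ∃ d, computation Y d ∧ ∃ i, entry d i (pair e (pair x y)).

Definition turing_le (X Y : hset) : hform :=
  ∃ e, ∀ n, (n ∈ X ⇒ computes Y e n 1) ∧ (¬ n ∈ X ⇒ computes Y e n 0).

Definition WKL : form :=
  sentence (∀set T, binary_tree T ∧ infinite T ⇒ ∃set F, path F T).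

Definition WKL0 : theory := extend RCA0 WKL.

Definition cofinal_paths (T : hset) : hform :=
  ∀set X, ∃set F, path F T ∧ turing_le X F.

Definition wMPT : form :=
  sentence (∀set T, tree T ∧ cofinal_paths T ⇒
              ∃set P, perfect_tree P ∧ subset P T).

(* Main.v *)
From Stdlib Require Import List Arith Lia Classical ClassicalEpsilon FunctionalExtensionality PropExtensionality Reals Lra.
Require Import Defs.
Import ListNotations.

(** The separating model is an omega-model whose sets are coded by a union [M] of
    countable Turing ideals [L 0], [L 1], ... such that every function in [M] is
    dominated by one in each [L i].

    [L 0] contains an array [A] whose columns converge to a limit [c] outside
    [L 0]. Arithmetical comprehension would put a modulus of convergence of [A]
    into [M]; it would be dominated in [L 0], which would compute [c].

    [L (i + 1)] adjoins to [L i] a path through an infinite binary tree together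
    with a real [z] random over [L i]. Both come from one forcing, whose
    conditions are trees of pairs having, at some path component, sections of
    measure bounded below; a fusion by deleting sets of small measure makes the
    extension dominated by [L i]. Bookkeeping makes weak Koenig's lemma true in [M].

    For wMPT let [T] be a tree in [L i] and let [F] in [M] be a path of [T] that
    computes [z]. Bounds in [L i] for [F] and for the use of the computation give
    a bounded subtree of [T] whose image under the computation is a closed set
    in [L i] containing [z], hence of positive measure. Such a tree has a perfect
    subtree with splitting levels that are known in advance, and those form a
    nonempty Pi01 class in [M], so one of them belongs to [M]. *)

(** * Semantics and soundness *)

(** Cofinality by itself says little: for each real of the model it supplies one path computing that
    real. Randomness turns this single path into evidence of size, since a closed set coded in [L i]
    that contains a real random over [L i] cannot be null. Domination is what brings the closed set
    down into [L i], because the path and the use of the computation appear only at later levels;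
    the same property keeps a modulus of convergence out of the model. The perfect tree found by
    measure consists of nodes above which the measure stays bounded below at all levels, an infinite
    condition, so nothing places this tree in the model. Only its splitting levels are computed from
    data in [L i]. With them prescribed, perfectness needs no unbounded search, and weak Koenig's
    lemma supplies a possibly different perfect subtree inside the model. Relative computability is
    handled through associates of continuous operators: membership in an ideal reduces to continuity
    at a point. For the same reason [A] is obtained by finite extension forcing against all terms
    over the operators, and its limit plays the part of the halting problem. *)

Fixpoint tval (e : nat -> nat) (t : term) : nat :=
  match t with
  | Var i => e i
  | Zero => 0
  | One => 1
  | Plus s t => tval e s + tval e t
  | Times s t => tval e s * tval e t
  end.

Fixpoint sat (M : (nat -> Prop) -> Prop) (e : nat -> nat) (r : nat -> nat -> Prop)
    (p : form) : Prop :=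
  match p with
  | Eq s t => tval e s = tval e t
  | Lt s t => tval e s < tval e t
  | In t X => r X (tval e t)
  | Bot => False
  | Imp p q => sat M e r p -> sat M e r q
  | And p q => sat M e r p /\ sat M e r q
  | Or p q => sat M e r p \/ sat M e r q
  | AllN p => forall n, sat M (scons n e) r p
  | ExN p => exists n, sat M (scons n e) r p
  | AllS p => forall X, M X -> sat M e (scons X r) p
  | ExS p => exists X, M X /\ sat M e (scons X r) p
  end.

Lemma tval_subst e s t : tval e (subst_term s t) = tval (fun i => tval e (s i)) t.
Proof. induction t; simpl; congruence. Qed.

Lemma sat_subst M p : forall e r s v,
  sat M e r (subst s v p) <-> sat M (fun i => tval e (s i)) (fun X => r (v X)) p.
Proof.
  assert (Hn : forall e s n, (fun i => tval (scons n e) (up_num s i))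
                             = scons n (fun i => tval e (s i))).
  { intros e s n. extensionality i. destruct i; simpl; auto.
    unfold lift_term. now rewrite tval_subst. }
  assert (Hs : forall (r : nat -> nat -> Prop) v X,
             (fun i => scons X r (up_set v i)) = scons X (fun i => r (v i))).
  { intros r v X. extensionality i. now destruct i. }
  induction p; intros e r s' v; simpl; rewrite ?tval_subst; try tauto.
  1-3: rewrite IHp1, IHp2; tauto.
  - split; intros H n; specialize (H n); rewrite IHp, Hn in *; exact H.
  - split; intros [n H]; exists n; rewrite IHp, Hn in *; exact H.
  - split; intros H X HX; specialize (H X HX); rewrite IHp, Hs in *; exact H.
  - split; intros [X [HX H]]; exists X; rewrite IHp, Hs in *; auto.
Qed.

Lemma sat_lift_num M e r n p : sat M (scons n e) r (lift_num p) <-> sat M e r p.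
Proof. unfold lift_num. now rewrite sat_subst. Qed.

Lemma sat_lift_set M e r X p : sat M e (scons X r) (lift_set p) <-> sat M e r p.
Proof. unfold lift_set. now rewrite sat_subst. Qed.

Lemma sat_inst_num M e r t p :
  sat M e r (inst_num t p) <-> sat M (scons (tval e t) e) r p.
Proof.
  unfold inst_num. rewrite sat_subst.
  replace (fun i => tval e (scons t Var i)) with (scons (tval e t) e); [tauto|].
  extensionality i. now destruct i.
Qed.

Lemma sat_inst_set M e r Y p :
  sat M e r (inst_set Y p) <-> sat M e (scons (r Y) r) p.
Proof.
  unfold inst_set. rewrite sat_subst.
  replace (fun X => r (scons Y (fun X0 => X0) X)) with (scons (r Y) r); [tauto|].
  extensionality i. now destruct i.
Qed.

(** The axioms are required to hold in every environment with sets from [M], because [nd_ax] may be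
    used below the eigenvariable rules, where the environment has changed. *)
Lemma sat_sound (M : (nat -> Prop) -> Prop) (T : theory) :
  (forall p e r, T p -> (forall X, M (r X)) -> sat M e r p) ->
  forall G p, nd T G p -> forall e r, (forall X, M (r X)) ->
    (forall q, List.In q G -> sat M e r q) -> sat M e r p.
Proof.
  intros HT.
  assert (Hsc : forall X (r : nat -> nat -> Prop), M X -> (forall Y, M (r Y)) ->
    forall Y, M (scons X r Y)) by (intros X r HX Hr [|Y]; simpl; auto).
  induction 1; intros e v Hr HG; simpl in *.
  - now apply HT.
  - now apply HG.
  - apply NNPP. intro Hn. now apply (IHnd e v Hr HG).
  - now destruct (IHnd e v Hr HG).
  - intros Hp. apply IHnd; auto. intros q' [<-|Hq]; auto.
  - now apply (IHnd1 e v Hr HG), IHnd2.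
  - split; auto.
  - now apply (IHnd e v).
  - now apply (IHnd e v).
  - left; auto.
  - right; auto.
  - destruct (IHnd1 e v Hr HG) as [Hp|Hq]; [apply IHnd2|apply IHnd3]; auto.
    + intros q' [<-|Hq']; auto.
    + intros q' [<-|Hq']; auto.
  - intros n. apply IHnd; auto. intros q Hq. apply in_map_iff in Hq.
    destruct Hq as [q' [<- Hq]]. rewrite sat_lift_num. auto.
  - rewrite sat_inst_num. now apply (IHnd e v).
  - exists (tval e t). rewrite <- sat_inst_num. auto.
  - destruct (IHnd1 e v Hr HG) as [n Hn].
    rewrite <- (sat_lift_num M e v n). apply IHnd2; auto.
    intros q' [<-|Hq]; auto. apply in_map_iff in Hq.
    destruct Hq as [q'' [<- Hq]]. rewrite sat_lift_num. auto.
  - intros X HX. apply IHnd; auto. intros q Hq. apply in_map_iff in Hq.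
    destruct Hq as [q' [<- Hq]]. rewrite sat_lift_set. auto.
  - rewrite sat_inst_set. now apply (IHnd e v).
  - exists (v Y). split; auto. rewrite <- sat_inst_set. auto.
  - destruct (IHnd1 e v Hr HG) as [X [HX Hn]].
    rewrite <- (sat_lift_set M e v X). apply IHnd2; auto.
    intros q' [<-|Hq]; auto. apply in_map_iff in Hq.
    destruct Hq as [q'' [<- Hq]]. rewrite sat_lift_set. auto.
  - reflexivity.
  - rewrite sat_inst_num in *. rewrite <- (IHnd1 e v Hr HG).
    rewrite <- sat_inst_num. auto.
Qed.

(** A single [K] bounds the free variables; [m] is the use of the set parameters. *)
Lemma delta00_use M p : delta00 p -> exists K, forall e r, exists m,
  forall e' r', (forall i, i < K -> e i = e' i) ->
    (forall X j, X < K -> j < m -> (r X j <-> r' X j)) ->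
    (sat M e r p <-> sat M e' r' p).
Proof.
  assert (Ht : forall t, exists K, forall e e',
    (forall i, i < K -> e i = e' i) -> tval e t = tval e' t).
  { induction t as [i| | |s [K1 H1] t [K2 H2]|s [K1 H1] t [K2 H2]]; simpl.
    - exists (S i). intros e e' H. apply H. lia.
    - exists 0; auto.
    - exists 0; auto.
    - exists (K1 + K2). intros e e' H.
      rewrite (H1 e e'), (H2 e e'); auto; intros; apply H; lia.
    - exists (K1 + K2). intros e e' H.
      rewrite (H1 e e'), (H2 e e'); auto; intros; apply H; lia. }
  assert (Hlift : forall n e t, tval (scons n e) (lift_term t) = tval e t).
  { intros n e t. unfold lift_term. now rewrite tval_subst. }
  (* A bounded quantifier has finitely many instances, so the sum of their uses serves for all of
     them. *)
  assert (Hb : forall K p, (forall e r, exists m,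
      forall e' r', (forall i, i < K -> e i = e' i) ->
        (forall X j, X < K -> j < m -> (r X j <-> r' X j)) ->
        (sat M e r p <-> sat M e' r' p)) ->
      forall b e r, exists m, forall n, n < b -> forall e' r', (forall i, i < K -> e i = e' i) ->
        (forall X j, X < K -> j < m -> (r X j <-> r' X j)) ->
        (sat M (scons n e) r p <-> sat M (scons n e') r' p)).
  { intros K q H b e r. induction b as [|b [m1 H1]].
    - exists 0. lia.
    - destruct (H (scons b e) r) as [m2 H2]. exists (m1 + m2).
      intros n Hn e' r' He Hr. assert (n < b \/ n = b) as [Hlt| ->] by lia.
      + apply H1; auto. intros; apply Hr; lia.
      + apply H2; [intros [|i] Hi; simpl; auto; apply He; lia|].
        intros; apply Hr; lia. }
  induction 1.
  - destruct (Ht s) as [K1 H1], (Ht t) as [K2 H2]. exists (K1 + K2). intros e r.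
    exists 0. intros e' r' He _. simpl.
    rewrite (H1 e e'), (H2 e e'); try tauto; intros; apply He; lia.
  - destruct (Ht s) as [K1 H1], (Ht t) as [K2 H2]. exists (K1 + K2). intros e r.
    exists 0. intros e' r' He _. simpl.
    rewrite (H1 e e'), (H2 e e'); try tauto; intros; apply He; lia.
  - destruct (Ht t) as [K1 H1]. exists (K1 + S X). intros e r.
    exists (S (tval e t)). intros e' r' He Hr. simpl.
    rewrite <- (H1 e e') by (intros; apply He; lia). apply Hr; lia.
  - exists 0. intros e r. exists 0. simpl. tauto.
  - destruct IHdelta00_1 as [K1 H1], IHdelta00_2 as [K2 H2]. exists (K1 + K2).
    intros e r. destruct (H1 e r) as [m1 G1], (H2 e r) as [m2 G2].
    exists (m1 + m2). intros e' r' He Hr. simpl.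
    rewrite (G1 e' r'), (G2 e' r'); try tauto; intros; try apply He; try apply Hr; lia.
  - destruct IHdelta00_1 as [K1 H1], IHdelta00_2 as [K2 H2]. exists (K1 + K2).
    intros e r. destruct (H1 e r) as [m1 G1], (H2 e r) as [m2 G2].
    exists (m1 + m2). intros e' r' He Hr. simpl.
    rewrite (G1 e' r'), (G2 e' r'); try tauto; intros; try apply He; try apply Hr; lia.
  - destruct IHdelta00_1 as [K1 H1], IHdelta00_2 as [K2 H2]. exists (K1 + K2).
    intros e r. destruct (H1 e r) as [m1 G1], (H2 e r) as [m2 G2].
    exists (m1 + m2). intros e' r' He Hr. simpl.
    rewrite (G1 e' r'), (G2 e' r'); try tauto; intros; try apply He; try apply Hr; lia.
  - destruct (Ht t) as [K1 H1], IHdelta00 as [K2 H2]. exists (K1 + K2).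
    intros e r. destruct (Hb K2 p H2 (tval e t) e r) as [m Hm]. exists m.
    intros e' r' He Hr. simpl. setoid_rewrite Hlift.
    rewrite <- (H1 e e') by (intros; apply He; lia).
    split; intros G n Hn; specialize (G n Hn);
      (eapply Hm; [exact Hn| | |exact G]; intros; try apply He; try apply Hr; lia).
  - destruct (Ht t) as [K1 H1], IHdelta00 as [K2 H2]. exists (K1 + K2).
    intros e r. destruct (Hb K2 p H2 (tval e t) e r) as [m Hm]. exists m.
    intros e' r' He Hr. simpl. setoid_rewrite Hlift.
    rewrite <- (H1 e e') by (intros; apply He; lia).
    split; intros [n [Hn G]]; exists n; split; auto;
      (eapply Hm; [exact Hn| | |exact G]; intros; try apply He; try apply Hr; lia).
Qed.

(** * Codes of finite sequences and computations *)

(** The capitalized notions up to [Turing_le] are the meanings of the formulas of the same names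
    over the standard numbers. They repeat the shape of the formulas, down to numerals such as
    [1 + 1 + 1], so that [sat_WKL] and [sat_wMPT] hold by conversion. *)
Definition Pair (x y : nat) : nat := (x + y) * (x + y) + x.

Definition Fin_mem (i c : nat) : Prop :=
  exists k m n, c = Pair k (Pair m n) /\ i < k /\ exists q, n = (m * (i + 1) + 1) * q.

Definition Fin_code (c : nat) : Prop :=
  forall d, d < c -> ~ forall i, Fin_mem i c <-> Fin_mem i d.

Definition Entry (s i j : nat) : Prop := Fin_mem (Pair i j) s.

Definition Seq (s : nat) : Prop :=
  Fin_code s
  /\ (forall n, Fin_mem n s -> exists i j, n = Pair i j)
  /\ (forall i j k, Entry s i j /\ Entry s i k -> j = k)
  /\ exists l, forall i, i < l <-> exists j, Entry s i j.

Definition Initial (s t : nat) : Prop := forall i j, Entry s i j -> Entry t i j.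

Definition Incompatible (s t : nat) : Prop := ~ Initial s t /\ ~ Initial t s.

Definition Tree (T : nat -> Prop) : Prop :=
  (forall s, T s -> Seq s) /\ forall s t, T s /\ Seq t /\ Initial t s -> T t.

Definition Binary_tree (T : nat -> Prop) : Prop :=
  Tree T /\ forall s i j, T s /\ Entry s i j -> j = 0 \/ j = 1.

Definition Infinite (X : nat -> Prop) : Prop := forall m, exists n, m < n /\ X n.

Definition Func (F : nat -> Prop) : Prop :=
  (forall n, F n -> exists i j, n = Pair i j)
  /\ (forall i j k, F (Pair i j) /\ F (Pair i k) -> j = k)
  /\ forall i, exists j, F (Pair i j).

Definition Path (F T : nat -> Prop) : Prop :=
  Func F /\ forall s, Seq s /\ (forall i j, Entry s i j -> F (Pair i j)) -> T s.

Definition Perfect_tree (P : nat -> Prop) : Prop :=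
  Tree P
  /\ (exists s, P s)
  /\ forall s, P s -> exists t u, P t /\ P u /\ Initial s t /\ Initial s u /\ Incompatible t u.

Definition Rule (Y : nat -> Prop) (J : nat -> nat -> nat -> Prop) (e x y : nat) : Prop :=
  (e = Pair 0 0 /\ y = 0)
  \/ (e = Pair 0 1 /\ y = x + 1)
  \/ (e = Pair 0 (1 + 1) /\ y = x)
  \/ (e = Pair 0 (1 + 1 + 1) /\ exists z, x = Pair y z)
  \/ (e = Pair 0 (1 + 1 + 1 + 1) /\ exists z, x = Pair z y)
  \/ (e = Pair 0 (1 + 1 + 1 + 1 + 1)
     /\ ((Y x /\ y = 1) \/ (~ Y x /\ y = 0)))
  \/ (exists a b, e = Pair 1 (Pair a b) /\ exists z, J b x z /\ J a z y)
  \/ (exists a b, e = Pair (1 + 1) (Pair a b)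
       /\ exists u v, J a x u /\ J b x v /\ y = Pair u v)
  \/ (exists a b, e = Pair (1 + 1 + 1) (Pair a b) /\ exists p n, x = Pair p n
       /\ ((n = 0 /\ J a p y)
          \/ exists m z, n = m + 1 /\ J e (Pair p m) z
                   /\ J b (Pair p (Pair m z)) y))
  \/ (exists a, e = Pair (1 + 1 + 1 + 1) a /\ J a (Pair x y) 0
       /\ forall w, w < y -> exists v, J a (Pair x w) (v + 1)).

Definition Computation (Y : nat -> Prop) (d : nat) : Prop :=
  Seq d /\ forall i n, Entry d i n -> exists e x y, n = Pair e (Pair x y)
    /\ Rule Y (fun e' x' y' =>
                exists j, j < i /\ Entry d j (Pair e' (Pair x' y'))) e x y.

Definition Computes (Y : nat -> Prop) (e x y : nat) : Prop :=
  exists d, Computation Y d /\ exists i, Entry d i (Pair e (Pair x y)).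

Definition Turing_le (X Y : nat -> Prop) : Prop :=
  exists e, forall n, (X n -> Computes Y e n 1) /\ (~ X n -> Computes Y e n 0).

Lemma sat_WKL M e r : sat M e r WKL <->
  forall T, M T -> Binary_tree T /\ Infinite T -> exists F, M F /\ Path F T.
Proof. reflexivity. Qed.

Lemma sat_wMPT M e r : sat M e r wMPT <->
  forall T, M T ->
    Tree T /\ (forall X, M X -> exists F, M F /\ Path F T /\ Turing_le X F) ->
    exists P, M P /\ Perfect_tree P /\ forall n, P n -> T n.
Proof. reflexivity. Qed.

Lemma basic_sound M p e r : basic_axiom p -> sat M e r p.
Proof.
  destruct 1; cbn; intros; try lia.
Qed.

Lemma induction_sound M p e r : sat M e r (induction p).
Proof.
  unfold induction. simpl. intros [H0 HS] n. rewrite sat_inst_num in H0.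
  simpl in H0. induction n as [|n IH]; auto.
  specialize (HS n IH). rewrite sat_subst in HS. simpl in HS.
  replace (scons (S n) e) with
    (fun i => tval (scons n e) (scons (Plus (Var 0) One) (fun i => Var (S i)) i)); auto.
  extensionality i. destruct i; simpl; auto. lia.
Qed.

Lemma Pair_inj x y x' y' : Pair x y = Pair x' y' -> x = x' /\ y = y'.
Proof.
  unfold Pair. intros H.
  (* [Pair x y] lies between the consecutive squares [(x + y)^2] and [(x + y + 1)^2], the latter
     excluded, and so determines [x + y]. *)
  assert (x + y = x' + y') by nia.
  split; nia.
Qed.

Lemma Pair_bound x y : x <= Pair x y /\ y <= Pair x y.
Proof. unfold Pair. nia. Qed.

Lemma exists_least (P : nat -> Prop) : (exists n, P n) ->
  exists n, P n /\ forall m, m < n -> ~ P m.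
Proof.
  intros [n Hn]. induction n as [n IH] using lt_wf_ind.
  destruct (classic (exists m, m < n /\ P m)) as [[m [Hm Pm]]|H].
  - now apply (IH m).
  - exists n. split; auto. intros m Hm Pm. apply H. eauto.
Qed.

(** With [m = k!] the numbers [m (i + 1) + 1], [i < k], are pairwise coprime. *)
Lemma finite_set_fin_mem (F : nat -> Prop) k :
  exists c, forall i, Fin_mem i c <-> i < k /\ F i.
Proof.
  assert (Hm : exists m, 0 < m /\ forall d, 0 < d -> d < k -> Nat.divide d m).
  { exists (fact k). split; [apply lt_O_fact|].
    clear F. induction k as [|k IH]; [lia|]. intros d Hd Hdk.
    change (fact (S k)) with (S k * fact k).
    assert (d < k \/ d = k) as [H| ->] by lia.
    - apply Nat.divide_mul_r. auto.
    - apply Nat.divide_mul_r. destruct k; [lia|].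
      change (fact (S k)) with (S k * fact k). apply Nat.divide_factor_l. }
  destruct Hm as [m [Hm0 Hm]].
  set (a := fun i => m * (i + 1) + 1).
  assert (Hcop : forall i j, i < j -> j < k -> Nat.gcd (a i) (a j) = 1).
  { intros i j Hij Hj. set (d := Nat.gcd (a i) (a j)).
    assert (Hdi : Nat.divide d (a i)) by apply Nat.gcd_divide_l.
    assert (Hdj : Nat.divide d (a j)) by apply Nat.gcd_divide_r.
    (* A common divisor of two moduli divides [j - i], a positive number below [k]; hence it divides
       [m], and then 1. *)
    assert (Hd : Nat.divide d (j - i)).
    { replace (j - i) with ((j + 1) * a i - (i + 1) * a j) by (unfold a; nia).
      apply Nat.divide_sub_r; apply Nat.divide_mul_r; auto. }
    assert (Hdm : Nat.divide d m).
    { apply Hm.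
      - destruct Hd as [q Hq]. destruct d; lia.
      - apply Nat.divide_pos_le in Hd; lia. }
    assert (H1 : Nat.divide d 1).
    { replace 1 with (a i - m * (i + 1)) by (unfold a; lia).
      apply Nat.divide_sub_r; auto. now apply Nat.divide_mul_l. }
    now apply Nat.divide_1_r. }
  (* The witness is the product of the moduli [a i] with [i < l] and [F i]. Coprimality to the
     remaining moduli is carried along for the use of Gauss's lemma. *)
  assert (Hn : forall l, l <= k -> exists n, n <> 0 /\ forall i, i < k ->
     (Nat.divide (a i) n <-> i < l /\ F i) /\ (~ (i < l /\ F i) -> Nat.gcd (a i) n = 1)).
  { induction l as [|l IH]; intros Hl.
    - exists 1. split; [lia|]. intros i Hi. split.
      + split; [|lia]. intros H. apply Nat.divide_1_r in H. unfold a in H. nia.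
      + intros _. apply Nat.divide_1_r, Nat.gcd_divide_r.
    - destruct IH as [n [Hn0 Hn]]; [lia|].
      destruct (classic (F l)) as [Fl|Fl].
      + exists (a l * n). split; [unfold a in *; nia|]. intros i Hi.
        destruct (Nat.eq_dec i l) as [->|Hil].
        * split; [|intros H; exfalso; apply H; split; auto].
          split; [split; auto|]. intros _. apply Nat.divide_factor_l.
        * assert (Hc : Nat.gcd (a i) (a l) = 1).
          { destruct (Nat.lt_total i l) as [H|[H|H]]; [now apply Hcop|lia|].
            rewrite Nat.gcd_comm. now apply Hcop. }
          destruct (Hn i Hi) as [H1 H2]. split.
          -- split; intros H.
             ++ apply Nat.gauss in H; auto. apply H1 in H as [Ha Hb]. split; [lia|auto].
             ++ destruct H. apply Nat.divide_mul_r, H1. split; [lia|auto].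
          -- intros H. assert (Hg : Nat.gcd (a i) n = 1) by (apply H2; intros [A B]; apply H; split; [lia|auto]).
             set (d := Nat.gcd (a i) (a l * n)).
             assert (D1 : Nat.divide d (a i)) by apply Nat.gcd_divide_l.
             assert (D2 : Nat.divide d (a l * n)) by apply Nat.gcd_divide_r.
             apply Nat.gauss in D2.
             ++ assert (D3 : Nat.divide d 1) by (rewrite <- Hg; now apply Nat.gcd_greatest).
                now apply Nat.divide_1_r.
             ++ apply Nat.divide_1_r. rewrite <- Hc. apply Nat.gcd_greatest.
                ** eapply Nat.divide_trans; [apply Nat.gcd_divide_l|auto].
                ** apply Nat.gcd_divide_r.
      + exists n. split; auto. intros i Hi. destruct (Hn i Hi) as [H1 H2].
        assert (E : (i < S l /\ F i) <-> (i < l /\ F i)).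
        { split; intros [A B]; split; auto. assert (i <> l) by congruence. lia. }
        rewrite E. auto. }
  destruct (Hn k (le_n k)) as [n [_ Hn']].
  exists (Pair k (Pair m n)). intros i. unfold Fin_mem. split.
  - intros [k' [m' [n' [E [Hi [q Hq]]]]]].
    apply Pair_inj in E as [<- E]. apply Pair_inj in E as [<- <-].
    apply Hn'; auto. exists q. unfold a. lia.
  - intros [Hi HF]. exists k, m, n. split; auto. split; auto.
    destruct (Hn' i Hi) as [H1 _]. destruct H1 as [_ H1].
    destruct (H1 (conj Hi HF)) as [q Hq]. exists q. unfold a in Hq. lia.
Qed.

Lemma Fin_mem_bound i c : Fin_mem i c -> i < c.
Proof.
  intros [k [m [n [-> [H _]]]]]. pose proof (Pair_bound k (Pair m n)). lia.
Qed.

Lemma Entry_bound s i j : Entry s i j -> i < s /\ j < s.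
Proof.
  intros H. apply Fin_mem_bound in H. pose proof (Pair_bound i j). lia.
Qed.

Lemma Fin_code_ext c d : Fin_code c -> Fin_code d ->
  (forall i, Fin_mem i c <-> Fin_mem i d) -> c = d.
Proof.
  intros Hc Hd H. destruct (Nat.lt_total c d) as [L|[L|L]]; auto.
  - destruct (Hd c L). intros i. symmetry. apply H.
  - destruct (Hc d L). exact H.
Qed.

Lemma Seq_exists (s : list nat) :
  exists c, Seq c /\ forall i j, Entry c i j <-> nth_error s i = Some j.
Proof.
  assert (Hb : exists b, forall i j, nth_error s i = Some j -> Pair i j < b).
  { assert (H : forall i, exists b, forall i' j, i' < i -> nth_error s i' = Some j -> Pair i' j < b).
    { induction i as [|i [b IH]]; [exists 0; lia|].
      destruct (nth_error s i) as [v|] eqn:E.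
      - exists (b + S (Pair i v)). intros i' j Hi Hj.
        assert (i' < i \/ i' = i) as [H| ->] by lia.
        + specialize (IH i' j H Hj). lia.
        + assert (v = j) by congruence. subst. lia.
      - exists b. intros i' j Hi Hj.
        assert (i' < i \/ i' = i) as [H| ->] by lia; auto. congruence. }
    destruct (H (length s)) as [b Hb]. exists b. intros i j Hj. apply Hb; auto.
    apply nth_error_Some. congruence. }
  destruct Hb as [b Hb].
  set (F := fun n => exists i j, n = Pair i j /\ nth_error s i = Some j).
  destruct (exists_least (fun c => forall i, Fin_mem i c <-> i < b /\ F i)
              (finite_set_fin_mem F b)) as [c [Hc Hl]].
  assert (HE : forall i j, Entry c i j <-> nth_error s i = Some j).
  { intros i j. unfold Entry. rewrite Hc. split.
    - intros [_ [i' [j' [E H]]]]. apply Pair_inj in E as [-> ->]. auto.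
    - intros H. split; eauto. exists i, j. auto. }
  exists c. split; auto. split; [|split; [|split]].
  - intros d Hd H. apply (Hl d Hd). intros i. now rewrite <- H.
  - intros n Hn. apply Hc in Hn as [_ [i [j [-> _]]]]. eauto.
  - intros i j k [H1 H2]. apply HE in H1, H2. congruence.
  - exists (length s). intros i. rewrite <- nth_error_Some. split.
    + destruct (nth_error s i) as [v|] eqn:E; [|congruence]. exists v. now apply HE.
    + intros [j Hj]. apply HE in Hj. congruence.
Qed.

Definition enc (s : list nat) : nat :=
  proj1_sig (constructive_indefinite_description _ (Seq_exists s)).

Lemma enc_Seq s : Seq (enc s).
Proof. unfold enc. now destruct constructive_indefinite_description. Qed.

Lemma enc_Entry s i j : Entry (enc s) i j <-> nth_error s i = Some j.
Proof. unfold enc. destruct constructive_indefinite_description as [c [H1 H2]]; simpl. auto. Qed.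

Lemma list_ext {A} (s t : list A) : (forall i, nth_error s i = nth_error t i) -> s = t.
Proof.
  revert t; induction s as [|a s IH]; intros [|b t] H; auto.
  - specialize (H 0); discriminate.
  - specialize (H 0); discriminate.
  - f_equal; [specialize (H 0); simpl in H; congruence|].
    apply IH. intros i. apply (H (S i)).
Qed.

Lemma enc_inj s t : enc s = enc t -> s = t.
Proof.
  intros H. apply list_ext. intros i.
  destruct (nth_error s i) as [v|] eqn:E.
  - apply enc_Entry in E. rewrite H in E. apply enc_Entry in E. auto.
  - destruct (nth_error t i) as [v|] eqn:E'; auto.
    apply enc_Entry in E'. rewrite <- H in E'. apply enc_Entry in E'. congruence.
Qed.

Lemma Seq_enc c : Seq c -> exists s, c = enc s.
Proof.
  intros Hc. pose proof Hc as [H1 [H2 [H3 [l H4]]]].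
  assert (Hs : exists s, length s = l /\ forall i, i < l -> exists j, nth_error s i = Some j /\ Entry c i j).
  { assert (H : forall k, k <= l -> exists s, length s = k /\ forall i, i < k -> exists j, nth_error s i = Some j /\ Entry c i j).
    { induction k as [|k IH]; intros Hk; [exists nil; split; auto; lia|].
      destruct IH as [s [Hs H]]; [lia|]. destruct (proj1 (H4 k)) as [v Hv]; [lia|].
      exists (s ++ v :: nil). rewrite length_app; simpl. split; [lia|].
      intros i Hi. assert (i < k \/ i = k) as [L| ->] by lia.
      - rewrite nth_error_app1 by lia. auto.
      - exists v. split; auto. rewrite nth_error_app2 by lia. now rewrite Hs, Nat.sub_diag. }
    auto. }
  destruct Hs as [s [Hs HE]]. exists s.
  pose proof (enc_Seq s) as [K1 [K2 _]].
  assert (E : forall i j, Entry c i j <-> Entry (enc s) i j).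
  { intros i j. rewrite enc_Entry. split; intros H.
    - destruct (HE i) as [j' [A B]]; [apply H4; eauto|].
      rewrite A. f_equal. eapply H3; eauto.
    - destruct (HE i) as [j' [A B]]; [rewrite <- Hs; apply nth_error_Some; congruence|].
      assert (j = j') by congruence. now subst. }
  apply Fin_code_ext; auto. intros n. split; intros H.
  - destruct (H2 n H) as [i [j ->]]. now apply E.
  - destruct (K2 n H) as [i [j ->]]. now apply E.
Qed.

Definition dec (c : nat) : list nat := epsilon (inhabits nil) (fun s => c = enc s).

Lemma dec_enc s : dec (enc s) = s.
Proof.
  apply enc_inj. symmetry. unfold dec.
  apply (epsilon_spec (inhabits nil) (fun s' => enc s = enc s')). eauto.
Qed.

Definition prefix (s t : list nat) : Prop := exists u, t = s ++ u.

Lemma prefix_nth s t : prefix s t <-> forall i j, nth_error s i = Some j -> nth_error t i = Some j.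
Proof.
  split.
  - intros [u ->] i j H. rewrite nth_error_app1; auto. apply nth_error_Some. congruence.
  - revert t. induction s as [|a s IH]; intros t H; [exists t; auto|].
    destruct t as [|b t]; [specialize (H 0 a eq_refl); discriminate|].
    pose proof (H 0 a eq_refl) as E. simpl in E. injection E as ->.
    destruct (IH t) as [u ->]; [intros i j; apply (H (S i) j)|]. now exists u.
Qed.

Lemma Initial_enc s t : Initial (enc s) (enc t) <-> prefix s t.
Proof.
  rewrite prefix_nth. unfold Initial. setoid_rewrite enc_Entry. tauto.
Qed.

Ltac functional_step := match goal with
  | HJ : forall e x y y', ?J e x y -> ?J' e x y' -> _, H : ?J ?e ?x ?y, H' : ?J' ?e ?x ?y' |- _ =>
      pose proof (HJ _ _ _ _ H H'); clear H H'; subst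
  end.

(** Two relations occur because the two derivations being compared belong to different computation
    sequences. *)
Lemma Rule_functional Y J J' :
  (forall e x y y', J e x y -> J' e x y' -> y = y') ->
  forall e x y y', Rule Y J e x y -> Rule Y J' e x y' -> y = y'.
Proof.
  intros HJ e x y y' H H'. unfold Rule in *.
  repeat (destruct H as [H|H]); repeat (destruct H' as [H'|H']);
  repeat match goal with
  | H : exists _, _ |- _ => destruct H
  | H : _ /\ _ |- _ => destruct H
  | H : ?e = Pair _ _, H' : ?e = Pair _ _ |- _ =>
      rewrite H in H'; apply Pair_inj in H'; destruct H'; try lia
  | H : Pair _ _ = Pair _ _ |- _ => apply Pair_inj in H; destruct H
  end; subst; try congruence.
  - destruct H1 as [[? ->]|[? ->]], H2 as [[? ->]|[? ->]]; reflexivity || contradiction.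
  - functional_step. functional_step. reflexivity.
  - functional_step. functional_step. reflexivity.
  - destruct H4 as [H4|H4], H2 as [H2|H2];
    repeat match goal with
    | H : exists _, _ |- _ => destruct H
    | H : _ /\ _ |- _ => destruct H
    end; subst; try lia.
    + functional_step. reflexivity.
    + match goal with H : ?m + 1 = ?m' + 1 |- _ => assert (m = m') by lia; subst end.
      functional_step. functional_step. reflexivity.
  - destruct (Nat.lt_total y y') as [L|[L|L]]; auto.
    + match goal with H : forall w, w < y' -> _ |- _ => destruct (H y L) as [v Hv] end.
      assert (0 = v + 1) by eauto. lia.
    + match goal with H : forall w, w < y -> _ |- _ => destruct (H y' L) as [v Hv] end.
      assert (v + 1 = 0) by eauto. lia.
Qed.

Lemma Computes_functional Y e x y y' : Computes Y e x y -> Computes Y e x y' -> y = y'.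
Proof.
  intros [d [[_ Hd] [i Hi]]] [d' [[_ Hd'] [i' Hi']]].
  revert e x y y' i' Hi Hi'. induction i as [i IH] using lt_wf_ind.
  intros e x y y' i' Hi Hi'.
  destruct (Hd _ _ Hi) as [e1 [x1 [y1 [E R]]]].
  destruct (Hd' _ _ Hi') as [e2 [x2 [y2 [E' R']]]].
  apply Pair_inj in E as [-> E]. apply Pair_inj in E as [-> ->].
  apply Pair_inj in E' as [-> E']. apply Pair_inj in E' as [-> ->].
  eapply Rule_functional; [|exact R|exact R'].
  intros e x y y' [j [Hj Ej]] [j' [_ Ej']]. eauto.
Qed.

(** The code of a computation bounds its own use: each queried number is a component of an entry of
    [d], and codes bound their components. *)
Lemma Computation_use Y Y' d : (forall n, n < d -> (Y n <-> Y' n)) ->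
  Computation Y d -> Computation Y' d.
Proof.
  intros H [Hs Hd]. split; auto. intros i n Hn.
  destruct (Hd i n Hn) as [e [x [y [E R]]]]. exists e, x, y. split; auto.
  apply Entry_bound in Hn as [_ Hn].
  assert (Hx : x < d).
  { pose proof (Pair_bound e (Pair x y)). pose proof (Pair_bound x y). lia. }
  unfold Rule in *. rewrite <- (H x Hx). exact R.
Qed.

(** * Continuous operators *)

Notation real := (nat -> nat).

Definition agree (m : nat) (f f' : real) : Prop := forall i, i < m -> f' i = f i.

Lemma agree_mono m m' f f' : m <= m' -> agree m' f f' -> agree m f f'.
Proof. intros H A i Hi. apply A. lia. Qed.

Definition init (f : real) (m : nat) : list nat := map f (List.seq 0 m).

Lemma length_init f m : length (init f m) = m.
Proof. unfold init. now rewrite length_map, length_seq. Qed.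

Lemma init_S f m : init f (S m) = init f m ++ [f m].
Proof. unfold init. now rewrite seq_S, map_app. Qed.

Lemma nth_error_init f m i : i < m -> nth_error (init f m) i = Some (f i).
Proof.
  intros H. induction m as [|m IH]; [lia|]. rewrite init_S.
  assert (i < m \/ i = m) as [L| ->] by lia.
  - rewrite nth_error_app1; auto. rewrite length_init; auto.
  - rewrite nth_error_app2; rewrite length_init; auto. now rewrite Nat.sub_diag.
Qed.

Lemma init_agree m f f' : agree m f f' -> init f' m = init f m.
Proof.
  intros H. unfold init. apply map_ext_in. intros i Hi. apply in_seq in Hi. apply H. lia.
Qed.

Lemma agree_init m f f' : init f' m = init f m -> agree m f f'.
Proof.
  intros H i Hi. apply (f_equal (fun s => nth_error s i)) in H.
  rewrite !nth_error_init in H by auto. congruence.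
Qed.

Lemma firstn_init m k f : m <= k -> firstn m (init f k) = init f m.
Proof.
  intros H. apply list_ext. intros i. rewrite nth_error_firstn.
  destruct (Nat.ltb_spec i m).
  - rewrite !nth_error_init by lia. auto.
  - symmetry. apply nth_error_None. rewrite length_init. auto.
Qed.

(** The question put to an associate: what is the output at [n], if the input begins with [s]? The
    answer 0 means undecided, and [S v] means the value [v]. *)
Definition code (n : nat) (s : list nat) : nat := Pair n (enc s).

Definition uncode (c : nat) : nat * list nat :=
  epsilon (inhabits (0, [])) (fun p => c = code (fst p) (snd p)).

Lemma uncode_code n s : uncode (code n s) = (n, s).
Proof.
  pose proof (epsilon_spec (inhabits (0, @nil nat)) (fun p => code n s = code (fst p) (snd p))
    (ex_intro _ (n, s) eq_refl)) as H.
  unfold uncode. destruct epsilon as [n' s']. simpl in H.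
  apply Pair_inj in H as [-> H]. apply enc_inj in H. now subst.
Qed.

Definition unpair (c : nat) : nat * nat :=
  epsilon (inhabits (0, 0)) (fun p => c = Pair (fst p) (snd p)).

Lemma unpair_Pair x y : unpair (Pair x y) = (x, y).
Proof.
  pose proof (epsilon_spec (inhabits (0, 0)) (fun p => Pair x y = Pair (fst p) (snd p))
    (ex_intro _ (x, y) eq_refl)) as H.
  unfold unpair. destruct epsilon as [x' y']. simpl in H.
  apply Pair_inj in H as [-> ->]. auto.
Qed.

Definition least (P : nat -> Prop) : nat :=
  epsilon (inhabits 0) (fun n => P n /\ forall m, m < n -> ~ P m).

Lemma least_spec P : (exists n, P n) -> P (least P) /\ forall m, m < least P -> ~ P m.
Proof.
  intros H. apply exists_least in H.
  exact (epsilon_spec (inhabits 0) (fun n => P n /\ forall m, m < n -> ~ P m) H).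
Qed.

Lemma least_eq P n : P n -> (forall m, m < n -> ~ P m) -> least P = n.
Proof.
  intros Hn Hl. destruct (least_spec P) as [H1 H2]; [eauto|].
  destruct (Nat.lt_total (least P) n) as [L|[L|L]]; auto.
  - now destruct (Hl _ L).
  - now destruct (H2 _ L).
Qed.

Lemma least_le P n : P n -> least P <= n.
Proof.
  intros Hn. destruct (least_spec P) as [H1 H2]; [eauto|].
  destruct (Nat.le_gt_cases (least P) n) as [L|L]; auto. now destruct (H2 _ L).
Qed.

Definition indic (P : Prop) : nat := if excluded_middle_informative P then 1 else 0.

Lemma indic_nonzero P : indic P <> 0 <-> P.
Proof. unfold indic. destruct excluded_middle_informative; split; auto; try tauto; lia. Qed.

Lemma indic_true P : P -> indic P = 1.
Proof. unfold indic. destruct excluded_middle_informative; tauto. Qed.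

Lemma indic_false P : ~ P -> indic P = 0.
Proof. unfold indic. destruct excluded_middle_informative; tauto. Qed.

Definition join (f g : real) : real :=
  fun n => if Nat.even n then f (Nat.div2 n) else g (Nat.div2 n).
Definition pl (f : real) : real := fun n => f (2 * n).
Definition pr (f : real) : real := fun n => f (2 * n + 1).

Lemma pl_join f g : pl (join f g) = f.
Proof.
  extensionality n. unfold pl, join. now rewrite Nat.even_even, Nat.div2_double.
Qed.

Lemma pr_join f g : pr (join f g) = g.
Proof.
  extensionality n. unfold pr, join. rewrite Nat.even_odd.
  replace (2 * n + 1) with (S (2 * n)) by lia. now rewrite Nat.div2_succ_double.
Qed.

(** Continuity at [f] of a map into a discrete space; for [Y := Prop] equality
    is logical equivalence, by propositional extensionality. *)
Definition cont {Y : Type} (F : real -> Y) (f : real) : Prop :=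
  exists m, forall f', agree m f f' -> F f' = F f.

Lemma cont_const {Y} (y : Y) f : cont (fun _ => y) f.
Proof. exists 0; auto. Qed.

(** Near [f] the value of [G] is constant, so [F] is examined only with that value in place. This
    lets a search result or a bound be treated as a fixed parameter. *)
Lemma cont_bind {A B} (G : real -> A) (F : A -> real -> B) f :
  cont G f -> cont (F (G f)) f -> cont (fun f => F (G f) f) f.
Proof.
  intros [m1 H1] [m2 H2]. exists (m1 + m2). intros f' A'.
  rewrite (H1 f') by (eapply agree_mono; [|exact A']; lia).
  apply H2. eapply agree_mono; [|exact A']; lia.
Qed.

Lemma cont_map {A B} (h : A -> B) (F : real -> A) f : cont F f -> cont (fun f => h (F f)) f.
Proof. intros [m H]. exists m. intros f' A'. now rewrite H. Qed.

Lemma cont_map2 {A B C} (h : A -> B -> C) (F : real -> A) (G : real -> B) f :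
  cont F f -> cont G f -> cont (fun f => h (F f) (G f)) f.
Proof.
  intros H1 H2. apply (cont_bind F (fun a f => h a (G f))); auto. now apply cont_map.
Qed.

Lemma cont_eval (G : real -> nat) f : cont G f -> cont (fun f => f (G f)) f.
Proof.
  intros H. apply (cont_bind G (fun n f => f n)); auto.
  exists (S (G f)). intros f' A'. apply A'. lia.
Qed.

Lemma cont_pl (G : real -> real) f : (forall n, cont (fun f => G f n) f) ->
  forall n, cont (fun f => pl (G f) n) f.
Proof. intros H n. apply H. Qed.

Lemma cont_pr (G : real -> real) f : (forall n, cont (fun f => G f n) f) ->
  forall n, cont (fun f => pr (G f) n) f.
Proof. intros H n. apply H. Qed.

Lemma cont_id n f : cont (fun f => f n) f.
Proof. apply (cont_eval (fun _ => n)), cont_const. Qed.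

Lemma cont_app (G : real -> real) (H : real -> nat) f : (forall n, cont (fun f => G f n) f) ->
  cont H f -> cont (fun f => G f (H f)) f.
Proof. intros HG HH. apply (cont_bind H (fun n f => G f n)); auto. Qed.

Lemma cont_join (G H : real -> real) f : (forall n, cont (fun f => G f n) f) ->
  (forall n, cont (fun f => H f n) f) -> forall n, cont (fun f => join (G f) (H f) n) f.
Proof. intros HG HH n. unfold join. destruct Nat.even; auto. Qed.

Lemma cont_uniform {A B} (P : A -> real -> B) f (l : list A) :
  (forall x, List.In x l -> cont (P x) f) ->
  exists m, forall f', agree m f f' -> forall x, List.In x l -> P x f' = P x f.
Proof.
  induction l as [|a l IH]; intros H.
  - exists 0. intros f' _ x [].
  - destruct IH as [m1 H1]; [intros; apply H; simpl; auto|].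
    destruct (H a) as [m2 H2]; [simpl; auto|].
    exists (m1 + m2). intros f' A' x [<-|Hx].
    + apply H2. eapply agree_mono; [|exact A']; lia.
    + apply H1; auto. eapply agree_mono; [|exact A']; lia.
Qed.

Lemma cont_map_list {A B} (P : A -> real -> B) f (l : list A) :
  (forall x, List.In x l -> cont (P x) f) -> cont (fun f => map (fun x => P x f) l) f.
Proof.
  intros H. destruct (cont_uniform P f l H) as [m Hm]. exists m. intros f' A'.
  apply map_ext_in. intros x Hx. now apply Hm.
Qed.

Lemma cont_forall_in {A} (P : A -> real -> Prop) f (l : list A) :
  (forall x, List.In x l -> cont (P x) f) -> cont (fun f => forall x, List.In x l -> P x f) f.
Proof.
  intros H. destruct (cont_uniform P f l H) as [m Hm]. exists m. intros f' A'.
  apply propositional_extensionality. split; intros K x Hx; specialize (K x Hx);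
    specialize (Hm f' A' x Hx); congruence.
Qed.

Lemma cont_exists_in {A} (P : A -> real -> Prop) f (l : list A) :
  (forall x, List.In x l -> cont (P x) f) -> cont (fun f => exists x, List.In x l /\ P x f) f.
Proof.
  intros H. destruct (cont_uniform P f l H) as [m Hm]. exists m. intros f' A'.
  apply propositional_extensionality. split; intros [x [Hx K]]; exists x;
    specialize (Hm f' A' x Hx); split; congruence.
Qed.

Lemma cont_ext {A} (F G : real -> A) f : (forall f, F f = G f) -> cont F f -> cont G f.
Proof. intros H [m Hm]. exists m. intros. rewrite <- !H. auto. Qed.

Lemma cont_forall_le (P : nat -> real -> Prop) f n :
  (forall i, i <= n -> cont (P i) f) -> cont (fun f => forall i, i <= n -> P i f) f.
Proof.
  intros H. apply (cont_ext (fun f => forall i, List.In i (List.seq 0 (S n)) -> P i f)).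
  - intros g. apply propositional_extensionality. setoid_rewrite in_seq.
    split; intros K i Hi; apply K; lia.
  - apply cont_forall_in. intros i Hi. apply in_seq in Hi. apply H. lia.
Qed.

Lemma cont_not (P : real -> Prop) f : cont P f -> cont (fun f => ~ P f) f.
Proof. exact (cont_map not P f). Qed.

Lemma cont_and (P Q : real -> Prop) f : cont P f -> cont Q f -> cont (fun f => P f /\ Q f) f.
Proof. exact (cont_map2 and P Q f). Qed.

Lemma cont_or (P Q : real -> Prop) f : cont P f -> cont Q f -> cont (fun f => P f \/ Q f) f.
Proof. exact (cont_map2 or P Q f). Qed.

Lemma cont_imp (P Q : real -> Prop) f : cont P f -> cont Q f -> cont (fun f => P f -> Q f) f.
Proof. exact (cont_map2 (fun P Q : Prop => P -> Q) P Q f). Qed.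

Lemma cont_indic (P : real -> Prop) f : cont P f -> cont (fun f => indic (P f)) f.
Proof. apply cont_map. Qed.

Lemma cont_init (G : real -> real) f m : (forall n, cont (fun f => G f n) f) ->
  cont (fun f => init (G f) m) f.
Proof. intros H. unfold init. apply cont_map_list. auto. Qed.

Lemma cont_least (P : nat -> real -> Prop) f :
  (forall n, cont (P n) f) -> (exists n, P n f) -> cont (fun f => least (fun n => P n f)) f.
Proof.
  intros H Hex. destruct (least_spec _ Hex) as [H1 H2].
  set (n := least (fun n => P n f)) in *.
  destruct (cont_uniform P f (List.seq 0 (S n))) as [m Hm]; [auto|].
  exists m. intros f' A'. fold n. apply least_eq.
  - rewrite (Hm f' A'); auto. apply in_seq; lia.
  - intros k Hk. rewrite (Hm f' A'); auto. apply in_seq; lia.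
Qed.

(** Application in Kleene's second algebra, with junk value where it diverges. *)
Definition conv (phi f : real) (n : nat) : Prop := exists m, phi (code n (init f m)) <> 0.
Definition apf (phi f : real) : real :=
  fun n => pred (phi (code n (init f (least (fun m => phi (code n (init f m)) <> 0))))).

Lemma cont_apf (G H : real -> real) f n :
  (forall n, cont (fun f => G f n) f) -> (forall n, cont (fun f => H f n) f) ->
  conv (G f) (H f) n -> cont (fun f => apf (G f) (H f) n) f.
Proof.
  intros HG HH C. unfold apf.
  assert (K : forall m, cont (fun f => G f (code n (init (H f) m))) f).
  { intros m. apply cont_app; auto. apply (cont_map (code n)). apply cont_init; auto. }
  apply (cont_bind (fun f => least (fun m => G f (code n (init (H f) m)) <> 0))
    (fun m f => pred (G f (code n (init (H f) m))))).
  - apply (cont_least (fun m f => G f (code n (init (H f) m)) <> 0)); auto.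
    intros m. apply (cont_map (fun x => x <> 0)); auto.
  - apply cont_map. auto.
Qed.

(** Application to a finite string. The first answer counts, as in [apf], and it has to arrive
    within [s]; longer strings therefore give the same value. *)
Definition Val (phi : real) (n : nat) (s : list nat) (v : nat) : Prop :=
  exists m, m <= length s /\ phi (code n (firstn m s)) = S v
    /\ forall m', m' < m -> phi (code n (firstn m' s)) = 0.

Lemma Val_init phi f n m : phi (code n (init f m)) <> 0 ->
  Val phi n (init f m) (apf phi f n).
Proof.
  intros H. destruct (least_spec (fun m => phi (code n (init f m)) <> 0)) as [H1 H2]; [eauto|].
  pose proof (least_le (fun m => phi (code n (init f m)) <> 0) m H) as L.
  unfold Val, apf. set (k := least _) in *. exists k. rewrite length_init.
  split; auto. split.
  - rewrite firstn_init by auto. lia.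
  - intros m' Hm'. rewrite firstn_init by lia. specialize (H2 m' Hm'). lia.
Qed.

Lemma Val_prefix phi n s t v : prefix s t -> Val phi n s v -> Val phi n t v.
Proof.
  intros [u ->] [m [Hm [H1 H2]]]. exists m. rewrite length_app. split; [lia|].
  assert (E : forall k, k <= length s -> firstn k (s ++ u) = firstn k s).
  { intros k Hk. rewrite firstn_app. replace (k - length s) with 0 by lia.
    simpl. apply app_nil_r. }
  split; [rewrite E; auto|]. intros m' H. rewrite E by lia. auto.
Qed.

Lemma Val_functional phi n s v v' : Val phi n s v -> Val phi n s v' -> v = v'.
Proof.
  intros [m [_ [H1 H2]]] [m' [_ [H1' H2']]].
  destruct (Nat.lt_total m m') as [L|[<-|L]].
  - rewrite H2' in H1; congruence.
  - congruence.
  - rewrite H2 in H1'; congruence.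
Qed.

(** The associate of [F] answers as soon as all extensions of the given initial
    segment agree on the value of [F]. *)
Definition assoc (F : real -> real) : real := fun c =>
  let (n, s) := uncode c in
  let Q v := forall f, prefix s (init f (length s)) -> F f n = v in
  if excluded_middle_informative (exists v, Q v)
  then S (epsilon (inhabits 0) Q) else 0.

Lemma prefix_refl s : prefix s s.
Proof. exists []. now rewrite app_nil_r. Qed.

Lemma prefix_trans s t u : prefix s t -> prefix t u -> prefix s u.
Proof. intros [a ->] [b ->]. exists (a ++ b). now rewrite app_assoc. Qed.

Lemma prefix_length s t : prefix s t -> length s <= length t.
Proof. intros [u ->]. rewrite length_app. lia. Qed.

Lemma prefix_firstn m s : prefix (firstn m s) s.
Proof. exists (skipn m s). symmetry. apply firstn_skipn. Qed.

Lemma prefix_firstn_le s t m : prefix s t -> length s <= m -> prefix s (firstn m t).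
Proof.
  intros [u ->] H. exists (firstn (m - length s) u). rewrite firstn_app.
  now rewrite (firstn_all2 s) by auto.
Qed.

Lemma prefix_eq s t : prefix s t -> s = firstn (length s) t.
Proof.
  intros [u ->]. rewrite firstn_app, Nat.sub_diag, firstn_all, app_nil_r. auto.
Qed.

Lemma prefix_same_length s t : prefix s t -> length s = length t -> s = t.
Proof. intros H E. apply prefix_eq in H. rewrite H, E. apply firstn_all. Qed.

Lemma prefix_comparable s t u : prefix s u -> prefix t u -> length s <= length t -> prefix s t.
Proof.
  intros H1 H2 L. apply prefix_eq in H2. rewrite H2. now apply prefix_firstn_le.
Qed.

Lemma assoc_value F f n m : assoc F (code n (init f m)) <> 0 ->
  assoc F (code n (init f m)) = S (F f n).
Proof.
  unfold assoc. rewrite uncode_code.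
  destruct excluded_middle_informative as [E|E]; [|congruence]. intros _. f_equal.
  symmetry. apply (epsilon_spec (inhabits 0) _ E). rewrite length_init. apply prefix_refl.
Qed.

Lemma assoc_conv F f n : cont (fun f => F f n) f -> conv (assoc F) f n.
Proof.
  intros [m Hm]. exists m. unfold assoc. rewrite uncode_code.
  destruct excluded_middle_informative as [E|E]; [congruence|]. destruct E.
  exists (F f n). intros f' Hp. apply Hm. apply agree_init. rewrite length_init in Hp.
  symmetry. apply prefix_same_length; auto. now rewrite !length_init.
Qed.

Lemma apf_value (phi f : real) n v : conv phi f n ->
  (forall m, phi (code n (init f m)) <> 0 -> phi (code n (init f m)) = S v) ->
  apf phi f n = v.
Proof.
  intros C H. destruct (least_spec _ C) as [H1 _]. unfold apf. rewrite H; auto.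
Qed.

Lemma apf_assoc F f n : cont (fun f => F f n) f -> apf (assoc F) f n = F f n.
Proof.
  intros H. apply apf_value; [now apply assoc_conv|]. intros m. apply assoc_value.
Qed.

Fixpoint bstr (b : real) (n : nat) : list (list nat) :=
  match n with
  | 0 => [[]]
  | S n => flat_map (fun s => map (fun x => s ++ [x]) (List.seq 0 (S (b n)))) (bstr b n)
  end.

Lemma in_bstr b n s : List.In s (bstr b n) <->
  length s = n /\ forall i v, nth_error s i = Some v -> v <= b i.
Proof.
  revert s. induction n as [|n IH]; intros s; simpl.
  - split.
    + intros [<-|[]]. split; auto. intros [|i]; discriminate.
    + intros [H _]. left. destruct s; auto; discriminate.
  - rewrite in_flat_map. split.
    + intros [t [Ht H]]. apply IH in Ht as [Hl Hv].
      change (List.In s (map (fun x => t ++ [x]) (List.seq 0 (S (b n))))) in H.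
      apply in_map_iff in H as [x [<- Hx]]. apply in_seq in Hx.
      rewrite length_app; simpl. split; [lia|]. intros i v E.
      destruct (Nat.lt_ge_cases i (length t)) as [L|L].
      * rewrite nth_error_app1 in E by auto. auto.
      * rewrite nth_error_app2 in E by auto.
        destruct (i - length t) as [|k] eqn:Ei; [|destruct k; discriminate].
        injection E as <-. replace i with n by lia. lia.
    + intros [Hl Hv]. destruct (exists_last (l := s)) as [t [x ->]]; [destruct s; discriminate|].
      rewrite length_app in Hl; simpl in Hl. exists t. split.
      * apply IH. split; [lia|]. intros i v E. apply Hv. rewrite nth_error_app1; auto.
        apply nth_error_Some. congruence.
      * apply (in_map (fun x => t ++ [x]) (List.seq 0 (S (b n)))). apply in_seq.
        specialize (Hv n x). rewrite nth_error_app2 in Hv by lia.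
        replace (n - length t) with 0 in Hv by lia. specialize (Hv eq_refl). lia.
Qed.

Lemma cont_bstr (G : real -> real) f n : (forall n, cont (fun f => G f n) f) ->
  cont (fun f => bstr (G f) n) f.
Proof.
  intros H. induction n as [|n IH]; simpl; [apply cont_const|].
  apply (cont_map2 (fun l b => flat_map (fun s => map (fun x => s ++ [x]) (List.seq 0 (S b))) l)
    (fun f => bstr (G f) n) (fun f => G f n)); auto.
Qed.

Lemma init_bstr f b n : (forall i, f i <= b i) -> List.In (init f n) (bstr b n).
Proof.
  intros H. apply in_bstr. split; [apply length_init|]. intros i v E.
  assert (i < n) by (rewrite <- (length_init f n); apply nth_error_Some; congruence).
  rewrite nth_error_init in E by auto. injection E as <-. auto.
Qed.

Lemma firstn_bstr b n m s : List.In s (bstr b n) -> m <= n -> List.In (firstn m s) (bstr b m).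
Proof.
  rewrite !in_bstr. intros [Hl Hv] Hm. split.
  - rewrite length_firstn. lia.
  - intros i v E. apply Hv.
    assert (i < m) by (apply (Nat.lt_le_trans _ (length (firstn m s)));
      [apply nth_error_Some; congruence|rewrite length_firstn; lia]).
    rewrite nth_error_firstn in E. destruct (Nat.ltb_spec i m); auto; lia.
Qed.

Fixpoint bools (n : nat) : list (list bool) :=
  match n with
  | 0 => [[]]
  | S n => map (cons true) (bools n) ++ map (cons false) (bools n)
  end.

Lemma in_bools n s : List.In s (bools n) <-> length s = n.
Proof.
  revert s. induction n as [|n IH]; intros s; simpl.
  - split; [intros [<-|[]]; auto|]. destruct s; auto; discriminate.
  - rewrite in_app_iff, !in_map_iff. split.
    + intros [[t [<- Ht]]|[t [<- Ht]]]; apply IH in Ht; simpl; lia.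
    + destruct s as [|[|] s]; [discriminate| |]; simpl; intros H;
        [left|right]; exists s; rewrite IH; auto.
Qed.

(** * Ideals of reals *)

(** Averages over the strings of one length are all the measure theory involved: a closed set has
    measure at least [eps] when all its approximations by clopen sets do. *)
Fixpoint expect (n : nat) (phi : list bool -> R) : R :=
  match n with
  | 0 => phi []
  | S n => ((expect n (fun s => phi (true :: s)) + expect n (fun s => phi (false :: s))) / 2)%R
  end.

Definition half (k : nat) : R := ((/ 2) ^ k)%R.
Definition prob (n : nat) (P : list bool -> Prop) : R := expect n (fun s => INR (indic (P s))).

Definition mem (Q : real) (s : list nat) : Prop := Q (enc s) <> 0.

(** [t] holds the bits of the path to be added, [s] those of the random real. *)
Definition mix (t s : list bool) : list nat :=
  map (fun p => 2 * Nat.b2n (fst p) + Nat.b2n (snd p)) (combine t s).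

Definition diverging (Q W : real) (n : nat) (s : list nat) : Prop :=
  mem Q s /\ forall m, m <= length s -> W (code n (firstn m s)) = 0.

(** The restrictions by [length s] make this a finite condition that passes to initial segments. On
    a path every [n] is tested eventually. *)
Definition pruned (Q W g : real) (s : list nat) : Prop :=
  mem Q s /\ forall n, n <= length s ->
    g n <= length s -> ~ diverging Q W n (firstn (g n) s).

(** A single real carries all set parameters of a formula, as iterated joins. *)
Definition col (X : nat) (f : real) : real := pl (Nat.iter X pr f).
Definition cols (f : real) (X j : nat) : Prop := col X f j <> 0.
Definition listenv (l : list nat) (i : nat) : nat := nth i l 0.

(** Satisfaction of formulas without set quantifiers does not depend on the set sort. *)
Definition holds (f : real) (l : list nat) (p : form) : Prop :=
  sat (fun _ => True) (listenv l) (cols f) p.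

Definition graph (f : real) (c : nat) : Prop := exists i j, c = Pair i j /\ f i = j.

(** [c] packs a computation together with its value, so that one minimization finds both. *)
Definition witness (f : real) (e n c : nat) : Prop :=
  Computation (graph f) (fst (unpair c)) /\
  exists i, Entry (fst (unpair c)) i (Pair e (Pair n (snd (unpair c)))).

(** A strictly increasing length that dominates [u i] for all [i < n]: if [u] bounds the use, a
    string of length [ell u n] is long enough for the first [n] output values. *)
Fixpoint ell (u : real) (n : nat) : nat :=
  match n with 0 => 0 | S n => ell u n + S (u n) end.

(** The outputs still possible at level [length r] for paths of [T] below [fh], when [gam] is the
    associate of the computation and [uh] bounds its use. The bounds make the search for [t]
    finite. *)
Definition image (T gam fh uh : real) (r : list nat) : Prop :=
  exists t, List.In t (bstr fh (ell uh (length r))) /\ (mem T t /\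
    forall i, i <= length r ->
      match nth_error r i with
      | Some v => Val gam i (firstn (uh i) t) v
      | None => True
      end).

(** The [j]-th splitting level of the perfect tree, and the exponent of the
    measure bound there; [k] is the exponent at the root. *)
Fixpoint lev (fh uh : real) (k j : nat) : nat * nat :=
  match j with
  | 0 => (0, k)
  | S j => let (n, k) := lev fh uh k j in
      (n + k + 2, k + 2 + length (bstr fh (ell uh (n + k + 2))))
  end.

(** Here [l] is an initial part of a characteristic function, and [t] counts as present until [l]
    excludes it. *)
Definition undecided (l t : list nat) : Prop :=
  length l <= enc t \/ nth_error l (enc t) = Some 1.

(** The two extensions are sought in a finite set, at the length prescribed by [lam]. This bounded
    search is what turns perfectness into a Pi01 condition. *)
Definition splits (fh lam : real) (l t : list nat) : Prop :=
  exists t1, List.In t1 (bstr fh (lam (length t))) /\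
  exists t2, List.In t2 (bstr fh (lam (length t))) /\
    (t1 <> t2 /\ prefix t t1 /\ prefix t t2 /\ undecided l t1 /\ undecided l t2).

(** Holds as long as [l] is not seen to fail as the start of the characteristic function of a
    perfect subtree of [T]. The equation [i = enc (dec i)] says that [i] is a code, since [dec]
    returns some string for other numbers too. *)
Definition perfect_attempt (T fh lam : real) (l : list nat) : Prop :=
  forall i, i <= length l ->
    match nth_error l i with
    | None => True
    | Some v => v <= 1 /\ (i = enc [] -> v = 1) /\
        (v = 1 -> i = enc (dec i) /\
          (forall m, m <= length (dec i) -> undecided l (firstn m (dec i))) /\
          mem T (dec i) /\ splits fh lam l (dec i))
    end.

(** The operators under which ideals have to be closed. Nothing matters about this
    list except that it is countable and that each operator is continuous where it
    is used. *)
Inductive opx : Type :=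
| XFst | XSnd | XOne | XJoin | XApp | XCurry | XHalf | XOdd
| XStart | XDiv (n : nat) | XBound (k : nat) | XPrune | XTest | XDom
| XComp (p q : form) (l : list nat) | XFun | XGraph
| XCompute (e : nat) | XUse | XImage | XLev (k : nat) | XPerf | XLim.

(** Several arguments are packed by [join]. [XJoin] and [XApp] close an adjunction under join and
    application; [XCurry] fixes the parameter of a functional; [XBound] and [XPrune] perform the
    fusion; [XTest] searches for an exit from a closed set; [XDom] adds up all values that a bounded
    search can return; [XLim] reads a limit off its column beyond a given bound. *)
Definition opf (x : opx) : real -> real :=
  match x with
  | XFst => pl
  | XSnd => pr
  | XOne => fun _ _ => 1
  | XJoin => fun f => join (apf (pl (pl (pl f))) (join (pr (pl (pl f))) (pr f)))
                           (apf (pl (pr (pl f))) (join (pr (pr (pl f))) (pr f)))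
  | XApp => fun f => apf (apf (pl (pl (pl f))) (join (pr (pl (pl f))) (pr f)))
                         (apf (pl (pr (pl f))) (join (pr (pr (pl f))) (pr f)))
  | XCurry => fun f c => let (n, s) := uncode c in
      let g := join (pr f) (fun i => nth i s 0) in
      indic (exists m, m <= 2 * length s /\ pl f (code n (init g m)) <> 0)
        * S (apf (pl f) g n)
  | XHalf => fun f n => Nat.div2 (f n)
  | XOdd => fun f n => Nat.b2n (Nat.odd (f n))
  | XStart => fun f c => indic (mem f (map Nat.div2 (dec c)))
  | XDiv n => fun f c => indic (diverging (pl f) (pr f) n (dec c))
  | XBound k => fun f n => least (fun l => forall t, List.In t (bools l) ->
      (prob l (fun s => diverging (pl f) (pr f) n (mix t s)) < half (k + n + 2))%R)
  | XPrune => fun f c => indic (pruned (pl (pl f)) (pr (pl f)) (pr f) (dec c))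
  | XTest => fun f c => indic (~ mem f (map (fun x => Nat.b2n (Nat.odd x)) (snd (uncode c))))
  | XDom => fun f n => list_sum (map (fun m =>
      list_sum (map (fun s => pl f (code n s)) (bstr (fun _ => 3) m)))
      (List.seq 0 (S (pr f n))))
  | XComp p q l => fun f n =>
      indic (holds f (least (fun k => holds f (k :: n :: l) p \/ ~ holds f (k :: n :: l) q)
                    :: n :: l) p)
  | XFun => fun f i => least (fun j => f (Pair i j) <> 0)
  | XGraph => fun f c => indic (c = Pair (fst (unpair c)) (snd (unpair c)) /\
                              f (fst (unpair c)) = snd (unpair c))
  | XCompute e => fun f n => snd (unpair (least (witness f e n)))
  | XUse => fun f n => least (fun m => pl f (code n (init (pr f) m)) <> 0)
  | XImage => fun f c =>
      indic (image (pl (pl f)) (pr (pl f)) (pl (pr f)) (pr (pr f)) (dec c))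
  | XLev k => fun f j => ell (pr f) (fst (lev (pl f) (pr f) k (S j)))
  | XPerf => fun f c => indic (perfect_attempt (pl (pl f)) (pr (pl f)) (pr f) (dec c))
  | XLim => fun f n => pl f (Pair n (S (pr f n)))
  end.

(** Since the associates of the operators are members, closure under total application yields
    closure under each operator at every argument where it is continuous. *)
Record ideal (M : real -> Prop) : Prop := {
  ideal_op : forall x, M (assoc (opf x));
  ideal_join : forall f g, M f -> M g -> M (join f g);
  ideal_apf : forall phi f, M phi -> M f -> (forall n, conv phi f n) -> M (apf phi f)
}.

Lemma ideal_closed M x f : ideal M -> M f -> (forall n, cont (fun f => opf x f n) f) ->
  M (opf x f).
Proof.
  intros I Hf H. replace (opf x f) with (apf (assoc (opf x)) f).
  - apply ideal_apf; auto; [apply (ideal_op _ I)|]. intros n. now apply assoc_conv.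
  - extensionality n. now apply apf_assoc.
Qed.

Definition countable {A : Type} (P : A -> Prop) : Prop :=
  exists e : nat -> A, forall x, P x -> exists n, e n = x.

Lemma countable_injection {A B : Type} (h : A -> nat) (g : A -> B) (b : B) (P : B -> Prop) :
  (forall x y, h x = h y -> x = y) -> (forall y, P y -> exists x, y = g x) -> countable P.
Proof.
  intros Hh HP.
  exists (fun n => epsilon (inhabits b) (fun y => exists x, h x = n /\ y = g x)).
  intros y Hy. destruct (HP y Hy) as [x ->]. exists (h x).
  destruct (epsilon_spec (inhabits b) (fun y => exists x', h x' = h x /\ y = g x')) as [x' [E ->]];
    [eauto|]. now apply Hh in E as ->.
Qed.

Fixpoint term_code (t : term) : nat :=
  match t with
  | Var i => Pair 0 i
  | Zero => Pair 1 0
  | One => Pair 2 0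
  | Plus s t => Pair 3 (Pair (term_code s) (term_code t))
  | Times s t => Pair 4 (Pair (term_code s) (term_code t))
  end.

Fixpoint form_code (p : form) : nat :=
  match p with
  | Eq s t => Pair 0 (Pair (term_code s) (term_code t))
  | Lt s t => Pair 1 (Pair (term_code s) (term_code t))
  | In t X => Pair 2 (Pair (term_code t) X)
  | Bot => Pair 3 0
  | Imp p q => Pair 4 (Pair (form_code p) (form_code q))
  | And p q => Pair 5 (Pair (form_code p) (form_code q))
  | Or p q => Pair 6 (Pair (form_code p) (form_code q))
  | AllN p => Pair 7 (form_code p)
  | ExN p => Pair 8 (form_code p)
  | AllS p => Pair 9 (form_code p)
  | ExS p => Pair 10 (form_code p)
  end.

Definition opx_code (x : opx) : nat :=
  match x with
  | XFst => Pair 0 0 | XSnd => Pair 1 0 | XOne => Pair 2 0 | XJoin => Pair 3 0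
  | XApp => Pair 4 0 | XCurry => Pair 5 0 | XHalf => Pair 6 0 | XOdd => Pair 7 0
  | XStart => Pair 8 0 | XDiv n => Pair 9 n | XBound k => Pair 10 k | XPrune => Pair 11 0
  | XTest => Pair 12 0 | XDom => Pair 13 0
  | XComp p q l => Pair 14 (Pair (form_code p) (Pair (form_code q) (enc l)))
  | XFun => Pair 15 0 | XGraph => Pair 16 0 | XCompute e => Pair 17 e | XUse => Pair 18 0
  | XImage => Pair 19 0 | XLev k => Pair 20 k | XPerf => Pair 21 0 | XLim => Pair 22 0
  end.

Ltac pair_inversion := repeat match goal with
  | H : Pair _ _ = Pair _ _ |- _ => apply Pair_inj in H; destruct H
  end.

Lemma term_code_inj s t : term_code s = term_code t -> s = t.
Proof.
  revert t. induction s; intros t; destruct t; simpl; intros H; pair_inversion;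
    try discriminate; f_equal; auto.
Qed.

Lemma form_code_inj p q : form_code p = form_code q -> p = q.
Proof.
  revert q. induction p; intros r; destruct r; simpl; intros H; pair_inversion;
    try discriminate; f_equal; auto using term_code_inj.
Qed.

Lemma opx_code_inj x y : opx_code x = opx_code y -> x = y.
Proof.
  destruct x; destruct y; simpl; intros H; pair_inversion;
    try discriminate; f_equal; auto using form_code_inj, enc_inj.
Qed.

(** * Continuity of the operators *)

Lemma cont_forall_lt (P : nat -> real -> Prop) f n :
  (forall i, i < n -> cont (P i) f) -> cont (fun f => forall i, i < n -> P i f) f.
Proof.
  intros H. apply (cont_ext (fun f => forall i, List.In i (List.seq 0 n) -> P i f)).
  - intros g. apply propositional_extensionality. setoid_rewrite in_seq.
    split; intros K i Hi; apply K; lia.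
  - apply cont_forall_in. intros i Hi. apply in_seq in Hi. apply H. lia.
Qed.

Lemma cont_exists_le (P : nat -> real -> Prop) f n :
  (forall i, i <= n -> cont (P i) f) -> cont (fun f => exists i, i <= n /\ P i f) f.
Proof.
  intros H. apply (cont_ext (fun f => exists i, List.In i (List.seq 0 (S n)) /\ P i f)).
  - intros g. apply propositional_extensionality. setoid_rewrite in_seq.
    split; intros [i [Hi K]]; exists i; split; auto; lia.
  - apply cont_exists_in. intros i Hi. apply in_seq in Hi. apply H. lia.
Qed.

Lemma cont_expect n (phi : real -> list bool -> R) f :
  (forall s, cont (fun f => phi f s) f) -> cont (fun f => expect n (phi f)) f.
Proof.
  revert phi. induction n as [|n IH]; intros phi H; simpl; auto.
  apply (cont_map2 (fun x y => ((x + y) / 2)%R) (fun f => expect n (fun s => phi f (true :: s)))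
           (fun f => expect n (fun s => phi f (false :: s)))); auto.
Qed.

Lemma cont_prob n (P : real -> list bool -> Prop) f :
  (forall s, cont (fun f => P f s) f) -> cont (fun f => prob n (P f)) f.
Proof.
  intros H. apply cont_expect. intros s. apply (cont_map (fun Q => INR (indic Q))). auto.
Qed.

Lemma cont_mem (G : real -> real) s f : (forall n, cont (fun f => G f n) f) ->
  cont (fun f => mem (G f) s) f.
Proof. intros H. apply (cont_map (fun x => x <> 0)). auto. Qed.

Lemma cont_Val (G : real -> real) n s v f : (forall n, cont (fun f => G f n) f) ->
  cont (fun f => Val (G f) n s v) f.
Proof.
  intros H. unfold Val.
  apply (cont_exists_le (fun m f => G f (code n (firstn m s)) = S v /\
    forall m', m' < m -> G f (code n (firstn m' s)) = 0)).
  intros m _. apply cont_and.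
  - apply (cont_map (fun x => x = S v)). auto.
  - apply (cont_forall_lt (fun m' f => G f (code n (firstn m' s)) = 0)).
    intros i _. apply (cont_map (fun x => x = 0)). auto.
Qed.

Lemma cont_ell (G : real -> real) n f : (forall n, cont (fun f => G f n) f) ->
  cont (fun f => ell (G f) n) f.
Proof.
  intros H. induction n as [|n IH]; simpl; [apply cont_const|].
  apply (cont_map2 (fun x y => x + S y)); auto.
Qed.

Lemma cont_diverging (G H : real -> real) n s f :
  (forall n, cont (fun f => G f n) f) -> (forall n, cont (fun f => H f n) f) ->
  cont (fun f => diverging (G f) (H f) n s) f.
Proof.
  intros HG HH. apply cont_and; [now apply cont_mem|].
  apply (cont_forall_le (fun m f => H f (code n (firstn m s)) = 0)).
  intros m _. apply (cont_map (fun x => x = 0)). auto.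
Qed.

Lemma cont_pruned (Q W g : real -> real) s f :
  (forall n, cont (fun f => Q f n) f) -> (forall n, cont (fun f => W f n) f) ->
  (forall n, cont (fun f => g f n) f) -> cont (fun f => pruned (Q f) (W f) (g f) s) f.
Proof.
  intros HQ HW Hg. apply cont_and; [now apply cont_mem|].
  apply (cont_forall_le (fun n f => g f n <= length s ->
    ~ diverging (Q f) (W f) n (firstn (g f n) s))).
  intros n _. apply (cont_bind (fun f => g f n) (fun m f => m <= length s ->
    ~ diverging (Q f) (W f) n (firstn m s))); auto.
  apply cont_imp; [apply cont_const|]. apply cont_not, cont_diverging; auto.
Qed.

Lemma cont_image (T gam fh uh : real -> real) r f :
  (forall n, cont (fun f => T f n) f) -> (forall n, cont (fun f => gam f n) f) ->
  (forall n, cont (fun f => fh f n) f) -> (forall n, cont (fun f => uh f n) f) ->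
  cont (fun f => image (T f) (gam f) (fh f) (uh f) r) f.
Proof.
  intros HT Hg Hf Hu. unfold image.
  apply (cont_bind (fun f => ell (uh f) (length r)) (fun l f => exists t, List.In t (bstr (fh f) l) /\
    (mem (T f) t /\ forall i, i <= length r ->
      match nth_error r i with
      | Some v => Val (gam f) i (firstn (uh f i) t) v
      | None => True
      end))); [now apply cont_ell|].
  apply (cont_bind (fun f => bstr (fh f) _) (fun L f => exists t, List.In t L /\
    (mem (T f) t /\ forall i, i <= length r ->
      match nth_error r i with
      | Some v => Val (gam f) i (firstn (uh f i) t) v
      | None => True
      end))); [now apply cont_bstr|].
  apply cont_exists_in. intros t _. apply cont_and; [now apply cont_mem|].
  apply (cont_forall_le (fun i f => match nth_error r i with
      | Some v => Val (gam f) i (firstn (uh f i) t) v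
      | None => True
      end)).
  intros i _. destruct nth_error; [|apply cont_const].
  apply (cont_bind (fun f => uh f i) (fun u f => Val (gam f) i (firstn u t) n)); auto.
  now apply cont_Val.
Qed.

Lemma cont_lev (fh uh : real -> real) k j f :
  (forall n, cont (fun f => fh f n) f) -> (forall n, cont (fun f => uh f n) f) ->
  cont (fun f => lev (fh f) (uh f) k j) f.
Proof.
  intros Hf Hu. induction j as [|j IH]; simpl; [apply cont_const|].
  apply (cont_bind (fun f => lev (fh f) (uh f) k j) (fun p f =>
    let (n, k0) := p in
    (n + k0 + 2, k0 + 2 + length (bstr (fh f) (ell (uh f) (n + k0 + 2)))))); auto.
  destruct (lev (fh f) (uh f) k j) as [n k'].
  apply (cont_map (fun x => (n + k' + 2, k' + 2 + length x))).
  apply (cont_bind (fun f => ell (uh f) (n + k' + 2)) (fun l f => bstr (fh f) l)); [now apply cont_ell|].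
  now apply cont_bstr.
Qed.

Lemma cont_perfect_attempt (T fh lam : real -> real) l f :
  (forall n, cont (fun f => T f n) f) -> (forall n, cont (fun f => fh f n) f) ->
  (forall n, cont (fun f => lam f n) f) ->
  cont (fun f => perfect_attempt (T f) (fh f) (lam f) l) f.
Proof.
  intros HT Hf Hl. unfold perfect_attempt.
  apply (cont_forall_le (fun i f => match nth_error l i with
    | None => True
    | Some v => v <= 1 /\ (i = enc [] -> v = 1) /\
        (v = 1 -> i = enc (dec i) /\
          (forall m, m <= length (dec i) -> undecided l (firstn m (dec i))) /\
          mem (T f) (dec i) /\ splits (fh f) (lam f) l (dec i))
    end)).
  intros i _. destruct nth_error; [|apply cont_const].
  apply cont_and; [apply cont_const|]. apply cont_and; [apply cont_const|].
  apply cont_imp; [apply cont_const|]. apply cont_and; [apply cont_const|].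
  apply cont_and; [apply cont_const|]. apply cont_and; [now apply cont_mem|].
  unfold splits. set (t := dec i). generalize t. clear t. intros t.
  apply (cont_bind (fun f => bstr (fh f) (lam f (length t))) (fun L f => exists t1, List.In t1 L /\
    exists t2, List.In t2 L /\
    (t1 <> t2 /\ prefix t t1 /\ prefix t t2 /\ undecided l t1 /\ undecided l t2)));
    [|apply cont_const].
  apply (cont_bind (fun f => lam f (length t)) (fun n f => bstr (fh f) n)); auto.
  now apply cont_bstr.
Qed.

Lemma cont_XCurry f c : cont (fun f => opf XCurry f c) f.
Proof.
  simpl. destruct (uncode c) as [n s].
  set (G := fun f => join (pr f) (fun i => nth i s 0)).
  assert (HG : forall n, cont (fun f => G f n) f).
  { intros k. apply cont_join; [|intros; apply cont_const]. intros; apply cont_id. }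
  apply (cont_bind (fun f => indic (exists m, m <= 2 * length s /\ pl f (code n (init (G f) m)) <> 0))
     (fun b f => b * S (apf (pl f) (G f) n))).
  - apply cont_indic. apply (cont_exists_le (fun m f => pl f (code n (init (G f) m)) <> 0)).
    intros m _. apply (cont_map (fun x => x <> 0)).
    apply (cont_app pl (fun f => code n (init (G f) m))); [intros; apply cont_id|].
    apply cont_map. apply cont_init; auto.
  (* The factor [indic] guards the application: where the bounded search fails, the product is
     constantly 0, and otherwise [apf] converges. Hence [XCurry] is continuous everywhere. *)
  - destruct (classic (exists m, m <= 2 * length s /\ pl f (code n (init (G f) m)) <> 0)) as [H|H].
    + rewrite indic_true by auto. apply (cont_map (fun x => 1 * S x)).
      apply cont_apf; auto; [intros; apply cont_id|]. destruct H as [m [_ H]]. now exists m.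
    + rewrite indic_false by auto. simpl. apply cont_const.
Qed.

(** The excluded operators contain an unbounded search or an unguarded application and are shown
    continuous only at arguments where these terminate. *)
Definition total_op (x : opx) : bool :=
  match x with
  | XJoin | XApp | XBound _ | XComp _ _ _ | XFun | XCompute _ | XUse => false
  | _ => true
  end.

Lemma cont_total_op x f n : total_op x = true -> cont (fun f => opf x f n) f.
Proof.
  assert (H1 : forall n, cont (fun f => pl (pl f) n) f) by (intros; apply cont_id).
  assert (H2 : forall n, cont (fun f => pr (pl f) n) f) by (intros; apply cont_id).
  assert (H3 : forall n, cont (fun f => pl (pr f) n) f) by (intros; apply cont_id).
  assert (H4 : forall n, cont (fun f => pr (pr f) n) f) by (intros; apply cont_id).
  assert (H5 : forall n, cont (fun f => pl f n) f) by (intros; apply cont_id).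
  assert (H6 : forall n, cont (fun f => pr f n) f) by (intros; apply cont_id).
  assert (H7 := fun n => cont_id n f).
  intros Hx. destruct x; try discriminate; try (simpl; auto; fail).
  - simpl. apply cont_const.
  - apply cont_XCurry.
  - simpl. apply cont_map; auto.
  - simpl. apply (cont_map (fun x => Nat.b2n (Nat.odd x))); auto.
  - simpl. apply cont_indic, (cont_mem (fun f => f)). auto.
  - simpl. apply cont_indic, cont_diverging; auto.
  - simpl. apply cont_indic, cont_pruned; auto.
  - simpl. apply cont_indic, cont_not, (cont_mem (fun f => f)). auto.
  - simpl. apply (cont_bind (fun f => pr f n) (fun b f => list_sum (map (fun m =>
      list_sum (map (fun s => pl f (code n s)) (bstr (fun _ => 3) m))) (List.seq 0 (S b))))); auto.
    apply cont_map, cont_map_list. intros m _. apply cont_map, cont_map_list. auto.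
  - simpl. apply cont_indic, cont_and; [apply cont_const|]. apply (cont_map (fun x => x = _)); auto.
  - simpl. apply cont_indic, cont_image; auto.
  - cbn [opf].
    apply (cont_bind (fun f => fst (lev (pl f) (pr f) k (S n))) (fun m f => ell (pr f) m)).
    + apply cont_map, cont_lev; auto.
    + apply cont_ell; auto.
  - simpl. apply cont_indic, cont_perfect_attempt; auto.
  - simpl. apply (cont_app pl (fun f => Pair n (S (pr f n)))); auto.
    apply (cont_map (fun x => Pair n (S x))); auto.
Qed.

Lemma ideal_total M x f : ideal M -> total_op x = true -> M f -> M (opf x f).
Proof. intros I H Hf. apply ideal_closed; auto. intros n. now apply cont_total_op. Qed.

Lemma cont_XJoin p1 f1 p2 f2 X n :
  (forall n, conv p1 (join f1 X) n) -> (forall n, conv p2 (join f2 X) n) ->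
  cont (fun f => opf XJoin f n) (join (join (join p1 f1) (join p2 f2)) X).
Proof.
  intros C1 C2. set (f := join _ X).
  assert (H : forall n, cont (fun f => pr f n) f) by (intros; apply cont_id).
  simpl. apply cont_join; intros k; apply cont_apf.
  - intros; apply cont_id.
  - apply cont_join; auto. intros; apply cont_id.
  - unfold f. rewrite !pl_join, !pr_join. auto.
  - intros; apply cont_id.
  - apply cont_join; auto. intros; apply cont_id.
  - unfold f. rewrite !pl_join, !pr_join, !pl_join. auto.
Qed.

Lemma cont_XApp p1 f1 p2 f2 X n :
  (forall n, conv p1 (join f1 X) n) -> (forall n, conv p2 (join f2 X) n) ->
  conv (apf p1 (join f1 X)) (apf p2 (join f2 X)) n ->
  cont (fun f => opf XApp f n) (join (join (join p1 f1) (join p2 f2)) X).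
Proof.
  intros C1 C2 C3. set (f := join _ X).
  assert (H : forall n, cont (fun f => pr f n) f) by (intros; apply cont_id).
  simpl. apply cont_apf; [intros k; apply cont_apf|intros k; apply cont_apf|].
  - intros; apply cont_id.
  - apply cont_join; auto. intros; apply cont_id.
  - unfold f. rewrite !pl_join, !pr_join. auto.
  - intros; apply cont_id.
  - apply cont_join; auto. intros; apply cont_id.
  - unfold f. rewrite !pl_join, !pr_join, !pl_join. auto.
  - unfold f. rewrite !pl_join, !pr_join, !pl_join. auto.
Qed.

Lemma cont_XFun f i : (exists j, f (Pair i j) <> 0) -> cont (fun f => opf XFun f i) f.
Proof.
  intros H. simpl. apply (cont_least (fun j f => f (Pair i j) <> 0)); auto.
  intros j. apply (cont_map (fun x => x <> 0)), cont_id.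
Qed.

Lemma cont_XUse gam f n : conv gam f n -> cont (fun f => opf XUse f n) (join gam f).
Proof.
  intros H. simpl.
  apply (cont_least (fun m f => pl f (code n (init (pr f) m)) <> 0));
    [|now rewrite pl_join, pr_join].
  intros m. apply (cont_map (fun x => x <> 0)).
  apply (cont_app pl (fun f => code n (init (pr f) m))); [intros; apply cont_id|].
  apply cont_map, cont_init. intros; apply cont_id.
Qed.

Lemma cont_XBound k Q W n :
  (exists l, forall t, List.In t (bools l) ->
      (prob l (fun s => diverging Q W n (mix t s)) < half (k + n + 2))%R) ->
  cont (fun f => opf (XBound k) f n) (join Q W).
Proof.
  intros H. simpl.
  apply (cont_least (fun l f => forall t, List.In t (bools l) ->
      (prob l (fun s => diverging (pl f) (pr f) n (mix t s)) < half (k + n + 2))%R));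
    [|now rewrite pl_join, pr_join].
  intros l. apply cont_forall_in. intros t _.
  apply (cont_map (fun x => (x < half (k + n + 2))%R)), cont_prob.
  intros s. apply cont_diverging; intros; apply cont_id.
Qed.

Lemma cont_XCompute e f n v : Computes (graph f) e n v -> cont (fun f => opf (XCompute e) f n) f.
Proof.
  intros [d [Hd [i Hi]]]. simpl.
  apply (cont_map (fun c => snd (unpair c)) (fun f => least (fun c => witness f e n c))).
  apply (cont_least (fun c f => witness f e n c)).
  - intros c. exists (S (fst (unpair c))). intros f' A.
    (* Whether [m = Pair x y] lies in the graph depends on [f x] alone, and [x <= m]. *)
    assert (Hg : forall m, m < fst (unpair c) -> (graph f m <-> graph f' m)).
    { intros m Hm. unfold graph.
      assert (K : forall x y, m = Pair x y -> f' x = f x).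
      { intros x y ->. apply A. pose proof (Pair_bound x y). lia. }
      split; intros [x [y [E V]]]; exists x, y; split; auto; rewrite (K x y E) in *; auto. }
    unfold witness. apply propositional_extensionality. split; intros [H1 H2]; split; auto.
    + apply (Computation_use (graph f')); auto. intros m Hm. symmetry. auto.
    + apply (Computation_use (graph f)); auto.
  - exists (Pair d v). unfold witness. rewrite unpair_Pair. simpl. eauto.
Qed.

Lemma XCompute_value e f n v : Computes (graph f) e n v -> opf (XCompute e) f n = v.
Proof.
  intros H. pose proof H as [d [Hd [i Hi]]]. simpl.
  destruct (least_spec (witness f e n)) as [[H1 H2] _].
  - exists (Pair d v). unfold witness. rewrite unpair_Pair. simpl. eauto.
  - eapply Computes_functional; [|exact H]. eexists; eauto.
Qed.

Lemma cols_use K m f : exists k, forall f', agree k f f' ->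
  forall X j, X < K -> j < m -> (cols f X j <-> cols f' X j).
Proof.
  assert (H : forall X n, cont (fun f => Nat.iter X pr f n) f).
  { induction X as [|X IH]; intros n; [apply cont_id|]. simpl. apply (cont_pr (fun f => Nat.iter X pr f)). auto. }
  destruct (cont_uniform (fun p f => cols f (fst p) (snd p)) f
     (list_prod (List.seq 0 K) (List.seq 0 m))) as [k Hk].
  - intros [X j] _. apply (cont_map (fun x => x <> 0)). apply (cont_pl (fun f => Nat.iter X pr f)). auto.
  - exists k. intros f' A X j HX Hj. specialize (Hk f' A (X, j)). simpl in Hk.
    rewrite Hk; [tauto|]. apply in_prod; apply in_seq; lia.
Qed.

Lemma cont_holds p l f : delta00 p -> cont (fun f => holds f l p) f.
Proof.
  intros H. destruct (delta00_use (fun _ => True) p H) as [K HK].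
  destruct (HK (listenv l) (cols f)) as [m Hm].
  destruct (cols_use K m f) as [k Hk]. exists k. intros f' A.
  apply propositional_extensionality. symmetry. apply Hm; auto.
Qed.

Lemma cont_XComp p q l f n : delta00 p -> delta00 q ->
  (exists k, holds f (k :: n :: l) p \/ ~ holds f (k :: n :: l) q) ->
  cont (fun f => opf (XComp p q l) f n) f.
Proof.
  intros Hp Hq H. simpl. apply cont_indic.
  apply (cont_bind (fun f => least (fun k => holds f (k :: n :: l) p \/ ~ holds f (k :: n :: l) q))
    (fun k f => holds f (k :: n :: l) p)); [|now apply cont_holds].
  apply (cont_least (fun k f => holds f (k :: n :: l) p \/ ~ holds f (k :: n :: l) q)); auto.
  intros k. apply cont_or; [|apply cont_not]; now apply cont_holds.
Qed.

(** * A generic array *)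

(** Terms for the elements of the ideal generated by a real. *)
Inductive tm : Type :=
| TOp (x : opx)
| TGen
| TJoin (t u : tm)
| TApp (t u : tm).

Fixpoint tm_code (t : tm) : nat :=
  match t with
  | TOp x => Pair 0 (opx_code x)
  | TGen => Pair 1 0
  | TJoin t u => Pair 2 (Pair (tm_code t) (tm_code u))
  | TApp t u => Pair 3 (Pair (tm_code t) (tm_code u))
  end.

Lemma tm_code_inj t u : tm_code t = tm_code u -> t = u.
Proof.
  revert u. induction t; intros u; destruct u; simpl; intros H; pair_inversion;
    try discriminate; f_equal; auto using opx_code_inj.
Qed.

(** A relation, because application may diverge. The string [s] is the part of the argument that was
    read, and the earlier answers 0 are required as values, so that each value has a finite use. *)
Fixpoint tm_value (t : tm) (A : real) (n v : nat) : Prop :=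
  match t with
  | TOp x => assoc (opf x) n = v
  | TGen => A n = v
  | TJoin t u => if Nat.even n then tm_value t A (Nat.div2 n) v else tm_value u A (Nat.div2 n) v
  | TApp t u => exists s, (forall i w, nth_error s i = Some w -> tm_value u A i w)
      /\ tm_value t A (code n s) (S v)
      /\ forall m, m < length s -> tm_value t A (code n (firstn m s)) 0
  end.

Lemma tm_value_functional t A n v v' : tm_value t A n v -> tm_value t A n v' -> v = v'.
Proof.
  revert n v v'. induction t; simpl; intros n v v' H H'; try congruence.
  - destruct Nat.even; eauto.
  - destruct H as [s [H1 [H2 H3]]], H' as [s' [H1' [H2' H3']]].
    (* Two strings read off the same argument are comparable, and an answer on the shorter one
       contradicts the answer 0 required of it by the longer. *)
    assert (P : forall s s' : list nat,
       (forall i w, nth_error s i = Some w -> tm_value t2 A i w) ->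
       (forall i w, nth_error s' i = Some w -> tm_value t2 A i w) ->
       length s <= length s' -> s = firstn (length s) s').
    { clear -IHt2. intros s s' H H' L. apply list_ext. intros i. rewrite nth_error_firstn.
      destruct (Nat.ltb_spec i (length s)); [|now apply nth_error_None].
      destruct (nth_error s i) as [w|] eqn:E;
        [|apply nth_error_None in E; lia].
      destruct (nth_error s' i) as [w'|] eqn:E';
        [|apply nth_error_None in E'; lia].
      f_equal. eauto. }
    destruct (Nat.lt_total (length s) (length s')) as [L|[L|L]].
    + specialize (H3' _ L). rewrite <- P in H3' by (auto; lia).
      discriminate (IHt1 _ _ _ H2 H3').
    + assert (s = s') as <-.
      { rewrite (P s s') by (auto; lia). rewrite L. apply firstn_all. }
      injection (IHt1 _ _ _ H2 H2'). auto.
    + specialize (H3 _ L). rewrite <- P in H3 by (auto; lia).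
      discriminate (IHt1 _ _ _ H2' H3).
Qed.

Lemma uniform_use (Q : nat -> real -> Prop) A (n : nat) :
  (forall i, i < n -> exists m, forall A', agree m A A' -> Q i A') ->
  exists m, forall A', agree m A A' -> forall i, i < n -> Q i A'.
Proof.
  induction n as [|n IH]; intros H; [exists 0; lia|].
  destruct IH as [m1 H1]; [auto|]. destruct (H n) as [m2 H2]; [lia|].
  exists (m1 + m2). intros A' HA i Hi. assert (i < n \/ i = n) as [L| ->] by lia.
  - apply H1; auto. eapply agree_mono; [|exact HA]; lia.
  - apply H2; auto. eapply agree_mono; [|exact HA]; lia.
Qed.

Lemma tm_value_use t A n v : tm_value t A n v -> exists m, forall A', agree m A A' -> tm_value t A' n v.
Proof.
  revert n v. induction t; simpl; intros n v H.
  - exists 0; auto.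
  - exists (S n). intros A' HA. rewrite <- H. apply HA. lia.
  - destruct Nat.even; auto.
  - destruct H as [s [H1 [H2 H3]]].
    destruct (uniform_use (fun i A' => forall w, nth_error s i = Some w -> tm_value t2 A' i w) A (length s))
      as [m1 K1].
    { intros i Hi. destruct (nth_error s i) as [w|] eqn:E;
        [|apply nth_error_None in E; lia].
      destruct (IHt2 i w (H1 i w E)) as [m Hm]. exists m. intros A' HA w' Hw.
      injection Hw as <-. auto. }
    destruct (IHt1 _ _ H2) as [m2 K2].
    destruct (uniform_use (fun i A' => tm_value t1 A' (code n (firstn i s)) 0) A (length s))
      as [m3 K3]; [auto|].
    exists (m1 + m2 + m3). intros A' HA. exists s. split; [|split].
    + intros i w E. apply K1; auto.
      * eapply agree_mono; [|exact HA]; lia.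
      * apply nth_error_Some. congruence.
    + apply K2. eapply agree_mono; [|exact HA]; lia.
    + apply K3. eapply agree_mono; [|exact HA]; lia.
Qed.

Definition generated (A : real) (g : real) : Prop := exists t, forall n, tm_value t A n (g n).

Lemma generated_ideal A : ideal (generated A).
Proof.
  split.
  - intros x. exists (TOp x). simpl. auto.
  - intros f g [t Ht] [u Hu]. exists (TJoin t u). intros n. simpl. unfold join.
    destruct Nat.even; auto.
  - intros phi f [t Ht] [u Hu] C. exists (TApp t u). intros n. simpl.
    destruct (least_spec _ (C n)) as [H1 H2].
    set (m := least (fun m => phi (code n (init f m)) <> 0)) in *.
    exists (init f m). rewrite length_init. split; [|split].
    + intros i w E. assert (i < m) by (rewrite <- (length_init f m); apply nth_error_Some; congruence).
      rewrite nth_error_init in E by auto. injection E as <-. auto.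
    + replace (S (apf phi f n)) with (phi (code n (init f m))); auto.
      unfold apf. fold m. lia.
    + intros k Hk. rewrite firstn_init by lia.
      replace 0 with (phi (code n (init f k))); auto. specialize (H2 k Hk). lia.
Qed.

Lemma generated_countable A : countable (generated A).
Proof.
  apply (countable_injection tm_code
    (fun t => epsilon (inhabits (fun _ => 0)) (fun g => forall n, tm_value t A n (g n))) (fun _ => 0)).
  - exact tm_code_inj.
  - intros g [t Ht]. exists t. extensionality n. apply (tm_value_functional t A n); auto.
    apply (epsilon_spec (inhabits (fun _ => 0)) (fun g => forall n, tm_value t A n (g n))). eauto.
Qed.

Lemma generated_gen A : generated A A.
Proof. exists TGen. simpl. auto. Qed.

(** Finite extension forcing: a condition is an initial segment of [A] together
    with limits of its first columns, which later entries have to respect. *)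
Definition respects (s c s' : list nat) : Prop :=
  prefix s s' /\ forall i v, length s <= i -> nth_error s' i = Some v ->
    forall n k, i = Pair n k -> n < length c -> v = nth n c 0.

Definition forces (s : list nat) (t : tm) (n v : nat) : Prop :=
  forall A, init A (length s) = s -> tm_value t A n v.

(** The limit of column [length c] is still free when [t] is examined at the argument [length c], so
    it can be made to differ from a value forced by some extension. If no extension forces a value,
    [t] has none there on the generic array. *)
Lemma respects_step t s c : exists s' b, respects s c s' /\ length s < length s' /\
  ((exists v, b <> v /\ forces s' t (length c) v) \/
   (forall s'' v, respects s c s'' -> ~ forces s'' t (length c) v)).
Proof.
  (* The new entry takes the limit of its column; outside the restricted columns any entry would
     do. *)
  assert (Hx : forall s', respects s c s' -> exists w, respects s c (s' ++ [w])).
  { intros s' [Hp H].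
    exists (nth (fst (unpair (length s'))) c 0). split.
    - destruct Hp as [u ->]. rewrite <- app_assoc. eexists; eauto.
    - intros i v Hi E n k -> Hn.
      destruct (Nat.lt_ge_cases (Pair n k) (length s')) as [L|L].
      + rewrite nth_error_app1 in E by auto. eauto.
      + rewrite nth_error_app2 in E by auto.
        destruct (Pair n k - length s') as [|j] eqn:Ej; [|destruct j; discriminate].
        injection E as <-. replace (length s') with (Pair n k) by lia.
        now rewrite unpair_Pair. }
  assert (H0 : respects s c s).
  { split; [apply prefix_refl|]. intros i v Hi E. apply nth_error_None in Hi. congruence. }
  destruct (classic (exists s'' v, respects s c s'' /\ forces s'' t (length c) v)) as [[s'' [v [R F]]]|H].
  - destruct (Hx s'' R) as [w Hw]. exists (s'' ++ [w]), (S v). split; auto.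
    destruct R as [R _]. apply prefix_length in R.
    split; [rewrite length_app; simpl; lia|]. left. exists v. split; [lia|].
    intros A HA. apply F. rewrite <- (firstn_init (length s'') (length (s'' ++ [w]))).
    + rewrite HA. rewrite firstn_app, firstn_all, Nat.sub_diag. simpl. apply app_nil_r.
    + rewrite length_app. lia.
  - destruct (Hx s H0) as [w Hw]. exists (s ++ [w]), 0. split; auto.
    split; [rewrite length_app; simpl; lia|]. right. intros s'' v R F. eauto.
Qed.

Lemma generic_exists : exists A c : real,
  (forall n, exists m, forall k, m <= k -> A (Pair n k) = c n) /\ ~ generated A c.
Proof.
  destruct (countable_injection tm_code (fun t => t) TGen (fun _ => True) tm_code_inj) as [e He];
    [eauto|].
  set (Q := fun (t : tm) (p q : list nat * list nat) => exists b, snd q = snd p ++ [b] /\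
    respects (fst p) (snd p) (fst q) /\ length (fst p) < length (fst q) /\
    ((exists v, b <> v /\ forces (fst q) t (length (snd p)) v) \/
     (forall s'' v, respects (fst p) (snd p) s'' -> ~ forces s'' t (length (snd p)) v))).
  assert (HQ : forall t p, exists q, Q t p q).
  { intros t [s c]. destruct (respects_step t s c) as [s' [b H]].
    exists (s', c ++ [b]). exists b. simpl. auto. }
  set (nxt := fun t p => epsilon (inhabits ([], [])) (Q t p)).
  assert (Hn : forall t p, Q t p (nxt t p)) by (intros; apply epsilon_spec, HQ).
  set (p := fix p i := match i with 0 => ([], []) | S i => nxt (e i) (p i) end).
  assert (Hp : forall i, Q (e i) (p i) (p (S i))) by (intros i; apply Hn).
  assert (Hc : forall i, length (snd (p i)) = i).
  { induction i as [|i IH]; auto. destruct (Hp i) as [b [E _]].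
    rewrite E, length_app, IH. simpl. lia. }
  assert (Hs : forall i, i <= length (fst (p i))).
  { induction i as [|i IH]; [lia|]. destruct (Hp i) as [b [_ [_ [L _]]]]. lia. }
  assert (Hpre : forall i j, i <= j -> prefix (fst (p i)) (fst (p j)) /\ prefix (snd (p i)) (snd (p j))).
  { intros i j H. induction H as [|j H [IH1 IH2]]; [split; apply prefix_refl|].
    destruct (Hp j) as [b [E [[R _] _]]]. split; eapply prefix_trans; eauto.
    rewrite E. eexists; eauto. }
  set (A := fun i => nth i (fst (p (S i))) 0). set (c := fun n => nth n (snd (p (S n))) 0).
  assert (HA : forall j i v, nth_error (fst (p j)) i = Some v -> A i = v).
  { intros j i v E. unfold A. apply nth_error_nth.
    destruct (Nat.le_ge_cases j (S i)) as [L|L].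
    - destruct (Hpre _ _ L) as [H _]. rewrite prefix_nth in H. auto.
    - destruct (Hpre _ _ L) as [H _]. rewrite prefix_nth in H.
      destruct (nth_error (fst (p (S i))) i) as [w|] eqn:E'.
      + apply H in E'. congruence.
      + apply nth_error_None in E'. specialize (Hs (S i)). lia. }
  assert (Hcc : forall j n, n < j -> nth n (snd (p j)) 0 = c n).
  { intros j n L. unfold c. destruct (Hpre (S n) j L) as [_ H]. rewrite prefix_nth in H.
    destruct (nth_error (snd (p (S n))) n) as [w|] eqn:E'.
    - rewrite (nth_error_nth _ _ 0 E'). apply nth_error_nth. auto.
    - apply nth_error_None in E'. rewrite Hc in E'. lia. }
  assert (HI : forall j, init A (length (fst (p j))) = fst (p j)).
  { intros j. apply list_ext. intros i.
    destruct (nth_error (fst (p j)) i) as [v|] eqn:E.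
    - rewrite nth_error_init; [f_equal; eauto|]. apply nth_error_Some. congruence.
    - apply nth_error_None. rewrite length_init. now apply nth_error_None. }
  assert (HR : forall j i, length (fst (p j)) <= i -> forall n k, i = Pair n k -> n < j -> A i = c n).
  { intros j i Hi n k -> Hnj.
    assert (K : forall l, j <= l -> forall v, nth_error (fst (p l)) (Pair n k) = Some v -> v = c n).
    { intros l Hl. induction Hl as [|l Hl IH]; intros v E.
      - apply nth_error_None in Hi. congruence.
      - destruct (Nat.lt_ge_cases (Pair n k) (length (fst (p l)))) as [L|L].
        + destruct (nth_error (fst (p l)) (Pair n k)) as [w|] eqn:E'.
          * destruct (Hpre l (S l)) as [H _]; [lia|]. rewrite prefix_nth in H.
            apply H in E'. rewrite E in E'. injection E' as ->. auto.
          * apply nth_error_None in E'. lia.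
        + destruct (Hp l) as [b [_ [[_ R] _]]]. rewrite (R (Pair n k) v L E n k eq_refl).
          * apply Hcc. lia.
          * rewrite Hc. lia. }
    set (l := j + S (Pair n k)).
    destruct (nth_error (fst (p l)) (Pair n k)) as [v|] eqn:E.
    - rewrite (HA _ _ _ E). apply (K l); auto. lia.
    - apply nth_error_None in E. specialize (Hs l). lia. }
  exists A, c. split.
  - intros n. exists (length (fst (p (S n)))). intros k Hk.
    apply (HR (S n) (Pair n k) ltac:(pose proof (Pair_bound n k); lia) n k eq_refl). lia.
  - intros [t Ht]. destruct (He t I) as [i Hi].
    destruct (Hp i) as [b [Eb [_ [_ H]]]]. rewrite Hc in H. rewrite Hi in H.
    assert (Hb : c i = b).
    { rewrite <- (Hcc (S i)) by lia. rewrite Eb, app_nth2; rewrite Hc; [|lia].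
      now rewrite Nat.sub_diag. }
    destruct H as [[v [Hv F]]|H].
    + specialize (F A (HI _)). apply Hv. rewrite <- Hb. apply (tm_value_functional t A i); auto.
    (* A value of [t] on [A] has a finite use, so a long initial segment of [A], which respects the
       limits fixed so far, forces it after all. *)
    + destruct (tm_value_use _ _ _ _ (Ht i)) as [m Hm].
      apply (H (init A (length (fst (p i)) + m)) (c i)).
      * split.
        -- rewrite <- (HI i) at 1. rewrite <- (firstn_init _ (length (fst (p i)) + m)) by lia.
           apply prefix_firstn.
        -- intros j v Hj E n k -> Hlt. rewrite Hc in Hlt. rewrite Hcc by auto.
           assert (L : Pair n k < length (fst (p i)) + m)
             by (rewrite <- (length_init A (length (fst (p i)) + m)); apply nth_error_Some; congruence).
           rewrite nth_error_init in E by auto. injection E as <-.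
           now apply (HR i (Pair n k) Hj n k).
      * intros A' HA'. rewrite length_init in HA'. apply Hm.
        apply agree_init in HA'. eapply agree_mono; [|exact HA']; lia.
Qed.

(** * Measure and forcing *)

Lemma half_pos k : (0 < half k)%R.
Proof. apply pow_lt. lra. Qed.

Lemma half_S k : (half (S k) = half k / 2)%R.
Proof. unfold half. simpl. lra. Qed.

Lemma half_le_1 k : (half k <= 1)%R.
Proof.
  induction k as [|k IH]; [unfold half; simpl; lra|]. rewrite half_S.
  pose proof (half_pos k). lra.
Qed.

Lemma half_antitone k l : k <= l -> (half l <= half k)%R.
Proof.
  induction 1 as [|l H IH]; [lra|]. rewrite half_S. pose proof (half_pos l). lra.
Qed.

Lemma expect_le n phi psi : (forall s, length s = n -> (phi s <= psi s)%R) ->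
  (expect n phi <= expect n psi)%R.
Proof.
  revert phi psi. induction n as [|n IH]; intros phi psi H; simpl; [apply H; auto|].
  assert (expect n (fun s => phi (true :: s)) <= expect n (fun s => psi (true :: s)))%R
    by (apply IH; intros; apply H; simpl; auto).
  assert (expect n (fun s => phi (false :: s)) <= expect n (fun s => psi (false :: s)))%R
    by (apply IH; intros; apply H; simpl; auto).
  lra.
Qed.

Lemma expect_add n phi psi :
  (expect n (fun s => phi s + psi s) = expect n phi + expect n psi)%R.
Proof.
  revert phi psi. induction n as [|n IH]; intros phi psi; simpl; [lra|].
  rewrite (IH (fun s => phi (true :: s))), (IH (fun s => phi (false :: s))). lra.
Qed.

Lemma expect_const n c : expect n (fun _ => c) = c.
Proof. induction n as [|n IH]; simpl; auto. rewrite IH. lra. Qed.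

Lemma expect_firstn g n phi : g <= n -> expect n (fun s => phi (firstn g s)) = expect g phi.
Proof.
  revert n phi. induction g as [|g IH]; intros n phi H.
  - simpl. apply expect_const.
  - destruct n as [|n]; [lia|]. simpl.
    rewrite (IH n (fun s => phi (true :: s))), (IH n (fun s => phi (false :: s))) by lia. auto.
Qed.

Lemma indic_range P : (0 <= INR (indic P) <= 1)%R.
Proof. unfold indic. destruct excluded_middle_informative; simpl; lra. Qed.

Lemma prob_le n P Q : (forall s, length s = n -> P s -> Q s) -> (prob n P <= prob n Q)%R.
Proof.
  intros H. apply expect_le. intros s Hs.
  destruct (classic (P s)) as [K|K].
  - rewrite !indic_true; auto. lra.
  - rewrite (indic_false (P s)) by auto. apply indic_range.
Qed.

Lemma prob_or n P Q R : (forall s, length s = n -> P s -> Q s \/ R s) ->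
  (prob n P <= prob n Q + prob n R)%R.
Proof.
  intros H. unfold prob. rewrite <- expect_add. apply expect_le. intros s Hs.
  pose proof (indic_range (Q s)). pose proof (indic_range (R s)).
  destruct (classic (P s)) as [K|K].
  - destruct (H s Hs K) as [L|L]; rewrite (indic_true _ K), (indic_true _ L); simpl; lra.
  - rewrite (indic_false (P s)) by auto. simpl. lra.
Qed.

Lemma prob_empty n P : (forall s, length s = n -> ~ P s) -> prob n P = 0%R.
Proof.
  intros H. apply Rle_antisym.
  - rewrite <- (expect_const n 0). apply expect_le. intros s Hs.
    rewrite indic_false by auto. simpl. lra.
  - rewrite <- (expect_const n 0) at 1. apply expect_le. intros s Hs. apply indic_range.
Qed.

Lemma prob_exists n P : (0 < prob n P)%R -> exists s, length s = n /\ P s.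
Proof.
  intros H. apply NNPP. intros K. rewrite prob_empty in H; [lra|].
  intros s Hs Ps. apply K. eauto.
Qed.

Lemma prob_firstn g n P : g <= n -> prob n (fun s => P (firstn g s)) = prob g P.
Proof. intros H. exact (expect_firstn g n (fun s => INR (indic (P s))) H). Qed.

Lemma prob_true n P : (forall s, length s = n -> P s) -> prob n P = 1%R.
Proof.
  intros H. rewrite <- (expect_const n 1). apply Rle_antisym; apply expect_le; intros s Hs;
    rewrite indic_true by auto; simpl; lra.
Qed.

Lemma prob_eq n u : length u = n -> (prob n (fun s => s = u) <= half n)%R.
Proof.
  revert u. induction n as [|n IH]; intros u Hu.
  - unfold prob, half. simpl. apply indic_range.
  - destruct u as [|b u]; [discriminate|]. simpl in Hu. injection Hu as Hu.
    rewrite half_S. specialize (IH u Hu).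
    change (prob (S n) (fun s => s = b :: u)) with
      ((prob n (fun s => true :: s = b :: u) + prob n (fun s => false :: s = b :: u)) / 2)%R.
    destruct b.
    + rewrite (prob_empty n (fun s => false :: s = true :: u)) by congruence.
      assert (prob n (fun s => true :: s = true :: u) <= prob n (fun s => s = u))%R
        by (apply prob_le; congruence). lra.
    + rewrite (prob_empty n (fun s => true :: s = false :: u)) by congruence.
      assert (prob n (fun s => false :: s = false :: u) <= prob n (fun s => s = u))%R
        by (apply prob_le; congruence). lra.
Qed.

Lemma prob_list {A} n (P : list bool -> Prop) (Q : A -> list bool -> Prop) (l : list A) eps :
  (forall s, length s = n -> P s -> exists x, List.In x l /\ Q x s) ->
  (forall x, List.In x l -> (prob n (Q x) <= eps)%R) ->
  (prob n P <= INR (length l) * eps)%R.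
Proof.
  revert P. induction l as [|a l IH]; intros P H HQ.
  - rewrite prob_empty; [simpl; lra|]. intros s Hs K. destruct (H s Hs K) as [x [[] _]].
  - assert (H1 : (prob n P <= prob n (Q a) + prob n (fun s => exists x, List.In x l /\ Q x s))%R).
    { apply prob_or. intros s Hs K. destruct (H s Hs K) as [x [[<-|Hx] Hq]]; eauto. }
    assert (H2 := IH (fun s => exists x, List.In x l /\ Q x s) (fun s _ K => K)
      (fun x Hx => HQ x (or_intror Hx))).
    assert (H3 := HQ a (or_introl eq_refl)).
    change (length (a :: l)) with (S (length l)). rewrite S_INR. lra.
Qed.

Lemma prob_geometric n (P : list bool -> Prop) (Q : nat -> list bool -> Prop) l k :
  (forall s, length s = n -> P s -> exists i, i < l /\ Q i s) ->
  (forall i, i < l -> (prob n (Q i) <= half (k + i + 2))%R) ->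
  (prob n P <= half (k + 1))%R.
Proof.
  intros H HQ.
  (* The exact partial sum of the geometric series is carried through the induction on [l]. *)
  assert (K : (prob n P <= half (k + 1) - half (k + l + 1))%R).
  { revert P H. induction l as [|l IH]; intros P H.
    - rewrite prob_empty; [rewrite Nat.add_0_r; lra|].
      intros s Hs K. destruct (H s Hs K) as [x [Hx _]]. lia.
    - assert (H1 : (prob n P <= prob n (fun s => exists i, (i < l)%nat /\ Q i s) + prob n (Q l))%R).
      { apply prob_or. intros s Hs K. destruct (H s Hs K) as [i [Hi Hq]].
        assert (i < l \/ i = l) as [L| ->] by lia; eauto. }
      assert (H2 := IH (fun i Hi => HQ i (Nat.lt_lt_succ_r _ _ Hi)) _ (fun s _ K => K)).
      assert (H3 := HQ l (Nat.lt_succ_diag_r l)).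
      replace (k + l + 2) with (S (k + l + 1)) in H3 by lia.
      replace (k + S l + 1) with (S (k + l + 1)) by lia.
      rewrite half_S in *. lra. }
  pose proof (half_pos (k + l + 1)). lra.
Qed.

Lemma finite_eventually {A} (P : A -> nat -> Prop) (l : list A) :
  (forall x, List.In x l -> exists n, forall m, n <= m -> P x m) ->
  exists n, forall m, n <= m -> forall x, List.In x l -> P x m.
Proof.
  induction l as [|a l IH]; intros H.
  - exists 0. intros m _ x [].
  - destruct IH as [n1 H1]; [intros; apply H; simpl; auto|].
    destruct (H a) as [n2 H2]; [simpl; auto|].
    exists (n1 + n2). intros m Hm x [<-|Hx]; [apply H2|apply H1]; auto; lia.
Qed.

Lemma konig (b : real) (R : list nat -> Prop) :
  (forall s m, R s -> R (firstn m s)) ->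
  (forall n, exists s, List.In s (bstr b n) /\ R s) ->
  exists X, (forall n, X n <= b n) /\ forall m, R (init X m).
Proof.
  intros HR Hinf.
  set (big := fun s => forall n, length s <= n ->
    exists s', List.In s' (bstr b n) /\ prefix s s' /\ R s').
  assert (Hstep : forall s, exists x, big s -> x <= b (length s) /\ big (s ++ [x])).
  { intros s. destruct (classic (big s)) as [Hs|Hs]; [|exists 0; tauto].
    apply NNPP. intros K.
    destruct (finite_eventually (fun x n => ~ exists s', List.In s' (bstr b n) /\ prefix (s ++ [x]) s' /\ R s')
      (List.seq 0 (S (b (length s))))) as [n Hn].
    - intros x Hx. apply in_seq in Hx.
      assert (Hb : ~ big (s ++ [x])) by (intros Hb; apply K; exists x; split; [lia|auto]).
      apply not_all_ex_not in Hb as [n Hb]. exists n. intros m Hm [s' [H1 [H2 H3]]].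
      apply Hb. intros Hl. exists (firstn n s'). split; [now apply (firstn_bstr b m)|].
      split; auto. now apply prefix_firstn_le.
    - destruct (Hs (S n + length s)) as [s' [H1 [[u ->] H3]]]; [lia|].
      destruct u as [|x u].
      { apply in_bstr in H1 as [H1 _]. rewrite app_nil_r in H1. lia. }
      apply (Hn (S n + length s) ltac:(lia) x).
      + apply in_seq. apply in_bstr in H1 as [_ H1].
        specialize (H1 (length s) x). rewrite nth_error_app2, Nat.sub_diag in H1 by auto.
        specialize (H1 eq_refl). lia.
      + exists (s ++ x :: u). split; auto. split; auto. exists u. now rewrite <- app_assoc. }
  set (nx := fun s => epsilon (inhabits 0) (fun x => big s -> x <= b (length s) /\ big (s ++ [x]))).
  assert (Hnx : forall s, big s -> nx s <= b (length s) /\ big (s ++ [nx s])).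
  { intros s. apply (epsilon_spec (inhabits 0)
      (fun x => big s -> x <= b (length s) /\ big (s ++ [x])) (Hstep s)). }
  set (p := fix p n := match n with 0 => [] | S n => p n ++ [nx (p n)] end).
  assert (Hp : forall n, big (p n) /\ length (p n) = n).
  { induction n as [|n [IH1 IH2]].
    - split; auto. intros n _. destruct (Hinf n) as [s [H1 H2]]. exists s.
      split; auto. split; auto. now exists s.
    - simpl. split; [now apply Hnx|]. rewrite length_app, IH2. simpl. lia. }
  exists (fun n => nx (p n)).
  assert (Hi : forall m, init (fun n => nx (p n)) m = p m).
  { induction m as [|m IH]; auto. rewrite init_S, IH. auto. }
  split.
  - intros n. destruct (Hp n) as [H1 H2]. destruct (Hnx _ H1) as [H _]. now rewrite H2 in H.
  - intros m. rewrite Hi. destruct (Hp m) as [H1 H2].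
    destruct (H1 m) as [s' [H3 [H4 H5]]]; [lia|].
    apply in_bstr in H3 as [H3 _]. replace (p m) with s'; auto.
    symmetry. apply prefix_same_length; auto. lia.
Qed.

Lemma mix_firstn m t s : firstn m (mix t s) = mix (firstn m t) (firstn m s).
Proof. unfold mix. now rewrite firstn_map, combine_firstn. Qed.

Lemma length_mix t s : length (mix t s) = Nat.min (length t) (length s).
Proof. unfold mix. now rewrite length_map, length_combine. Qed.

Lemma mix_bstr n t s : length t = n -> length s = n -> List.In (mix t s) (bstr (fun _ => 3) n).
Proof.
  intros Ht Hs. apply in_bstr. split; [rewrite length_mix; lia|].
  intros i v E. unfold mix in E. rewrite nth_error_map in E.
  destruct nth_error as [[a c]|]; [|discriminate].
    injection E as <-. destruct a, c; simpl; lia.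
Qed.

Lemma mix_div2 n t s : length t = n -> length s = n ->
  map Nat.div2 (mix t s) = map Nat.b2n t.
Proof.
  revert t s. induction n as [|n IH]; intros [|a t] [|b s] Ht Hs; try discriminate; auto.
  simpl in *. unfold mix in *. simpl. rewrite IH by lia. f_equal.
  destruct a, b; auto.
Qed.

Lemma mix_odd n t s : length t = n -> length s = n ->
  map (fun x => Nat.b2n (Nat.odd x)) (mix t s) = map Nat.b2n s.
Proof.
  revert t s. induction n as [|n IH]; intros [|a t] [|b s] Ht Hs; try discriminate; auto.
  simpl in *. unfold mix in *. simpl. rewrite IH by lia. f_equal.
  destruct a, b; auto.
Qed.

(** The path component [t] may change with [n]. Failure of largeness then provides one length at
    which all sections are small, and this is the length that [XBound] searches for. *)
Definition large (k : nat) (Q : real) : Prop := forall n, exists t, length t = n /\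
  (half k <= prob n (fun s => mem Q (mix t s)))%R.

Definition condition (N : real -> Prop) (k : nat) (Q : real) : Prop :=
  N Q /\ (forall s m, mem Q s -> mem Q (firstn m s)) /\ large k Q.

Lemma mem_indic (P : list nat -> Prop) s : mem (fun c => indic (P (dec c))) s <-> P s.
Proof. unfold mem. now rewrite dec_enc, indic_nonzero. Qed.

(** The dichotomy behind the forcing: either the search for the value at some
    [n] fails on a large subtree, or removing for each [n] the few branches on
    which it is slow leaves a large subtree with a common bound [g]. *)
Lemma density N k Q W : ideal N -> condition N k Q -> N W ->
  exists k' Q', condition N k' Q' /\ (forall s, mem Q' s -> mem Q s) /\
    ((exists n, forall s, mem Q' s -> diverging Q W n s) \/
     (exists g, N g /\ forall X, (forall m, mem Q' (init X m)) ->
        forall n, exists m, m <= g n /\ W (code n (init X m)) <> 0)).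
Proof.
  intros I [HN [Hc HL]] HW.
  assert (HQW : N (join Q W)) by now apply ideal_join.
  destruct (classic (exists n k', large k' (opf (XDiv n) (join Q W)))) as [[n [k' H]]|H].
  - exists k', (opf (XDiv n) (join Q W)).
    assert (E : forall s, mem (opf (XDiv n) (join Q W)) s <-> diverging Q W n s).
    { intros s. simpl. rewrite pl_join, pr_join. apply mem_indic. }
    split; [|split].
    + split; [|split]; auto.
      * apply ideal_total; auto.
      * intros s m. rewrite !E. intros [H1 H2]. split; auto.
        intros m' Hm'. rewrite firstn_firstn. apply H2. rewrite length_firstn in Hm'. lia.
    + intros s Hs. now apply E in Hs as [Hs _].
    + left. exists n. intros s. apply E.
  - assert (Hsmall : forall n k', exists l, forall t, List.In t (bools l) ->
      (prob l (fun s => diverging Q W n (mix t s)) < half k')%R).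
    { intros n k'. apply NNPP. intros K. apply H. exists n, k'. intros l.
      apply NNPP. intros K'. apply K. exists l. intros t Ht. apply in_bools in Ht.
      apply Rnot_le_lt. intros K''. apply K'. exists t. split; auto.
      eapply Rle_trans; [exact K''|]. apply prob_le. intros s _ Hs.
      simpl. rewrite pl_join, pr_join. now apply mem_indic. }
    (* The part removed for [n] has measure below [2^-(k+n+2)] in each section, in total at most
       [2^-(k+1)]. This is half of what the condition guarantees, so the remainder has exponent
       [k + 1]. *)
    set (g := opf (XBound k) (join Q W)).
    assert (Hg : N g).
    { apply ideal_closed; auto. intros n. apply cont_XBound. auto. }
    assert (Hg' : forall n t, length t = g n ->
      (prob (g n) (fun s => diverging Q W n (mix t s)) < half (k + n + 2))%R).
    { intros n t Ht. apply in_bools in Ht. revert t Ht. unfold g. simpl.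
      rewrite pl_join, pr_join. apply (least_spec _ (Hsmall n (k + n + 2))). }
    set (Q' := opf XPrune (join (join Q W) g)).
    assert (E : forall s, mem Q' s <-> pruned Q W g s).
    { intros s. unfold Q'. simpl. rewrite !pl_join, !pr_join. apply mem_indic. }
    exists (k + 1), Q'. split; [|split].
    + split; [|split].
      * apply ideal_total; auto. now apply ideal_join.
      * intros s m. rewrite !E. intros [H1 H2]. split; auto.
        intros n Hn Hgn. rewrite length_firstn in Hn, Hgn.
        rewrite firstn_firstn. rewrite Nat.min_l by lia. apply H2; lia.
      * intros l. destruct (HL l) as [t [Ht Hp]]. exists t. split; auto.
        assert (H1 : (prob l (fun s => mem Q (mix t s)) <= prob l (fun s => mem Q' (mix t s)) +
          prob l (fun s => exists n, (n < S l)%nat /\ ((g n <= l)%nat /\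
             diverging Q W n (mix (firstn (g n) t) (firstn (g n) s)))))%R).
        { apply prob_or. intros s Hs Hm.
          destruct (classic (mem Q' (mix t s))) as [K|K]; auto. right.
          apply NNPP. intros K'. apply K. apply E. split; auto.
          rewrite length_mix, Ht, Hs, Nat.min_id. intros n Hn Hgn Hd.
          apply K'. exists n. rewrite <- mix_firstn. split; [lia|]. auto. }
        assert (H2 := prob_geometric l _ _ (S l) k (fun s _ K => K)
          : _ -> (prob l (fun s => exists n, (n < S l)%nat /\ ((g n <= l)%nat /\
             diverging Q W n (mix (firstn (g n) t) (firstn (g n) s)))) <= half (k + 1))%R).
        assert (H3 : (prob l (fun s => exists n, (n < S l)%nat /\ ((g n <= l)%nat /\
             diverging Q W n (mix (firstn (g n) t) (firstn (g n) s)))) <= half (k + 1))%R).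
        { apply H2. intros n Hn. destruct (Nat.le_gt_cases (g n) l) as [L|L].
          - apply Rle_trans with (prob l (fun s => diverging Q W n (mix (firstn (g n) t) (firstn (g n) s)))).
            + apply prob_le. intros s _ [_ K]. exact K.
            + rewrite (prob_firstn (g n) l (fun s => diverging Q W n (mix (firstn (g n) t) s))) by auto.
              apply Rlt_le, Hg'. rewrite length_firstn. lia.
          - rewrite prob_empty; [apply Rlt_le, half_pos|]. intros s _ [K _]. lia. }
        replace (k + 1) with (S k) in * by lia. rewrite half_S in *. lra.
    + intros s Hs. now apply E in Hs as [Hs _].
    + right. exists g. split; auto. intros X HX n.
      (* A string of length [n + g n] satisfies both length restrictions in [pruned] for this
         [n]. *)
      assert (Hm := HX (n + g n)). apply E in Hm as [H1 H2].
      specialize (H2 n). rewrite length_init in H2.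
      specialize (H2 ltac:(lia) ltac:(lia)). rewrite firstn_init in H2 by lia.
      apply NNPP. intros K. apply H2. split.
      * rewrite <- (firstn_init (g n) (n + g n)) by lia. auto.
      * intros m Hm'. rewrite length_init in Hm'. rewrite firstn_init by auto.
        apply NNPP. intros K'. apply K. exists m. auto.
Qed.

(** In [step] one dichotomy serves two purposes. If [W] searches for the values of a total
    functional, the second alternative is impossible and the first gives domination. If [W] searches
    for an exit from a closed set containing the random real, the first is impossible and the second
    gives positive measure. *)
Lemma generic_path N B : ideal N -> countable N -> N B ->
  (forall s m, mem B s -> mem B (firstn m s)) ->
  (forall n, exists t, length t = n /\ mem B (map Nat.b2n t)) ->
  exists X, (forall n, X n <= 3) /\ (forall m, mem B (map Nat.div2 (init X m))) /\
    forall W, N W ->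
      (exists g, N g /\ forall n, exists m, m <= g n /\ W (code n (init X m)) <> 0) \/
      (exists n k, (forall m, W (code n (init X m)) = 0) /\
         forall l, exists t, length t = l /\
           (half k <= prob l (fun s => forall m, (m <= l)%nat -> W (code n (firstn m (mix t s))) = 0%nat))%R).
Proof.
  intros I [e He] HB Hc Hinf.
  set (R := fun W p q => condition N (fst p) (snd p) -> N W ->
    condition N (fst q) (snd q) /\ (forall s, mem (snd q) s -> mem (snd p) s) /\
    ((exists n, forall s, mem (snd q) s -> diverging (snd p) W n s) \/
     (exists g, N g /\ forall X, (forall m, mem (snd q) (init X m)) ->
        forall n, exists m, m <= g n /\ W (code n (init X m)) <> 0))).
  assert (HR : forall W p, exists q : nat * real, R W p q).
  { intros W [k Q]. destruct (classic (condition N k Q /\ N W)) as [[H1 H2]|H].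
    - destruct (density N k Q W I H1 H2) as [k' [Q' H]]. exists (k', Q'). intros _ _. exact H.
    - exists (0, Q). intros H1 H2. simpl in *. tauto. }
  set (nxt := fun W p => epsilon (inhabits (0, fun _ => 0)) (R W p)).
  assert (Hn : forall W p, R W p (nxt W p)) by (intros; apply epsilon_spec, HR).
  (* The enumeration [e] may also list reals outside [N]; they are replaced by members of [N]. *)
  set (W' := fun i => epsilon (inhabits B) (fun W => N W /\ (N (e i) -> W = e i))).
  assert (HW' : forall i, N (W' i) /\ (N (e i) -> W' i = e i)).
  { intros i. apply (epsilon_spec (inhabits B) (fun W => N W /\ (N (e i) -> W = e i))).
    destruct (classic (N (e i))) as [H|H]; [exists (e i)|exists B]; tauto. }
  set (p := fix p i := match i with 0 => (0, opf XStart B) | S i => nxt (W' i) (p i) end).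
  assert (E0 : forall s, mem (opf XStart B) s <-> mem B (map Nat.div2 s))
    by (intros s; apply (mem_indic (fun s => mem B (map Nat.div2 s)))).
  assert (Hp : forall i, condition N (fst (p i)) (snd (p i))).
  { induction i as [|i IH].
    - split; [|split].
      + change (snd (p 0)) with (opf XStart B). now apply ideal_total.
      + change (snd (p 0)) with (opf XStart B). intros s m. rewrite !E0, <- firstn_map. auto.
      + change (snd (p 0)) with (opf XStart B). intros n. destruct (Hinf n) as [t [Ht Hm]]. exists t. split; auto.
        rewrite prob_true; [apply half_le_1|]. intros s Hs. apply E0. now rewrite (mix_div2 n).
    - destruct (Hn (W' i) (p i) IH (proj1 (HW' i))) as [H _]. exact H. }
  assert (Hq := fun i => Hn (W' i) (p i) (Hp i) (proj1 (HW' i))).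
  assert (Hmono : forall i j, i <= j -> forall s, mem (snd (p j)) s -> mem (snd (p i)) s).
  { intros i j H. induction H as [|j H IH]; auto. intros s Hs. apply IH.
    apply (Hq j). exact Hs. }
  (* The tree is the intersection of all conditions. Its levels are nonempty: each level has
     finitely many candidates and the conditions decrease, so if all candidates were dropped, some
     single condition would be empty there, contrary to its largeness. *)
  destruct (konig (fun _ => 3) (fun s => forall i, mem (snd (p i)) s)) as [X [HX1 HX2]].
  - intros s m Hs i. apply Hp. auto.
  - intros n. apply NNPP. intros K.
    destruct (finite_eventually (fun s i => ~ mem (snd (p i)) s) (bstr (fun _ => 3) n)) as [i Hi].
    + intros s Hs. apply NNPP. intros K'. apply K. exists s. split; auto. intros i.
      apply NNPP. intros K''. apply K'. exists i. intros m Hm Hmem. apply K''. eauto.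
    + destruct (Hp i) as [_ [_ HL]]. destruct (HL n) as [t [Ht Hpr]].
      destruct (prob_exists n (fun s => mem (snd (p i)) (mix t s))) as [s [Hs Hm]].
      * pose proof (half_pos (fst (p i))). lra.
      * apply (Hi i (le_n i) (mix t s)); auto. now apply mix_bstr.
  - exists X. split; auto. split.
    + intros m. apply E0. apply (HX2 m 0).
    + intros W HW. destruct (He W HW) as [i Hi].
      assert (EW : W' i = W) by (rewrite <- Hi in HW |- *; now apply HW').
      destruct (Hq i) as [_ [_ [[n Hd]|[g [Hg1 Hg2]]]]].
      * right. exists n, (fst (p (S i))). split.
        -- intros m. destruct (Hd (init X m)) as [_ H]; [apply (HX2 m (S i))|].
           specialize (H m). rewrite length_init, firstn_init, EW in H by auto. auto.
        -- intros l. destruct (Hp (S i)) as [_ [_ HL]]. destruct (HL l) as [t [Ht Hpr]].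
           exists t. split; auto. eapply Rle_trans; [exact Hpr|]. apply prob_le.
           intros s Hs Hm m Hml. destruct (Hd _ Hm) as [_ H]. rewrite EW in H.
           apply H. rewrite length_mix. lia.
      * left. exists g. split; auto. intros n. rewrite <- EW. apply Hg2.
        intros m. apply (HX2 m (S i)).
Qed.

(** * The tower of ideals *)

(** The ideal generated by [N] and [X]. With the parameter [f] kept apart from the functional [phi],
    the associate of any operator can take the place of [phi]. *)
Definition adjoin (N : real -> Prop) (X g : real) : Prop :=
  exists phi f, N phi /\ N f /\ (forall n, conv phi (join f X) n) /\ g = apf phi (join f X).

Definition dominated (M N : real -> Prop) : Prop :=
  forall f, M f -> exists g, N g /\ forall n, f n <= g n.

Definition binary_infinite (B : real) : Prop :=
  (forall s m, mem B s -> mem B (firstn m s)) /\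
  forall n, exists t, length t = n /\ mem B (map Nat.b2n t).

(** Weak (Kurtz) randomness relative to [N], stated through the finite approximations of a closed
    set. *)
Definition random (N : real -> Prop) (z : real) : Prop :=
  (forall n, z n <= 1) /\ forall D, N D -> (forall n, mem D (init z n)) ->
    exists k, forall n, (half k <= prob n (fun s => mem D (map Nat.b2n s)))%R.

Lemma adjoin_op N x f X : ideal N -> N f ->
  (forall n, cont (fun f => opf x f n) (join f X)) -> adjoin N X (opf x (join f X)).
Proof.
  intros I Hf H. exists (assoc (opf x)), f. split; [apply (ideal_op _ I)|]. split; auto.
  split; [intros n; now apply assoc_conv|]. extensionality n. symmetry. now apply apf_assoc.
Qed.

Lemma adjoin_base N X f : ideal N -> N f -> adjoin N X f.
Proof.
  intros I Hf. replace f with (opf XFst (join f X)) by (simpl; now rewrite pl_join).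
  apply adjoin_op; auto. intros n. now apply cont_total_op.
Qed.

Lemma adjoin_ideal N X : ideal N -> ideal (adjoin N X).
Proof.
  intros I. split.
  - intros x. apply adjoin_base; auto. apply (ideal_op _ I).
  - intros g1 g2 [p1 [f1 [P1 [F1 [C1 ->]]]]] [p2 [f2 [P2 [F2 [C2 ->]]]]].
    replace (join (apf p1 (join f1 X)) (apf p2 (join f2 X)))
      with (opf XJoin (join (join (join p1 f1) (join p2 f2)) X))
      by (simpl; now rewrite !pl_join, !pr_join, !pl_join).
    apply adjoin_op; auto; [|intros n; now apply cont_XJoin].
    repeat apply ideal_join; auto.
  - intros g1 g2 [p1 [f1 [P1 [F1 [C1 ->]]]]] [p2 [f2 [P2 [F2 [C2 ->]]]]] C.
    replace (apf (apf p1 (join f1 X)) (apf p2 (join f2 X)))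
      with (opf XApp (join (join (join p1 f1) (join p2 f2)) X))
      by (simpl; now rewrite !pl_join, !pr_join, !pl_join).
    apply adjoin_op; auto; [|intros n; now apply cont_XApp].
    repeat apply ideal_join; auto.
Qed.

Lemma adjoin_countable N X : countable N -> countable (adjoin N X).
Proof.
  intros [e He].
  apply (countable_injection (fun p => Pair (fst p) (snd p))
    (fun p => apf (e (fst p)) (join (e (snd p)) X)) X).
  - intros [a b] [c d] H. apply Pair_inj in H as [H1 H2]. simpl in *. congruence.
  - intros g [phi [f [Hp [Hf [_ ->]]]]].
    destruct (He _ Hp) as [i <-], (He _ Hf) as [j <-]. now exists (i, j).
Qed.

Lemma adjoin_gen N X : ideal N -> adjoin N X X.
Proof.
  intros I. set (f := assoc (opf XOne)).
  replace X with (opf XSnd (join f X)) at 2 by (simpl; now rewrite pr_join).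
  apply adjoin_op; auto; [apply (ideal_op _ I)|]. intros n. now apply cont_total_op.
Qed.

Lemma in_list_sum {A} (h : A -> nat) l x : List.In x l -> h x <= list_sum (map h l).
Proof.
  induction l as [|a l IH]; intros H; [destruct H|].
  change (list_sum (map h (a :: l))) with (h a + list_sum (map h l)).
  destruct H as [->|H]; [|specialize (IH H)]; lia.
Qed.

(** [opf XCurry (join phi f)] acts as an associate of the map taking [X] to [apf phi (join f X)]:
    the parameter is absorbed, and the search depends on initial segments of [X] alone. *)
Lemma XCurry_value phi f X n m : opf XCurry (join phi f) (code n (init X m)) <> 0 ->
  opf XCurry (join phi f) (code n (init X m)) = S (apf phi (join f X) n).
Proof.
  simpl. rewrite uncode_code, length_init, pl_join, pr_join.
  set (g := join f (fun i => nth i (init X m) 0)).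
  destruct (classic (exists m', m' <= 2 * m /\ phi (code n (init g m')) <> 0)) as [H|H].
  - rewrite indic_true by exact H. intros _. rewrite Nat.mul_1_l. f_equal.
    destruct H as [m' [Hm H]].
    (* Below position [2 * m] the join reads only the first [m] entries of [X], so the padding with
       0 is never seen. *)
    assert (E : init g m' = init (join f X) m').
    { apply init_agree. intros i Hi. unfold g, join. destruct Nat.even; auto.
      apply nth_error_nth. apply nth_error_init.
      rewrite Nat.div2_div. apply Nat.Div0.div_lt_upper_bound. lia. }
    apply (Val_functional phi n (init g m')); [now apply Val_init|].
    rewrite E. apply Val_init. now rewrite <- E.
  - rewrite indic_false by exact H. intros K. now destruct K.
Qed.

Lemma XCurry_conv phi f X n : conv phi (join f X) n ->
  exists m, opf XCurry (join phi f) (code n (init X m)) <> 0.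
Proof.
  intros [m H]. exists m. simpl. rewrite uncode_code, length_init, pl_join, pr_join.
  rewrite indic_true; [lia|]. exists m. split; [lia|].
  replace (init _ m) with (init (join f X) m); auto.
  symmetry. apply init_agree. intros i Hi. unfold join. destruct Nat.even; auto.
  apply nth_error_nth. apply nth_error_init.
  rewrite Nat.div2_div. apply Nat.Div0.div_lt_upper_bound. lia.
Qed.

Lemma step N f : ideal N -> countable N -> exists N',
  ideal N' /\ countable N' /\ (forall g, N g -> N' g) /\ dominated N' N /\
  (exists z, N' z /\ random N z) /\
  (N f -> binary_infinite f -> exists y, N' y /\ forall m, mem f (init y m)).
Proof.
  intros I C.
  assert (HB : exists B, N B /\ binary_infinite B /\ (N f -> binary_infinite f -> B = f)).
  { destruct (classic (N f /\ binary_infinite f)) as [[H1 H2]|H].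
    - exists f. auto.
    (* The constant 1 codes the full tree, a default when [f] is no infinite binary tree in [N]. *)
    - exists (opf XOne (assoc (opf XOne))). split; [|split].
      + apply ideal_total; auto. apply (ideal_op _ I).
      + split; [intros; discriminate|]. intros n. exists (repeat true n).
        rewrite repeat_length. split; auto. discriminate.
      + tauto. }
  destruct HB as [B [NB [[B1 B2] B3]]].
  destruct (generic_path N B I C NB B1 B2) as [X [X3 [XB XW]]].
  assert (I' := adjoin_ideal N X I).
  assert (HX := adjoin_gen N X I).
  exists (adjoin N X). split; auto. split; [now apply adjoin_countable|].
  split; [intros; now apply adjoin_base|]. split; [|split].
  - intros g [phi [h [Hp [Hh [Hc ->]]]]].
    set (W := opf XCurry (join phi h)).
    assert (HW : N W) by (apply ideal_total; auto; now apply ideal_join).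
    destruct (XW W HW) as [[g0 [Hg0 Hm]]|[n [k [H _]]]].
    (* The entries of [X] are at most 3, so the value at [n] is among the finitely many answers of
       [W] on strings of length at most [g0 n]; [XDom] adds these up. *)
    + exists (opf XDom (join W g0)). split; [apply ideal_total; auto; now apply ideal_join|].
      intros n. destruct (Hm n) as [m [Hmg Hne]].
      assert (E := XCurry_value phi h X n m Hne). fold W in E.
      cbn [opf]. rewrite pl_join, pr_join.
      assert (L1 := in_list_sum (fun s => W (code n s)) (bstr (fun _ => 3) m) (init X m)
        (init_bstr X (fun _ => 3) m X3)).
      assert (L2 := in_list_sum (fun m => list_sum (map (fun s => W (code n s)) (bstr (fun _ => 3) m)))
        (List.seq 0 (S (g0 n))) m ltac:(apply in_seq; lia)).
      cbv beta in *. lia.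
    + destruct (XCurry_conv phi h X n (Hc n)) as [m Hne]. now destruct Hne.
  - exists (opf XOdd X). split; [now apply ideal_total|]. split.
    + intros n. simpl. destruct Nat.odd; simpl; lia.
    + intros D HD Hz.
      assert (Hi : forall m, map (fun x => Nat.b2n (Nat.odd x)) (init X m) = init (opf XOdd X) m).
      { intros m. unfold init. rewrite map_map. reflexivity. }
      (* [W] answers when the odd parts leave [D]. The real [z] never leaves, so the search diverges
         on [X], and hence on a set of positive measure. *)
      set (W := opf XTest D).
      assert (E : forall n s, W (code n s) = indic (~ mem D (map (fun x => Nat.b2n (Nat.odd x)) s))).
      { intros n s. unfold W. simpl. now rewrite uncode_code. }
      destruct (XW W) as [[g [_ Hg]]|[n [k [_ H]]]]; [now apply ideal_total| |].
      * destruct (Hg 0) as [m [_ Hm]]. rewrite E, indic_nonzero in Hm. destruct Hm.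
        rewrite Hi. apply Hz.
      * exists k. intros l. destruct (H l) as [t [Ht Hp]].
        eapply Rle_trans; [exact Hp|]. apply prob_le. intros s Hs K.
        specialize (K l (le_n l)). rewrite E in K.
        rewrite firstn_all2 in K by (rewrite length_mix; lia).
        rewrite (mix_odd l) in K by auto. apply NNPP. intros K'.
        rewrite indic_true in K; [discriminate|auto].
  - intros Nf Bf. specialize (B3 Nf Bf). subst B. exists (opf XHalf X).
    split; [now apply ideal_total|]. intros m.
    replace (init (opf XHalf X) m) with (map Nat.div2 (init X m)); auto.
    unfold init. rewrite map_map. reflexivity.
Qed.

Lemma tower_exists N0 : ideal N0 -> countable N0 -> exists L : nat -> real -> Prop,
  L 0 = N0 /\ (forall i, ideal (L i)) /\ (forall i j f, i <= j -> L i f -> L j f) /\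
  (forall i j, i <= j -> dominated (L j) (L i)) /\
  (forall i, exists z, L (S i) z /\ random (L i) z) /\
  (forall i f, L i f -> binary_infinite f -> exists j y, L j y /\ forall m, mem f (init y m)).
Proof.
  intros I0 C0.
  set (good := fun N f N' => ideal N /\ countable N ->
    ideal N' /\ countable N' /\ (forall g : real, N g -> N' g) /\ dominated N' N /\
    (exists z, N' z /\ random N z) /\
    (N f -> binary_infinite f -> exists y, N' y /\ forall m, mem f (init y m))).
  assert (Hgood : forall N f, exists N', good N f N').
  { intros N f. destruct (classic (ideal N /\ countable N)) as [[H1 H2]|H].
    - destruct (step N f H1 H2) as [N' H]. exists N'. intros _. exact H.
    - exists N. intros K. tauto. }
  set (next := fun N f => epsilon (inhabits N) (good N f)).
  assert (Hnext : forall N f, good N f (next N f)) by (intros; apply epsilon_spec, Hgood).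
  set (en := fun N : real -> Prop => epsilon (inhabits (fun _ _ => 0))
     (fun e : nat -> real => forall x, N x -> exists n, e n = x)).
  assert (Hen : forall N, countable N -> forall x, N x -> exists n, en N n = x).
  { intros N HN. exact (epsilon_spec (inhabits (fun _ _ => 0)) _ HN). }
  (* [H i] tabulates [L 0], ..., [L i]. Stage [i] treats an element of an earlier ideal, given by
     its number in an enumeration, so the recursion has to look back; pairs bound their components,
     hence each element gets its turn after its ideal is built. *)
  set (H := fix H i := match i with
     | 0 => fun _ => N0
     | S i => fun j => if Nat.leb j i then H i j
         else next (H i i) (en (H i (fst (unpair i))) (snd (unpair i)))
     end).
  set (L := fun i => H i i).
  assert (HS : forall i, L (S i) = next (L i) (en (H i (fst (unpair i))) (snd (unpair i)))).
  { intros i. change (L (S i)) with (if Nat.leb (S i) i then H i (S i)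
      else next (L i) (en (H i (fst (unpair i))) (snd (unpair i)))).
    now rewrite (proj2 (Nat.leb_gt (S i) i) (Nat.lt_succ_diag_r i)). }
  assert (HH : forall i j, j <= i -> H i j = L j).
  { induction i as [|i IH]; intros j Hj.
    - replace j with 0 by lia. auto.
    - destruct (Nat.eq_dec j (S i)) as [->|Hne]; auto.
      change (H (S i) j) with (if Nat.leb j i then H i j
        else next (H i i) (en (H i (fst (unpair i))) (snd (unpair i)))).
      rewrite (proj2 (Nat.leb_le j i)) by lia. apply IH. lia. }
  assert (HL : forall i, ideal (L i) /\ countable (L i)).
  { induction i as [|i IH]; [auto|]. rewrite HS.
    destruct (Hnext (L i) (en (H i (fst (unpair i))) (snd (unpair i))) IH) as [K1 [K2 _]]. auto. }
  assert (HG : forall i, good (L i) (en (H i (fst (unpair i))) (snd (unpair i))) (L (S i)))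
    by (intros i; rewrite HS; apply Hnext).
  assert (HN := fun i => HG i (HL i)).
  assert (Hmono : forall i j f, i <= j -> L i f -> L j f).
  { intros i j f Hij Hf. induction Hij as [|j Hij IH]; auto. destruct (HN j) as [_ [_ [K _]]]. auto. }
  exists L. split; auto. split; [apply HL|]. split; auto. split; [|split].
  - intros i j Hij. induction Hij as [|j Hij IH].
    + intros f Hf. exists f. auto.
    + intros f Hf. destruct (HN j) as [_ [_ [_ [D _]]]]. destruct (D f Hf) as [g [Hg Hfg]].
      destruct (IH g Hg) as [h [Hh Hgh]]. exists h. split; auto. intros n.
      specialize (Hfg n). specialize (Hgh n). lia.
  - intros i. destruct (HN i) as [_ [_ [_ [_ [Z _]]]]]. exact Z.
  - intros i f Hf Hb. destruct (Hen (L i) (proj2 (HL i)) f Hf) as [c Hc].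
    set (j := Pair i c). destruct (HN j) as [_ [_ [_ [_ [_ P]]]]].
    assert (Hij : i <= j) by apply Pair_bound.
    exists (S j). unfold j in P. rewrite unpair_Pair in P. simpl fst in P. simpl snd in P.
    fold j in P. rewrite HH in P by auto. rewrite Hc in P.
    apply P; auto. eauto.
Qed.

(** * Perfect subtrees of trees of positive measure *)

Definition reads (gam uh : real) (t : list nat) (r : list bool) : Prop :=
  forall i b, nth_error r i = Some b -> Val gam i (firstn (uh i) t) (Nat.b2n b).

Definition image_above (T gam fh uh : real) (n : nat) (t : list nat) (r : list bool) : Prop :=
  exists t', List.In t' (bstr fh (ell uh n)) /\ mem T t' /\ prefix t t' /\ reads gam uh t' r.

Definition good (T gam fh uh : real) (n : nat) (t : list nat) (k : nat) : Prop :=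
  forall N, n <= N -> (half k <= prob N (image_above T gam fh uh N t))%R.

Lemma half_add a b : half (a + b) = (half a * half b)%R.
Proof. apply pow_add. Qed.

Lemma half_mul_le n : (INR n * half n <= 1)%R.
Proof.
  induction n as [|n IH]; [simpl; lra|]. rewrite half_S, S_INR.
  pose proof (half_le_1 n). pose proof (pos_INR n). pose proof (half_pos n). lra.
Qed.

Lemma ell_lt u i n : i < n -> u i <= ell u n.
Proof.
  induction n as [|n IH]; [lia|]. intros H. simpl.
  assert (i < n \/ i = n) as [L| ->] by lia; [specialize (IH L)|]; lia.
Qed.

Lemma ell_mono u n m : n <= m -> ell u n <= ell u m.
Proof. induction 1; simpl; lia. Qed.

Lemma ell_ge u n : n <= ell u n.
Proof. induction n; simpl; lia. Qed.

Lemma reads_restrict gam uh n t r : length r = n -> reads gam uh t r <->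
  reads gam uh (firstn (ell uh n) t) r.
Proof.
  intros Hr. unfold reads.
  assert (E : forall i b, nth_error r i = Some b ->
    firstn (uh i) (firstn (ell uh n) t) = firstn (uh i) t).
  { intros i b Hi. rewrite firstn_firstn, Nat.min_l; auto. apply ell_lt.
    rewrite <- Hr. apply nth_error_Some. congruence. }
  split; intros H i b Hi; specialize (H i b Hi); rewrite (E i b Hi) in *; auto.
Qed.

Lemma reads_firstn gam uh n t r : reads gam uh t r -> reads gam uh t (firstn n r).
Proof.
  intros H i b Hi. apply H. rewrite nth_error_firstn in Hi.
  destruct Nat.ltb; [auto|discriminate].
Qed.

Lemma reads_functional gam uh t r r' : length r = length r' ->
  reads gam uh t r -> reads gam uh t r' -> r = r'.
Proof.
  intros L H H'. apply list_ext. intros i.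
  destruct (nth_error r i) as [b|] eqn:E.
  - destruct (nth_error r' i) as [b'|] eqn:E'.
    + pose proof (Val_functional _ _ _ _ _ (H i b E) (H' i b' E')). f_equal.
      destruct b, b'; simpl in *; congruence.
    + apply nth_error_None in E'. assert (i < length r) by (apply nth_error_Some; congruence). lia.
  - symmetry. apply nth_error_None. apply nth_error_None in E. lia.
Qed.

Section Splitting.
Context (T gam fh uh : real) (T_closed : forall s m, mem T s -> mem T (firstn m s)).

Lemma image_above_restrict n n' t r : n <= n' -> length t <= ell uh n -> length r = n' ->
  image_above T gam fh uh n' t r -> image_above T gam fh uh n t (firstn n r).
Proof.
  intros Hn Ht Hr [t' [H1 [H2 [H3 H4]]]]. exists (firstn (ell uh n) t').
  split; [apply (firstn_bstr fh (ell uh n')); auto; now apply ell_mono|].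
  split; auto. split; [now apply prefix_firstn_le|].
  apply reads_restrict; [rewrite length_firstn; lia|]. now apply reads_firstn.
Qed.

Lemma image_above_antitone n n' t : n <= n' -> length t <= ell uh n ->
  (prob n' (image_above T gam fh uh n' t) <= prob n (image_above T gam fh uh n t))%R.
Proof.
  intros Hn Ht. rewrite <- (prob_firstn n n' (image_above T gam fh uh n t)) by auto.
  apply prob_le. intros r Hr. now apply image_above_restrict.
Qed.

(** A string of length [ell uh n] already fixes the first [n] output bits, so all outputs above it
    lie in one cylinder. *)
Lemma image_above_small n N t : n <= N -> length t = ell uh n ->
  (prob N (image_above T gam fh uh N t) <= half n)%R.
Proof.
  intros Hn Ht.
  destruct (classic (exists r, length r = N /\ image_above T gam fh uh N t r)) as [[u [Hu Hi]]|H].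
  - assert (K : forall r, length r = N -> image_above T gam fh uh N t r ->
      reads gam uh t (firstn n r)).
    { intros r Hr [t' [_ [_ [H3 H4]]]]. apply prefix_eq in H3. rewrite H3, Ht.
      apply reads_restrict; [rewrite length_firstn; lia|]. now apply reads_firstn. }
    apply Rle_trans with (prob N (fun r => firstn n r = firstn n u)).
    + apply prob_le. intros r Hr Hir. apply (reads_functional gam uh t); auto.
      rewrite !length_firstn. lia.
    + rewrite (prob_firstn n N (fun r => r = firstn n u)) by auto. apply prob_eq.
      rewrite length_firstn. lia.
  - rewrite prob_empty; [apply Rlt_le, half_pos|]. intros r Hr Hir. eauto.
Qed.

(** If all of the measure below [t] sat on one node of the next level, up to
    nodes of small measure, it would be at most [2^-(k+2) + 2^-(k+2)]. *)
Lemma good_splits n k t : length t = ell uh n -> good T gam fh uh n t k ->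
  let n' := n + k + 2 in let l := bstr fh (ell uh n') in let k' := k + 2 + length l in
  exists t1 t2, t1 <> t2 /\
    (List.In t1 l /\ mem T t1 /\ prefix t t1 /\ good T gam fh uh n' t1 k') /\
    (List.In t2 l /\ mem T t2 /\ prefix t t2 /\ good T gam fh uh n' t2 k').
Proof.
  intros Ht Hg n' l k'. apply NNPP. intros HN.
  set (G := fun x => mem T x /\ prefix t x /\ good T gam fh uh n' x k').
  assert (HG : exists t0, forall x, List.In x l -> G x -> x = t0).
  { destruct (classic (exists x, List.In x l /\ G x)) as [[x [Hx Gx]]|H].
    - exists x. intros y Hy Gy. apply NNPP. intros Hne. apply HN. exists y, x.
      unfold G in *. tauto.
    - exists []. intros x Hx Gx. destruct H. eauto. }
  destruct HG as [t0 Ht0].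
  (* A node that is not good has small measure from some level on, because the measures decrease.
     One level [N] works for all of the finitely many nodes. *)
  destruct (finite_eventually (fun x m => ~ G x -> n' <= m -> mem T x -> prefix t x ->
      (prob m (image_above T gam fh uh m x) <= half k')%R) l) as [N0 HN0].
  { intros x Hx. destruct (classic (G x)) as [Gx|Gx]; [exists 0; tauto|].
    destruct (classic (mem T x /\ prefix t x)) as [[H1 H2]|H]; [|exists 0; tauto].
    assert (Hb : ~ good T gam fh uh n' x k') by (unfold G in Gx; tauto).
    apply not_all_ex_not in Hb as [N1 Hb]. exists N1. intros m Hm _ Hnm _ _.
    assert (Hb' : n' <= N1 /\ ~ (half k' <= prob N1 (image_above T gam fh uh N1 x))%R) by tauto.
    destruct Hb' as [L1 L2]. apply Rnot_le_lt in L2.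
    apply Rle_trans with (prob N1 (image_above T gam fh uh N1 x)); [|lra].
    apply image_above_antitone; auto. apply in_bstr in Hx as [-> _]. now apply ell_mono. }
  set (N := N0 + n').
  assert (Hn' : n <= n') by (unfold n'; lia).
  assert (B0 := Hg N ltac:(unfold N; lia)).
  assert (B1 : (prob N (image_above T gam fh uh N t) <=
    prob N (fun r => List.In t0 l /\ image_above T gam fh uh N t0 r) +
    prob N (fun r => exists x, List.In x l /\
       ((~ G x /\ mem T x /\ prefix t x) /\ image_above T gam fh uh N x r)))%R).
  { apply prob_or. intros r Hr [t' [H1 [H2 [H3 H4]]]].
    set (x := firstn (ell uh n') t').
    assert (Hx : List.In x l).
    { apply (firstn_bstr fh (ell uh N)); auto. apply ell_mono. unfold N. lia. }
    assert (Hpx : prefix t x).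
    { apply prefix_firstn_le; auto. rewrite Ht. now apply ell_mono. }
    assert (Hix : image_above T gam fh uh N x r).
    { exists t'. split; auto. split; auto. split; auto. apply prefix_firstn. }
    destruct (classic (G x)) as [Gx|Gx].
    - left. rewrite <- (Ht0 x Hx Gx). auto.
    - right. exists x. split; auto. split; auto. split; auto. split; [now apply T_closed|auto]. }
  assert (B2 : (prob N (fun r => List.In t0 l /\ image_above T gam fh uh N t0 r) <= half n')%R).
  { destruct (classic (List.In t0 l)) as [Hin|Hin].
    - apply Rle_trans with (prob N (image_above T gam fh uh N t0)).
      + apply prob_le. tauto.
      + apply image_above_small; [unfold N; lia|]. now apply in_bstr in Hin as [Hin _].
    - rewrite prob_empty; [apply Rlt_le, half_pos|]. tauto. }
  assert (B3 := prob_list N _ (fun x r => (~ G x /\ mem T x /\ prefix t x) /\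
       image_above T gam fh uh N x r) l (half k') (fun r _ K => K)).
  assert (B4 : forall x, List.In x l -> (prob N (fun r => (~ G x /\ mem T x /\ prefix t x) /\
       image_above T gam fh uh N x r) <= half k')%R).
  { intros x Hx. destruct (classic (~ G x /\ mem T x /\ prefix t x)) as [[H1 [H2 H3]]|H].
    - apply Rle_trans with (prob N (image_above T gam fh uh N x)); [apply prob_le; tauto|].
      apply (HN0 N); auto; unfold N; lia.
    - rewrite prob_empty; [apply Rlt_le, half_pos|]. tauto. }
  specialize (B3 B4).
  (* The summand [length l] in [k'] pays for the number of nodes, since [c * 2^-c <= 1]. *)
  assert (B5 : (INR (length l) * half k' <= half (k + 2))%R).
  { unfold k'. rewrite (half_add (k + 2)). pose proof (half_mul_le (length l)).
    pose proof (half_pos (k + 2)).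
    replace (INR (length l) * (half (k + 2) * half (length l)))%R with
      (half (k + 2) * (INR (length l) * half (length l)))%R by ring.
    rewrite <- (Rmult_1_r (half (k + 2))) at 2. apply Rmult_le_compat_l; lra. }
  assert (B6 := half_antitone (k + 2) n' ltac:(unfold n'; lia)).
  replace (k + 2) with (S (S k)) in B5, B6 by lia. rewrite !half_S in B5, B6.
  pose proof (half_pos k). lra.
Qed.

(** All good extensions are kept rather than two chosen ones; the exponents in [lev] guarantee at
    least two above each node. *)
Fixpoint level_node (k j : nat) (t : list nat) : Prop :=
  match j with
  | 0 => t = []
  | S j => List.In t (bstr fh (ell uh (fst (lev fh uh k (S j))))) /\ mem T t /\
      good T gam fh uh (fst (lev fh uh k (S j))) t (snd (lev fh uh k (S j))) /\
      exists t0, level_node k j t0 /\ prefix t0 t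
  end.

Lemma level_node_props k : mem T [] -> good T gam fh uh 0 [] k -> forall j t,
  level_node k j t -> length t = ell uh (fst (lev fh uh k j)) /\ mem T t /\
    good T gam fh uh (fst (lev fh uh k j)) t (snd (lev fh uh k j)).
Proof.
  intros H0 Hg [|j] t; simpl level_node.
  - intros ->. auto.
  - intros [H1 [H2 [H3 _]]]. apply in_bstr in H1 as [H1 _]. auto.
Qed.

Lemma level_node_splits k j t : mem T [] -> good T gam fh uh 0 [] k -> level_node k j t ->
  exists t1 t2, t1 <> t2 /\ prefix t t1 /\ prefix t t2 /\
    level_node k (S j) t1 /\ level_node k (S j) t2.
Proof.
  intros H0 Hg Hl. destruct (level_node_props k H0 Hg j t Hl) as [H1 [H2 H3]].
  cbn [level_node lev]. destruct (lev fh uh k j) as [n k']. simpl in H1, H3. simpl.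
  destruct (good_splits n k' t H1 H3) as [t1 [t2 [Hne [[A1 [A2 [A3 A4]]] [B1 [B2 [B3 B4]]]]]]].
  exists t1, t2. split; auto. split; auto. split; auto.
  split; split; auto; split; auto; split; auto; exists t; auto.
Qed.

Lemma lev_ge k j : j <= fst (lev fh uh k j).
Proof.
  induction j as [|j IH]; simpl; [lia|]. destruct (lev fh uh k j). simpl in *. lia.
Qed.

(** [P] is just a predicate, since [good] speaks of all levels. What is gained for the ideal is the
    splitting length, a function of [length t] computed from [fh] and [uh]. *)
Lemma perfect_subtree_exists k : mem T [] ->
  (forall n, (half k <= prob n (fun r => image T gam fh uh (map Nat.b2n r)))%R) ->
  exists P : list nat -> Prop, P [] /\ (forall s m, P s -> P (firstn m s)) /\
    (forall s, P s -> mem T s) /\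
    forall t, P t -> exists t1 t2, t1 <> t2 /\ prefix t t1 /\ prefix t t2 /\ P t1 /\ P t2 /\
      List.In t1 (bstr fh (opf (XLev k) (join fh uh) (length t))) /\
      List.In t2 (bstr fh (opf (XLev k) (join fh uh) (length t))).
Proof.
  intros H0 Hk.
  assert (Hg : good T gam fh uh 0 [] k).
  { intros N _. eapply Rle_trans; [apply (Hk N)|]. apply prob_le. intros r Hr.
    intros [t' [H1 [H2 H3]]]. rewrite length_map, Hr in H1. exists t'.
    split; auto. split; auto. split; [now exists t'|]. intros i b Hi.
    assert (Hi' : i < length r) by (apply nth_error_Some; congruence).
    specialize (H3 i). rewrite length_map, nth_error_map, Hi in H3. apply H3. lia. }
  assert (Hup : forall j i t, j <= i -> level_node k j t -> exists t', prefix t t' /\ level_node k i t').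
  { intros j i t H Ht. induction H as [|i H [t' [H1 H2]]].
    - exists t. split; auto. apply prefix_refl.
    - destruct (level_node_splits k i t' H0 Hg H2) as [t1 [_ [_ [H3 [_ [H4 _]]]]]].
      exists t1. split; auto. eapply prefix_trans; eauto. }
  assert (Hdown : forall i j t, level_node k i t -> j <= i -> exists t', prefix t' t /\ level_node k j t').
  { induction i as [|i IH]; intros j t Ht Hj.
    - replace j with 0 by lia. exists t. split; auto. apply prefix_refl.
    - destruct (Nat.eq_dec j (S i)) as [->|Hne]; [exists t; split; auto; apply prefix_refl|].
      destruct Ht as [_ [_ [_ [t0 [Ht0 Hp]]]]].
      destruct (IH j t0 Ht0) as [t' [H1 H2]]; [lia|]. exists t'. split; auto.
      eapply prefix_trans; eauto. }
  exists (fun t => exists j t', level_node k j t' /\ prefix t t').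
  split; [|split; [|split]].
  - exists 0, []. split; [reflexivity|apply prefix_refl].
  - intros s m [j [t' [H1 H2]]]. exists j, t'. split; auto.
    eapply prefix_trans; [apply prefix_firstn|auto].
  - intros s [j [t' [H1 H2]]]. destruct (level_node_props k H0 Hg j t' H1) as [_ [H3 _]].
    apply prefix_eq in H2. rewrite H2. auto.
  - intros t [j [t' [H1 H2]]].
    (* Nodes of level [j] have length at least [j]. Hence [t] lies below a node of level [length t],
       whose two successors give the required splitting, whichever level put [t] into [P]. *)
    assert (Hlt : exists t0, level_node k (length t) t0 /\ prefix t t0).
    { destruct (Nat.le_ge_cases j (length t)) as [L|L].
      - destruct (Hup j (length t) t' L H1) as [t0 [H3 H4]]. exists t0. split; auto.
        eapply prefix_trans; eauto.
      - destruct (Hdown j (length t) t' H1 L) as [t0 [H3 H4]]. exists t0. split; auto.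
        apply (prefix_comparable t t0 t'); auto.
        destruct (level_node_props k H0 Hg _ _ H4) as [-> _].
        eapply Nat.le_trans; [apply (lev_ge k)|apply ell_ge]. }
    destruct Hlt as [t0 [H3 H4]].
    destruct (level_node_splits k _ _ H0 Hg H3) as [t1 [t2 [Hne [P1 [P2 [L1 L2]]]]]].
    exists t1, t2. split; auto.
    split; [eapply prefix_trans; eauto|]. split; [eapply prefix_trans; eauto|].
    split; [exists (S (length t)), t1; split; auto; apply prefix_refl|].
    split; [exists (S (length t)), t2; split; auto; apply prefix_refl|].
    cbn [opf]. rewrite pl_join, pr_join. destruct L1 as [L1 _], L2 as [L2 _]. auto.
Qed.
End Splitting.

(** * The model *)

Lemma delta00_sort M M' p : delta00 p -> forall e r, sat M e r p <-> sat M' e r p.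
Proof.
  induction 1; intros e r; simpl; try tauto.
  - rewrite IHdelta00_1, IHdelta00_2. tauto.
  - rewrite IHdelta00_1, IHdelta00_2. tauto.
  - rewrite IHdelta00_1, IHdelta00_2. tauto.
  - setoid_rewrite IHdelta00. tauto.
  - setoid_rewrite IHdelta00. tauto.
Qed.

Definition coded (M : real -> Prop) (X : nat -> Prop) : Prop :=
  exists f, M f /\ forall n, X n <-> f n <> 0.

Lemma coded_cols M K : ideal M -> forall r : nat -> nat -> Prop, (forall X, coded M (r X)) ->
  exists f, M f /\ forall X j, X < K -> (cols f X j <-> r X j).
Proof.
  intros I. induction K as [|K IH]; intros r Hr.
  - exists (assoc (opf XOne)). split; [apply (ideal_op _ I)|lia].
  - destruct (Hr 0) as [f0 [H1 H2]].
    destruct (IH (fun X => r (S X))) as [f [H3 H4]]; [auto|].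
    exists (join f0 f). split; [now apply ideal_join|].
    intros [|X] j HX; unfold cols, col.
    + simpl. rewrite pl_join. symmetry. apply H2.
    + rewrite Nat.iter_succ_r, pr_join. apply H4. lia.
Qed.

(** Search at once for a witness of [p] and a counterexample to [q]; their equivalence makes the
    search end and its result correct. The parameters are cut down to a list of numbers and one
    real, as [delta00_use] permits. *)
Lemma RCA0_comp_sound M p q : ideal M -> sigma01 p -> pi01 q ->
  forall e r, (forall X, coded M (r X)) ->
  sat (coded M) e r (Imp (AllN (Iff p q)) (comprehension p)).
Proof.
  intros I [p0 Hp] [q0 Hq] e r Hr. unfold comprehension. simpl. intros Hiff.
  destruct (delta00_use (fun _ => True) p0 Hp) as [K1 HK1].
  destruct (delta00_use (fun _ => True) q0 Hq) as [K2 HK2].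
  destruct (coded_cols M (K1 + K2) I r Hr) as [f [Hf Hcols]].
  set (l := init e (K1 + K2)).
  assert (Henv : forall k n i, i < K1 + K2 -> listenv (k :: n :: l) i = scons k (scons n e) i).
  { intros k n [|[|i]] Hi; auto. unfold listenv, l. simpl.
    apply nth_error_nth, nth_error_init. lia. }
  assert (E1 : forall k n, holds f (k :: n :: l) p0 <-> sat (coded M) (scons k (scons n e)) r p0).
  { intros k n. rewrite (delta00_sort (coded M) (fun _ => True) p0 Hp).
    destruct (HK1 (listenv (k :: n :: l)) (cols f)) as [m Hm]. apply Hm.
    - intros i Hi. apply Henv. lia.
    - intros X j HX _. apply Hcols. lia. }
  assert (E2 : forall k n, holds f (k :: n :: l) q0 <-> sat (coded M) (scons k (scons n e)) r q0).
  { intros k n. rewrite (delta00_sort (coded M) (fun _ => True) q0 Hq).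
    destruct (HK2 (listenv (k :: n :: l)) (cols f)) as [m Hm]. apply Hm.
    - intros i Hi. apply Henv. lia.
    - intros X j HX _. apply Hcols. lia. }
  assert (Hex : forall n, exists k, holds f (k :: n :: l) p0 \/ ~ holds f (k :: n :: l) q0).
  { intros n. apply NNPP. intros H. destruct (Hiff n) as [_ Hqp].
    destruct Hqp as [k Hk].
    - intros k. apply E2, NNPP. intros H'. apply H. eauto.
    - apply H. exists k. left. now apply E1. }
  set (h := opf (XComp p0 q0 l) f).
  exists (fun n => h n <> 0). split.
  - exists h. split; [|tauto]. apply ideal_closed; auto. intros n. now apply cont_XComp.
  - intros n. change (exists n0, sat (coded M) (scons n0 (scons n e)) (scons (fun n => h n <> 0) r)
      (subst (up_num Var) S p0)) with
      (sat (coded M) (scons n e) (scons (fun n => h n <> 0) r) (lift_set (ExN p0))).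
    rewrite sat_lift_set. simpl. unfold h, opf. rewrite indic_nonzero.
    destruct (least_spec _ (Hex n)) as [H1 _]. set (k := least _) in *.
    split.
    + intros H. exists k. now apply E1.
    + intros H. destruct H1 as [H1|H1]; auto. destruct H1. apply E2.
      now apply (Hiff n).
Qed.

Lemma coded_graph M f : ideal M -> M f -> coded M (graph f).
Proof.
  intros I Hf. exists (opf XGraph f). split; [now apply ideal_total|]. intros c. simpl.
  rewrite indic_nonzero. split.
  - intros [i [j [-> H]]]. now rewrite unpair_Pair.
  - intros [H1 H2]. now exists (fst (unpair c)), (snd (unpair c)).
Qed.

Lemma coded_func M F : ideal M -> coded M F -> Func F -> exists f, M f /\ F = graph f.
Proof.
  intros I [h [Hh HF]] [F1 [F2 F3]].
  assert (Hex : forall i, exists j, h (Pair i j) <> 0).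
  { intros i. destruct (F3 i) as [j Hj]. exists j. now apply HF. }
  exists (opf XFun h). split.
  - apply ideal_closed; auto. intros n. now apply cont_XFun.
  - assert (Hl : forall i, F (Pair i (opf XFun h i))).
    { intros i. apply HF. apply (least_spec _ (Hex i)). }
    extensionality c. apply propositional_extensionality. split.
    + intros H. destruct (F1 c H) as [i [j ->]]. exists i, j. split; auto. eapply F2; eauto.
    + intros [i [j [-> <-]]]. apply Hl.
Qed.

Lemma Seq_graph f s : Seq s -> (forall i j, Entry s i j -> graph f (Pair i j)) ->
  exists m, s = enc (init f m).
Proof.
  intros Hs H. destruct (Seq_enc s Hs) as [t ->]. exists (length t). f_equal.
  apply list_ext. intros i. destruct (nth_error t i) as [v|] eqn:E.
  - apply enc_Entry in E as E'. destruct (H i v E') as [i' [j' [Ep Ev]]].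
    apply Pair_inj in Ep as [<- <-]. rewrite nth_error_init; [congruence|].
    apply nth_error_Some. congruence.
  - symmetry. apply nth_error_None. rewrite length_init. now apply nth_error_None.
Qed.

Lemma Func_graph f : Func (graph f).
Proof.
  split; [|split].
  - intros n [i [j [-> _]]]. eauto.
  - intros i j k [[i1 [j1 [E1 H1]]] [i2 [j2 [E2 H2]]]].
    apply Pair_inj in E1 as [-> ->]. apply Pair_inj in E2 as [-> ->]. congruence.
  - intros i. exists (f i), i, (f i). auto.
Qed.

Lemma WKL_coded M : ideal M ->
  (forall f, M f -> binary_infinite f -> exists y, M y /\ forall m, mem f (init y m)) ->
  forall T, coded M T -> Binary_tree T /\ Infinite T -> exists F, coded M F /\ Path F T.
Proof.
  intros I HM T [f [Hf HT]] [[[T1 T2] T3] Hinf].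
  assert (Hmem : forall s, mem f s <-> T (enc s)) by (intros s; symmetry; apply HT).
  assert (Hcl : forall s m, mem f s -> mem f (firstn m s)).
  { intros s m. rewrite !Hmem. intros H. apply (T2 (enc s)). split; auto.
    split; [apply enc_Seq|]. apply Initial_enc, prefix_firstn. }
  assert (Hbin : forall s, mem f s -> exists t, length t = length s /\ s = map Nat.b2n t).
  { intros s Hs. exists (map (fun v => Nat.eqb v 1) s). split; [apply length_map|].
    rewrite map_map. rewrite <- (map_id s) at 1. apply map_ext_in. intros v Hv.
    apply In_nth_error in Hv as [i Hi]. apply enc_Entry in Hi.
    destruct (T3 (enc s) i v) as [-> | ->]; auto. split; auto. now apply Hmem. }
  destruct (HM f Hf) as [y [Hy Hp]].
  - split; auto. intros n. apply NNPP. intros Hno.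
    (* Only finitely many binary strings are shorter than [n]; a member of [T] whose code exceeds
       all of theirs has length at least [n] and can be truncated. *)
    set (l := flat_map bools (List.seq 0 n)).
    destruct (Hinf (list_sum (map (fun t => enc (map Nat.b2n t)) l))) as [c [Hc HcT]].
    destruct (Seq_enc c (T1 c HcT)) as [s ->].
    apply Hmem in HcT. destruct (Nat.le_gt_cases n (length s)) as [L|L].
    + destruct (Hbin (firstn n s)) as [t [Ht1 Ht2]]; [auto|]. apply Hno. exists t.
      rewrite <- Ht2. rewrite Ht1, length_firstn. split; [lia|auto].
    + destruct (Hbin s HcT) as [t [Ht1 ->]].
      assert (Hin : List.In t l).
      { apply in_flat_map. exists (length t). split; [|now apply in_bools].
        rewrite Ht1. apply in_seq. lia. }
      pose proof (in_list_sum (fun t => enc (map Nat.b2n t)) l t Hin) as H. simpl in H. lia.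
  - exists (graph y). split; [now apply coded_graph|]. split; [apply Func_graph|].
    intros s [Hs He]. destruct (Seq_graph y s Hs He) as [m ->]. now apply Hmem.
Qed.

(** * Perfect subtrees with prescribed splitting levels as a Pi01 class *)

Lemma perfect_attempt_firstn T fh lam l m :
  perfect_attempt T fh lam l -> perfect_attempt T fh lam (firstn m l).
Proof.
  intros H i Hi. rewrite nth_error_firstn.
  destruct (Nat.ltb_spec i m) as [Hm|Hm]; auto.
  assert (Hu : forall t, undecided l t -> undecided (firstn m l) t).
  { intros t. unfold undecided. rewrite length_firstn, nth_error_firstn.
    destruct (Nat.ltb_spec (enc t) m); [|lia]. intros [K|K]; auto. lia. }
  rewrite length_firstn in Hi. specialize (H i ltac:(lia)).
  destruct (nth_error l i) as [v|]; auto. destruct H as [H1 [H2 H3]].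
  split; auto. split; auto. intros Hv. destruct (H3 Hv) as [K1 [K2 [K3 K4]]].
  split; auto. split; auto. split; auto.
  destruct K4 as [t1 [I1 [t2 [I2 [J1 [J2 [J3 [J4 J5]]]]]]]].
  exists t1. split; auto. exists t2. split; auto 7.
Qed.

Lemma perfect_attempt_of_tree T fh lam (P : list nat -> Prop) n : P [] ->
  (forall s m, P s -> P (firstn m s)) -> (forall s, P s -> mem T s) ->
  (forall t, P t -> exists t1 t2, t1 <> t2 /\ prefix t t1 /\ prefix t t2 /\ P t1 /\ P t2 /\
      List.In t1 (bstr fh (lam (length t))) /\ List.In t2 (bstr fh (lam (length t)))) ->
  perfect_attempt T fh lam (init (fun i => indic (i = enc (dec i) /\ P (dec i))) n).
Proof.
  intros H0 Hcl HT Hs. set (w := fun i => indic (i = enc (dec i) /\ P (dec i))).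
  assert (Hu : forall t, P t -> undecided (init w n) t).
  { intros t Ht. unfold undecided. rewrite length_init.
    destruct (Nat.le_gt_cases n (enc t)) as [L|L]; auto. right.
    rewrite nth_error_init by auto. f_equal. apply indic_true. now rewrite dec_enc. }
  intros i Hi. destruct (nth_error (init w n) i) as [v|] eqn:E; auto.
  assert (L : i < n) by (rewrite <- (length_init w n); apply nth_error_Some; congruence).
  rewrite nth_error_init in E by auto. injection E as <-. split; [|split].
  - unfold w, indic. destruct excluded_middle_informative; lia.
  - intros ->. apply indic_true. now rewrite dec_enc.
  - intros Hw. assert (K : i = enc (dec i) /\ P (dec i)) by (apply indic_nonzero; unfold w in Hw; lia).
    destruct K as [K1 K2]. split; auto. split; auto. split; auto.
    destruct (Hs _ K2) as [t1 [t2 [A1 [A2 [A3 [A4 [A5 [A6 A7]]]]]]]].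
    exists t1. split; auto. exists t2. split; auto 7.
Qed.

Lemma perfect_of_path T fh lam (h : real) :
  (forall m, perfect_attempt T fh lam (init h m)) ->
  Perfect_tree (fun c => h c <> 0) /\ forall c, h c <> 0 -> T c <> 0.
Proof.
  intros H.
  assert (Hn : forall m c, c < m -> h c <= 1 /\ (c = enc [] -> h c = 1) /\
        (h c = 1 -> c = enc (dec c) /\
          (forall k, k <= length (dec c) -> undecided (init h m) (firstn k (dec c))) /\
          mem T (dec c) /\ splits fh lam (init h m) (dec c))).
  { intros m c Hc. specialize (H m c). rewrite length_init, nth_error_init in H by auto.
    apply H. lia. }
  assert (H1 : forall c, h c <> 0 -> h c = 1).
  { intros c Hc. destruct (Hn (S c) c) as [K _]; lia. }
  assert (Hd : forall m t, enc t < m -> undecided (init h m) t -> h (enc t) <> 0).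
  { intros m t Hm [K|K]; [rewrite length_init in K; lia|].
    rewrite nth_error_init in K by auto. injection K as ->. lia. }
  assert (Hs : forall c, h c <> 0 -> c = enc (dec c) /\ mem T (dec c)).
  { intros c Hc. destruct (Hn (S c) c) as [_ [_ K]]; [lia|]. destruct (K (H1 c Hc)); tauto. }
  split; [split; [|split]|].
  - split.
    + intros c Hc. destruct (Hs c Hc) as [-> _]. apply enc_Seq.
    + intros s t [Hc [Ht Hi]]. destruct (Hs s Hc) as [Es _].
      destruct (Seq_enc t Ht) as [u ->]. rewrite Es in Hi. apply Initial_enc in Hi.
      pose proof (prefix_length _ _ Hi) as Hlen. apply prefix_eq in Hi.
      destruct (Hn (S (s + enc u)) s) as [_ [_ K]]; [lia|].
      destruct (K (H1 s Hc)) as [_ [K2 _]]. apply (Hd (S (s + enc u))); [lia|].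
      specialize (K2 _ Hlen). now rewrite <- Hi in K2.
  - exists (enc []). destruct (Hn (S (enc [])) (enc [])) as [_ [K _]]; [lia|].
    rewrite K; auto.
  - intros c Hc. set (l := bstr fh (lam (length (dec c)))).
    (* [m] exceeds the codes of all candidates for the splitting, so those undecided at [init h m]
       do belong to the tree. Being distinct and of equal length, they are incompatible. *)
    set (m := S (c + list_sum (map enc l))).
    destruct (Hn m c) as [_ [_ K]]; [unfold m; lia|].
    destruct (K (H1 c Hc)) as [Ec [_ [_ [t1 [I1 [t2 [I2 [A1 [A2 [A3 [A4 A5]]]]]]]]]]].
    fold l in I1, I2. assert (L1 := in_list_sum enc l t1 I1). assert (L2 := in_list_sum enc l t2 I2).
    exists (enc t1), (enc t2).
    split; [apply (Hd m); auto; unfold m; lia|].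
    split; [apply (Hd m); auto; unfold m; lia|].
    rewrite Ec. unfold Incompatible. rewrite !Initial_enc. split; auto. split; auto.
    apply in_bstr in I1 as [I1 _]. apply in_bstr in I2 as [I2 _].
    split; intros Hp; apply A1; [|symmetry]; apply prefix_same_length; auto; congruence.
  - intros c Hc. destruct (Hs c Hc) as [Ec Hm]. rewrite Ec. exact Hm.
Qed.

Lemma perfect_subtree_in_model M N T f z e :
  ideal M -> ideal N -> (forall g, N g -> M g) -> dominated M N ->
  (forall f, M f -> binary_infinite f -> exists y, M y /\ forall m, mem f (init y m)) ->
  N T -> (forall s m, mem T s -> mem T (firstn m s)) ->
  M f -> (forall m, mem T (init f m)) -> random N z ->
  (forall n, Computes (graph f) e n (z n)) ->
  exists h, M h /\ Perfect_tree (fun c => h c <> 0) /\ forall c, h c <> 0 -> T c <> 0.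
Proof.
  intros IM IN HNM Hdom HW NT HT Mf Hf [Hz1 Hz2] Hcomp.
  set (gam := assoc (opf (XCompute e))).
  assert (Ngam : N gam) by apply (ideal_op _ IN).
  assert (Hcontin : forall n, cont (fun f => opf (XCompute e) f n) f)
    by (intros n; eapply cont_XCompute; eauto).
  assert (Hconv : forall n, conv gam f n) by (intros n; now apply assoc_conv).
  assert (Hval : forall n, apf gam f n = z n).
  { intros n. unfold gam. rewrite apf_assoc by auto. now apply XCompute_value. }
  destruct (Hdom (opf XUse (join gam f))) as [uh [Nuh Huh]].
  { apply ideal_closed; auto; [apply ideal_join; auto|]. intros n. now apply cont_XUse. }
  destruct (Hdom f Mf) as [fh [Nfh Hfh]].
  assert (Hread : forall n, Val gam n (init f (uh n)) (z n)).
  { intros n. rewrite <- Hval. destruct (least_spec _ (Hconv n)) as [K _].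
    specialize (Huh n). cbn [opf] in Huh. rewrite pl_join, pr_join in Huh.
    apply Val_init in K. eapply Val_prefix; [|exact K].
    rewrite <- (firstn_init _ (uh n)) by exact Huh. apply prefix_firstn. }
  set (D := opf XImage (join (join T gam) (join fh uh))).
  assert (ND : N D) by (apply ideal_total; auto; repeat apply ideal_join; auto).
  assert (HD : forall r, mem D r <-> image T gam fh uh r).
  { intros r. unfold D. cbn [opf]. rewrite !pl_join, !pr_join, pl_join.
    apply (mem_indic (image T gam fh uh)). }
  destruct (Hz2 D ND) as [k Hk].
  { intros n. apply HD. exists (init f (ell uh n)). rewrite length_init.
    split; [now apply init_bstr|]. split; auto. intros i Hi.
    destruct (nth_error (init z n) i) as [v|] eqn:E; auto.
    assert (L : i < n) by (rewrite <- (length_init z n); apply nth_error_Some; congruence).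
    rewrite nth_error_init in E by auto. injection E as <-.
    rewrite firstn_init; auto. now apply ell_lt. }
  destruct (perfect_subtree_exists T gam fh uh HT k (Hf 0)) as [P [P1 [P2 [P3 P4]]]].
  { intros n. eapply Rle_trans; [apply (Hk n)|]. apply prob_le. intros s _. apply HD. }
  set (lam := opf (XLev k) (join fh uh)) in *.
  assert (Nlam : N lam) by (apply ideal_total; auto; now apply ideal_join).
  set (B := opf XPerf (join (join T fh) lam)).
  assert (MB : M B) by (apply HNM, ideal_total; auto; repeat apply ideal_join; auto).
  assert (HB : forall l, mem B l <-> perfect_attempt T fh lam l).
  { intros l. unfold B. cbn [opf]. rewrite !pl_join, !pr_join.
    apply (mem_indic (perfect_attempt T fh lam)). }
  destruct (HW B MB) as [h [Mh Hh]].
  - split.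
    + intros s m. rewrite !HB. apply perfect_attempt_firstn.
    (* The characteristic function of [P] shows that the class is nonempty, whether or not [P]
       belongs to the model. *)
    + intros n. set (w := fun i => indic (i = enc (dec i) /\ P (dec i))).
      exists (map (fun i => Nat.eqb (w i) 1) (List.seq 0 n)).
      rewrite length_map, length_seq. split; auto. rewrite map_map.
      replace (map _ _) with (init w n); [apply HB; now apply perfect_attempt_of_tree|].
      unfold init. apply map_ext. intros i. unfold w, indic.
      destruct excluded_middle_informative; auto.
  - exists h. split; auto. apply (perfect_of_path T fh lam). intros m. apply HB. auto.
Qed.

(** For the set variable [X0] coding the graph of a binary array [A(n, k)], the
    pairs [(n, m)] such that the column [A(n, -)] is constant beyond [m]. *)
Definition settled_form : form :=
  hExN (fun n => hExN (fun m => hAnd (hEq (fun d => Var (d - 1)) (pair n m))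
    (hAllN (fun k => hAllN (fun k' => hAllN (fun y =>
       hImp (hLt m k) (hImp (hLt m k')
         (hIff (hIn (pair (pair n k) y) (fun e => e))
               (hIn (pair (pair n k') y) (fun e => e)))))))))) 1 0.

(** The free number variable counts as one enclosing quantifier, which is why [settled_form] starts
    at depth 1 and writes it as [Var (d - 1)]; the free set variable has index 0 at set depth 0. *)
Lemma sat_settled_form M e r : sat M e r settled_form <->
  exists n m, e 0 = Pair n m /\ forall k k' y, m < k -> m < k' ->
    (r 0 (Pair (Pair n k) y) <-> r 0 (Pair (Pair n k') y)).
Proof. reflexivity. Qed.

Lemma graph_Pair f i j : graph f (Pair i j) <-> f i = j.
Proof.
  split; [|intros H; exists i, j; auto].
  intros [i' [j' [E H]]]. apply Pair_inj in E as [-> ->]. auto.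
Qed.

Lemma comprehension_fails M N A c : ideal M -> ideal N -> dominated M N -> M A -> N A ->
  (forall n, exists m, forall k, m <= k -> A (Pair n k) = c n) -> ~ N c ->
  ~ sat (coded M) (fun _ => 0) (fun _ => graph A) (comprehension settled_form).
Proof.
  intros IM IN Hdom MA NA Hlim Nc [D [[d [Md Hd]] HD]].
  apply Nc.
  assert (HD' : forall n m, d (Pair n m) <> 0 <-> forall k k', m < k -> m < k' ->
    A (Pair n k) = A (Pair n k')).
  { intros n m. rewrite <- Hd. specialize (HD (Pair n m)). simpl in HD.
    change (D (Pair n m) <-> sat (coded M) (scons (Pair n m) (fun _ => 0))
      (scons D (fun _ => graph A)) (lift_set settled_form)) in HD.
    rewrite sat_lift_set, sat_settled_form in HD. rewrite HD. simpl. split.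
    - intros [n' [m' [E H]]] k k' Hk Hk'. apply Pair_inj in E as [<- <-].
      specialize (H k k' (A (Pair n k)) Hk Hk'). rewrite !graph_Pair in H. symmetry. now apply H.
    - intros H. exists n, m. split; auto. intros k k' y Hk Hk'. rewrite !graph_Pair.
      rewrite (H k k'); tauto. }
  assert (Hex : forall n, exists m, d (Pair n m) <> 0).
  { intros n. destruct (Hlim n) as [m Hm]. exists m. apply HD'. intros k k' Hk Hk'.
    rewrite !Hm; auto; lia. }
  destruct (Hdom (opf XFun d)) as [g [Ng Hg]].
  { apply ideal_closed; auto. intros n. now apply cont_XFun. }
  replace c with (opf XLim (join A g)); [apply ideal_total; auto; now apply ideal_join|].
  extensionality n. cbn [opf]. rewrite pl_join, pr_join.
  destruct (least_spec _ (Hex n)) as [K _]. specialize (Hg n). cbn [opf] in Hg.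
  (* The positions [m + S (g n)] and [S (g n)] both lie beyond the least settled position, and the
     first also beyond [m], so the entry read by [XLim] is the limit. *)
  destruct (Hlim n) as [m Hm]. rewrite <- (Hm (m + S (g n))) by lia.
  apply (proj1 (HD' _ _) K); lia.
Qed.

Theorem theorem4p2 : ~ proves (extend WKL0 wMPT) ACA0.
Proof.
  intros Hproves.
  destruct generic_exists as [A [c [Hlim Hc]]].
  destruct (tower_exists (generated A) (generated_ideal A) (generated_countable A))
    as [L [L0 [LI [Lmono [Ldom [Lrand LWKL]]]]]].
  set (M := fun f => exists i, L i f).
  assert (LM : forall i f, L i f -> M f) by (intros i f Hf; exists i; auto).
  assert (IM : ideal M).
  { split.
    - intros x. exists 0. apply (ideal_op _ (LI 0)).
    - intros f g [i Hi] [j Hj]. exists (i + j).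
      apply (ideal_join _ (LI (i + j))); [apply (Lmono i)|apply (Lmono j)]; auto; lia.
    - intros f g [i Hi] [j Hj] C. exists (i + j).
      apply (ideal_apf _ (LI (i + j))); auto; [apply (Lmono i)|apply (Lmono j)]; auto; lia. }
  assert (Mdom : forall i, dominated M (L i)).
  { intros i f [j Hj]. apply (Ldom i (i + j)); [lia|]. apply (Lmono j); auto. lia. }
  assert (MWKL : forall f, M f -> binary_infinite f -> exists y, M y /\ forall m, mem f (init y m)).
  { intros f [i Hi] Hb. destruct (LWKL i f Hi Hb) as [j [y [Hy Hp]]]. exists y. eauto. }
  assert (Hsound : forall p e r, extend WKL0 wMPT p -> (forall X, coded M (r X)) ->
    sat (coded M) e r p).
  { intros p e r [[Hp| ->]| ->] Hr.
    - destruct Hp as [p Hp|p Hp|p q Hp Hq].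
      + now apply basic_sound.
      + apply induction_sound.
      + now apply RCA0_comp_sound.
    - apply sat_WKL. now apply WKL_coded.
    - apply sat_wMPT. intros T [f [[i Hf] HT]] [[T1 T2] Hcof].
      destruct (Lrand i) as [z [Lz Hz]].
      destruct (Hcof (fun n => z n <> 0)) as [F [MF [[HFun HPath] [e' He]]]].
      { exists z. split; [eauto|tauto]. }
      destruct (coded_func M F IM MF HFun) as [y [My ->]].
      destruct (perfect_subtree_in_model M (L i) f y z e') as [h [Mh [Hh1 Hh2]]]; auto.
      + intros g Hg. eauto.
      + intros s m Hs. apply HT. apply HT in Hs. apply (T2 (enc s)). split; auto.
        split; [apply enc_Seq|]. apply Initial_enc, prefix_firstn.
      + intros m. apply HT, HPath. split; [apply enc_Seq|]. intros j v E.
        apply enc_Entry in E. apply graph_Pair.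
        assert (L' : j < m) by (rewrite <- (length_init y m); apply nth_error_Some; congruence).
        rewrite nth_error_init in E by auto. congruence.
      + intros n. destruct (He n) as [He1 He2]. destruct Hz as [Hz _]. specialize (Hz n).
        destruct (z n) as [|[|]]; [apply He2; lia|apply He1; lia|lia].
      + exists (fun c => h c <> 0). split; [exists h; split; auto; tauto|]. split; auto.
        intros n Hn. apply HT. auto. }
  apply (comprehension_fails M (L 0) A c); auto.
  - apply (LM 0). rewrite L0. apply generated_gen.
  - rewrite L0. apply generated_gen.
  - now rewrite L0.
  - assert (Harith : arithmetical settled_form) by (cbn; tauto).
    apply (sat_sound (coded M) (extend WKL0 wMPT) Hsound [] _ (Hproves _ (ACA0_comp _ Harith))).
    + intros _. apply coded_graph; auto. apply (LM 0). rewrite L0. apply generated_gen.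
    + intros q [].
Qed.
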